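(* Let $0<\alpha\le1$ and $$s_\alpha=\begin{cases}-3/4, & 0<\alpha\le 1/2,\\ -3/(5-2\alpha), & 1/2<\alpha\le 1.\end{cases}$$ Let $s\in(s_\alpha,0]$ and let $0<\delta\ll1$ (i.e. $\delta>0$ sufficiently small, depending on $s$ and $\alpha$). Then there exists $C_{s,\alpha}>0$ such that for any $u,v\in\mathcal{S}(\mathbb{R}^2)$, $$\|\partial_x(uv)\|_{X^{-1/2+\delta,s,\alpha}}\le C_{s,\alpha}\|u\|_{X^{1/2,s,\alpha}}\|v\|_{X^{1/2,s,\alpha}}.$$
   Context: $\mathcal{S}(\mathbb{R}^2)$ is the Schwartz space of functions of $(x,t)$. With $\widehat u(\xi,\tau)=\int_{\mathbb{R}^2}e^{-ix\xi}e^{-it\tau}u(x,t)\,dx\,dt$ and $\langle z\rangle=(1+|z|^2)^{1/2}$ for $z\in\mathbb{C}$, $$\|u\|_{X^{b,s,\alpha}}=\big\|\langle i(\tau-\xi^3)+|\xi|^{2\alpha}\rangle^b\langle\xi\rangle^s\widehat u(\xi,\tau)\big\|_{L^2(\mathbb{R}^2)}.$$ *)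

(* Defs.v *)
From mathcomp Require Import all_boot all_order all_algebra.
From mathcomp Require Import complex.
From mathcomp Require Import all_classical all_reals all_analysis.

Set Implicit Arguments.
Unset Strict Implicit.
Unset Printing Implicit Defensive.

Import Order.TTheory GRing.Theory Num.Theory.
Import numFieldNormedType.Exports.

Local Open Scope classical_set_scope.
Local Open Scope ring_scope.
Local Open Scope complex_scope.

(* Points of the plane are pairs [z = (x, t)], resp. [z = (xi, tau)] on the
   Fourier side.  [R[i]] is not a normed module over [R] in the library, so
   calculus and integration of complex-valued functions are defined through
   the real and imaginary parts. *)

Section Schwartz.
Variable R : realType.
Implicit Types (f : R * R -> R) (u : R * R -> R[i]).

Definition partial_x f : R * R -> R := fun z => 'D_((1, 0) : R * R) f z.
Definition partial_t f : R * R -> R := fun z => 'D_((0, 1) : R * R) f z.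

(* Iterated partial derivative along a word in the two directions;
   [true] stands for x, [false] for t. *)
Definition iter_partial (w : seq bool) f : R * R -> R :=
  foldr (fun b g => if b then partial_x g else partial_t g) f w.

(* ['D_v f] is a total operator; requiring each iterated partial derivative to
   be (Frechet) differentiable makes all of them genuine and continuous, so
   this is C^infinity. *)
Definition smooth2 f : Prop :=
  forall (w : seq bool) (z : R * R), differentiable (iter_partial w f) z.

Definition schwartz_real f : Prop :=
  smooth2 f /\
  forall (a b : nat) (w : seq bool), exists M : R, forall z : R * R,
    `|z.1 ^+ a * z.2 ^+ b * iter_partial w f z| <= M.

Definition schwartz u : Prop :=
  schwartz_real (fun z => complex.Re (u z)) /\
  schwartz_real (fun z => complex.Im (u z)).

Definition partial_x_complex u : R * R -> R[i] := fun z =>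
  partial_x (fun y => complex.Re (u y)) z +i*
  partial_x (fun y => complex.Im (u y)) z.

End Schwartz.

Section Bourgain.
Variable R : realType.
Implicit Types (u : R * R -> R[i]).

Definition lebesgue2 :
    {measure set (measurableTypeR R * measurableTypeR R) -> \bar R} :=
  (@lebesgue_measure R \x @lebesgue_measure R)%E.

Definition integral2 u : R[i] :=
  Rintegral lebesgue2 setT (fun z => complex.Re (u z)) +i*
  Rintegral lebesgue2 setT (fun z => complex.Im (u z)).

Definition L2norm u : \bar R :=
  ('N[lebesgue2]_2%:E [(fun z => (Normc.normc (u z))%:E)])%E.

Definition expi (theta : R) : R[i] := cos theta +i* sin theta.

Definition fourier u : R * R -> R[i] := fun zeta =>
  integral2 (fun z =>
    expi (- (z.1 * zeta.1)) * expi (- (z.2 * zeta.2)) * u z).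

Definition bracket (z : R[i]) : R := Num.sqrt (1 + Normc.normc z ^+ 2).

Definition Xweight (b s alpha : R) (zeta : R * R) : R :=
  let xi := zeta.1 in let tau := zeta.2 in
  bracket ((`|xi| `^ (2 * alpha)) +i* (tau - xi ^+ 3)) `^ b *
  bracket (xi%:C) `^ s.

Definition Xnorm (b s alpha : R) u : \bar R :=
  L2norm (fun zeta => (Xweight b s alpha zeta)%:C * fourier u zeta).

Definition s_crit (alpha : R) : R :=
  if alpha <= 1 / 2 then - (3 / 4) else - (3 / (5 - 2 * alpha)).

End Bourgain.

(* Main.v *)
(* On the Fourier side [partial_x] is multiplication by [i xi], and the transform
   of a product is dominated by the convolution of the absolute values of the
   transforms. The latter needs no inversion formula: regularise with
   [exp (- e |z|)], whose transform is a Poisson kernel, and let [e] tend to [0],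
   using that [u] is Lipschitz.
   What remains is to bound [|xi|] times the output weight by a kernel times the
   two input weights. Let [L] be the modulus of [i (tau - xi ^ 3) + |xi| ^ (2 a)].
   The resonance identity, i.e. the three values of [tau - xi ^ 3] differ by
   [3 xi xi1 xi2], makes the largest [L] at least of size [|xi xi1 xi2|], while the
   parabolic term always gives [L >= |xi| ^ (2 a)]. Distinguishing
   which [L] dominates, and whether the two remaining frequencies are close, the
   quotient of the weights is at most a sum of square roots of Schur weights.
   These inequalities are linear after taking logarithms.
   A Schur weight, in the variable that is integrated, is a sum of terms
   [|P'(x)| phi (P(x))] with [P] of degree at most two and [phi] integrable, times
   [phi (t - c (x))]; so its integral is bounded uniformly. Cauchy-Schwarz then
   bounds the trilinear form, and duality gives the estimate. *)
Require Import Defs.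
From HB Require Import structures.
From mathcomp Require Import all_boot all_order all_algebra.
From mathcomp Require Import complex.
From mathcomp Require Import all_classical all_reals all_analysis.
From mathcomp Require Import measurable_realfun.
From mathcomp Require Import ring lra.
Import Order.TTheory GRing.Theory Num.Theory.
Import numFieldNormedType.Exports.

Set Implicit Arguments.
Unset Strict Implicit.
Unset Printing Implicit Defensive.

Local Open Scope classical_set_scope.
Local Open Scope ring_scope.
Local Opaque powR.

(** * Integrals over the line and the plane *)

(** The Sobolev exponent enters only through some r >= - s, because 1 + |xi| <= (1 + |xi1|) (1 +
    |xi2|). The quotient of weights is squared, so that the modulations carry the exponents 1 - 2 q,
    1, 1; a small share is moved from the larger of two of them to the smaller one, which thereby
    reaches the integrable exponent p = 1 + 2 q. The obstacle is that the Jacobian of the resonance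
    function, 3 xi (xi1 - xi2), degenerates where the two remaining frequencies meet. There a strip
    of width (1 + |xi|) ^ e is treated separately and paid for by the parabolic term; e = 2 r - 2 +
    18 q is the width beyond which the Jacobian suffices. The value - 3 / (5 - 2 a) stems from two
    separated inputs, the larger of size N, with a low output. Up to terms in q, the Jacobian
    suffices if (1 + |xi|) ^ (2 r) >= N ^ (4 r - 3), which always holds for r <= 3 / 4; below that
    threshold the parabolic term of the larger input takes over, and the two ranges cover everything
    when r <= 3 / (5 - 2 a). *)

Lemma le_of_eq d (T : porderType d) (x y : T) : x = y -> (x <= y)%O.
Proof. by move=> ->. Qed.

Section IntegralOfReal.
Variables (d : measure_display) (T : measurableType d) (R : realType).
Variable nu : {measure set T -> \bar R}.
Implicit Types f g : T -> R.

Lemma ge0_integral_scale (c : R) f : measurable_fun [set: T] f ->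
  (forall x, 0 <= f x) -> 0 <= c ->
  (\int[nu]_x (c * f x)%:E = c%:E * \int[nu]_x (f x)%:E)%E.
Proof.
move=> mf f0 c0; under eq_integral do rewrite EFinM.
by rewrite ge0_integralZl_EFin// => [x _|]; [rewrite lee_fin|exact/measurable_EFinP].
Qed.

Lemma integral_EFin_ge0 f : (forall x, 0 <= f x) -> (0 <= \int[nu]_x (f x)%:E)%E.
Proof. by move=> f0; apply: integral_ge0 => x _; rewrite lee_fin. Qed.

Lemma ge0_le_integral_EFin f g : measurable_fun [set: T] f ->
  measurable_fun [set: T] g -> (forall x, 0 <= f x) -> (forall x, f x <= g x) ->
  (\int[nu]_x (f x)%:E <= \int[nu]_x (g x)%:E)%E.
Proof.
move=> mf mg f0 fg; apply: ge0_le_integral => // [x _|||x _].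
- by rewrite lee_fin.
- exact/measurable_EFinP.
- exact/measurable_EFinP.
- by rewrite lee_fin.
Qed.

Lemma ge0_integral_add3_le (h1 h2 h3 : T -> R) (b1 b2 b3 : \bar R) :
  measurable_fun [set: T] h1 -> measurable_fun [set: T] h2 ->
  measurable_fun [set: T] h3 ->
  (forall x, 0 <= h1 x) -> (forall x, 0 <= h2 x) -> (forall x, 0 <= h3 x) ->
  (\int[nu]_x (h1 x)%:E <= b1)%E -> (\int[nu]_x (h2 x)%:E <= b2)%E ->
  (\int[nu]_x (h3 x)%:E <= b3)%E ->
  (\int[nu]_x (h1 x + h2 x + h3 x)%:E <= b1 + b2 + b3)%E.
Proof.
move=> m1 m2 m3 h10 h20 h30 l1 l2 l3.
under eq_integral do rewrite EFinD EFinD.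
rewrite ge0_integralD//=; last 4 first.
- by move=> x _; rewrite -EFinD lee_fin addr_ge0.
- by apply: emeasurable_funD; exact/measurable_EFinP.
- by move=> x _; rewrite lee_fin.
- exact/measurable_EFinP.
rewrite ge0_integralD//=; last 4 first.
- by move=> x _; rewrite lee_fin.
- exact/measurable_EFinP.
- by move=> x _; rewrite lee_fin.
- exact/measurable_EFinP.
by apply: leeD => //; exact: leeD.
Qed.

End IntegralOfReal.

(** * Translation and reflection invariance on the line and the plane *)

Section Invariance.
Variable R : realType.
Local Notation RT := (measurableTypeR R).
Local Notation plane := (RT * RT)%type.
Local Notation mu := (@lebesgue_measure R).
Local Open Scope ereal_scope.

Lemma plane_tonelli (f : plane -> \bar R) :
  measurable_fun [set: plane] f -> (forall z, 0 <= f z) ->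
  \int[lebesgue2 R]_z f z = \int[mu]_x \int[mu]_t f (x, t).
Proof.
move=> mf f0. exact: fubini_tonelli1.
Qed.

Lemma lebesgue_measure_shift (a : R) (A : set R) : measurable A ->
  pushforward mu ((fun x => x + a)%R : _ -> RT) A = mu A.
Proof.
have mshift : measurable_fun [set: RT] ((fun x => x + a)%R : RT -> RT).
  exact: measurable_funD.
move=> mA; apply/esym.
apply: lebesgue_measure_unique => //= _ [[x y]] _ <-.
rewrite /pushforward.
have -> : (fun z : RT => z + a)%R @^-1` `]x, y]%classic = `](x - a)%R, (y - a)%R]%classic.
  by apply/seteqP; split => z /=; rewrite !in_itv/= ltrBlDr lerBrDr.
by rewrite !lebesgue_measure_itv/= !lte_fin ltrD2r -!EFinB opprB addrA subrK.
Qed.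

Lemma integral_shift (a : R) (f : R -> \bar R) :
  measurable_fun [set: RT] f -> (forall x, 0 <= f x) ->
  \int[mu]_x f (x + a)%R = \int[mu]_x f x.
Proof.
move=> mf f0.
have mshift : measurable_fun [set: RT] ((fun x => x + a)%R : RT -> RT).
  exact: measurable_funD.
transitivity (\int[pushforward mu ((fun x => x + a)%R : RT -> RT)]_x f x).
  by rewrite ge0_integral_pushforward//= preimage_setT.
by apply: eq_measure_integral => A mA _; apply/lebesgue_measure_shift.
Qed.

Lemma integral_reflect (f : R -> \bar R) :
  measurable_fun [set: RT] f -> (forall x, 0 <= f x) ->
  \int[mu]_x f (- x)%R = \int[mu]_x f x.
Proof.
move=> mf f0.
transitivity (\int[pushforward mu (-%R : RT -> RT)]_x f x).
  by rewrite ge0_integral_pushforward//= ?preimage_setT.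
by apply: eq_measure_integral => A mA _; apply/lebesgue_measureN.
Qed.

Lemma plane_integral_shift (a : plane) (f : plane -> \bar R) :
  measurable_fun [set: plane] f -> (forall x, 0 <= f x) ->
  \int[lebesgue2 R]_z f (z.1 + a.1, z.2 + a.2)%R = \int[lebesgue2 R]_z f z.
Proof.
move=> mf f0.
have ms : measurable_fun [set: plane] (fun z : plane => (z.1 + a.1, z.2 + a.2)%R : plane).
  apply: measurable_fun_pair; apply: measurable_funD => //; exact: measurable_fst || exact: measurable_snd.
rewrite !plane_tonelli//; last exact: measurableT_comp.
transitivity (\int[mu]_x \int[mu]_t f (x + a.1, t)%R).
  apply: eq_integral => x _ /=.
  apply: (@integral_shift a.2 (fun t => f (x + a.1, t)%R)) => //.
  by apply: measurableT_comp => //.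
apply: (@integral_shift a.1 (fun x => \int[mu]_t f (x, t))) => //.
  exact: measurable_fun_fubini_tonelli_F.
by move=> x; apply: integral_ge0.
Qed.

Lemma plane_integral_reflect (f : plane -> \bar R) :
  measurable_fun [set: plane] f -> (forall x, 0 <= f x) ->
  \int[lebesgue2 R]_z f (- z.1, - z.2)%R = \int[lebesgue2 R]_z f z.
Proof.
move=> mf f0.
have ms : measurable_fun [set: plane] (fun z : plane => (- z.1, - z.2)%R : plane).
  apply: measurable_fun_pair; apply: measurableT_comp => //; exact: measurable_fst || exact: measurable_snd.
rewrite !plane_tonelli//; last exact: measurableT_comp.
transitivity (\int[mu]_x \int[mu]_t f (- x, t)%R).
  apply: eq_integral => x _ /=.
  apply: (@integral_reflect (fun t => f (- x, t)%R)) => //.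
  by apply: measurableT_comp => //.
apply: (@integral_reflect (fun x => \int[mu]_t f (x, t))) => //.
  exact: measurable_fun_fubini_tonelli_F.
by move=> x; apply: integral_ge0.
Qed.

Lemma plane_integral_sub (a : plane) (f : plane -> \bar R) :
  measurable_fun [set: plane] f -> (forall x, 0 <= f x) ->
  \int[lebesgue2 R]_z f (a.1 - z.1, a.2 - z.2)%R = \int[lebesgue2 R]_z f z.
Proof.
move=> mf f0.
have ms : measurable_fun [set: plane] (fun z : plane => (z.1 + a.1, z.2 + a.2)%R : plane).
  apply: measurable_fun_pair; apply: measurable_funD => //; exact: measurable_fst || exact: measurable_snd.
rewrite -[RHS](plane_integral_shift a)//.
rewrite -(@plane_integral_reflect (fun z => f (z.1 + a.1, z.2 + a.2)%R))//.
- by apply: eq_integral => z _ /=; rewrite ![(- _ + _)%R]addrC.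
- exact: measurableT_comp.
Qed.

End Invariance.

(** * Uniform integrals of a decaying profile along quadratic polynomials *)

Section DecayIntegral.
Variable R : realType.
Local Notation RT := (measurableTypeR R).
Local Notation mu := (@lebesgue_measure R).
Implicit Types (f F : R -> R) (a b p v x y : R).

Lemma is_derive_continuous F (x l : R) : is_derive x (1 : R) F l -> {for x, continuous F}.
Proof.
by move=> [dF _]; apply: differentiable_continuous; exact/derivable1_diffP.
Qed.

Lemma integral_derivative f F a b : a <= b -> continuous f ->
  (forall x, is_derive x 1 F (f x)) ->
  (\int[mu]_(x in `[a, b]) (f x)%:E = (F b - F a)%:E)%E.
Proof.
rewrite le_eqVlt => /predU1P[<- _ _|ab cf dF].
  by rewrite set_itv1 integral_set1 subrr.
rewrite (@continuous_FTC2 _ f F)//; last first.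
- by move=> x _; rewrite derive1E; exact: derive_val.
- have cF x : F y @[y --> x] --> F x.
    exact: is_derive_continuous (dF x).
  split; first by move=> x _; case: (dF x).
  + by apply: cvg_at_right_filter; exact: cF.
  + by apply: cvg_at_left_filter; exact: cF.
- exact: continuous_subspaceT.
Qed.

Lemma integral_norm_derivative f F (M a b e : R) : a <= b -> continuous f ->
  (forall x, is_derive x 1 F (f x)) -> (forall x, `|F x| <= M) ->
  `|e| = 1 -> (forall x, a <= x <= b -> 0 <= e * f x) ->
  (\int[mu]_(x in `[a, b]) `|f x|%:E <= (2 * M)%:E)%E.
Proof.
move=> ab cf dF FM e1 sf.
have -> : (\int[mu]_(x in `[a, b]) `|f x|%:E =
           \int[mu]_(x in `[a, b]) (e * f x)%:E)%E.
  apply: eq_integral => x; rewrite inE/= in_itv/= => xab.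
  by rewrite -(ger0_norm (sf x xab)) normrM e1 mul1r.
rewrite (@integral_derivative _ (fun x => e * F x))//.
- rewrite lee_fin -mulrBr (le_trans (ler_norm _))// normrM e1 mul1r.
  by rewrite (le_trans (ler_normB _ _))// mulr_natl mulr2n lerD.
- by move=> x; apply: cvgM; [exact: cvg_cst|exact: cf].
Qed.

(** The derivative has constant sign on either side of [y0], so each half line contributes a
    difference of two values of [F], at most 2 M; intervals centred at [y0] exhaust the line. *)
Lemma integral_norm_derivative_le f F (M y0 e1 e2 : R) : continuous f ->
  (forall x, is_derive x 1 F (f x)) -> (forall x, `|F x| <= M) ->
  `|e1| = 1 -> (forall x, y0 <= x -> 0 <= e1 * f x) ->
  `|e2| = 1 -> (forall x, x <= y0 -> 0 <= e2 * f x) ->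
  (\int[mu]_x `|f x|%:E <= (4 * M)%:E)%E.
Proof.
move=> cf dF FM e1n s1 e2n s2.
have mf : measurable_fun [set: R] (fun x => `|f x|%:E : \bar R).
  apply/measurable_EFinP/measurableT_comp => //.
  exact: continuous_measurable_fun.
pose I n := `[y0 - n%:R, y0 + n%:R]%classic : set R.
have UI : \bigcup_n I n = [set: R].
  apply/seteqP; split => // x _.
  exists (Num.truncn `|x - y0|).+1 => //=; rewrite /I/= in_itv/=.
  have := truncnS_gt `|x - y0|; rewrite ltr_norml => /andP[? ?].
  by apply/andP; split; lra.
have cvgI : ((\int[mu]_(x in I n) `|f x|%:E)%E @[n --> \oo] --> (\int[mu]_x `|f x|%:E)%E).
  rewrite -UI; apply: ge0_nondecreasing_set_cvg_integral => //.
  - move=> n m nm; apply/subsetPset => x; rewrite /I /= !in_itv /= => /andP[? ?].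
    have ? : (n%:R : R) <= m%:R by rewrite ler_nat.
    by apply/andP; split; lra.
  - by move=> n; exact: measurable_itv.
  - by move=> n; exact: measurable_funTS.
rewrite -(cvg_lim _ cvgI)//; apply: lime_le; first by apply/cvg_ex; eexists; exact: cvgI.
apply: nearW => n.
have n0 : 0 <= n%:R :> R by [].
have fI (a b : R) : measurable_fun `[a, b] (fun x => `|f x|%:E : \bar R).
  exact: measurable_funTS.
have -> : I n = `[y0 - n%:R, y0[%classic `|` `[y0, y0 + n%:R]%classic.
  apply/seteqP; split => x; rewrite /I/= !in_itv/=.
    by move=> /andP[? ?]; have [|] := ltP x y0 => ?; [left|right]; apply/andP; split.
  by move=> [/andP[? ?]|/andP[? ?]]; apply/andP; split; lra.
rewrite ge0_integral_setU//=; last 2 first.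
- exact: measurable_funTS.
- by apply/disj_setPS => x /=; rewrite !in_itv/= => -[/andP[_ ?] /andP[? _]]; lra.
rewrite integral_itv_bndo_bndc; last first.
  exact: measurable_funTS.
have -> : (4 * M)%:E = ((2 * M)%:E + (2 * M)%:E)%E by rewrite -EFinD; congr EFin; ring.
apply: leeD.
- apply: (@integral_norm_derivative f F M _ _ e2) => //; first by lra.
  by move=> x /andP[_ ?]; exact: s2.
- apply: (@integral_norm_derivative f F M _ _ e1) => //; first by lra.
  by move=> x /andP[? _]; exact: s1.
Qed.

(** A smooth substitute for 1 + max 0 v. Being differentiable at 0, it yields a primitive in closed
    form valid on the whole line. *)
Definition softplus v : R := 1 + ln (1 + expR v).

Definition decay p v : R := (1 + `|v|) `^ (- p).

Lemma softplus_ge1 v : 1 <= softplus v.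
Proof. by rewrite /softplus lerDl ln_ge0// lerDl expR_ge0. Qed.

Lemma softplus_le v : 0 <= v -> softplus v <= 2 * (1 + `|v|).
Proof.
move=> v0; rewrite ger0_norm// /softplus.
have : ln (1 + expR v) <= 1 + v; last by lra.
rewrite -[leRHS]expRK ler_ln ?posrE ?expR_gt0//.
have e1 : 1 <= expR v by rewrite -expR0 ler_expR.
have e2 : 2 <= expR 1 :> R.
  by have := expR_ge1Dx (1 : R); lra.
rewrite expRD (le_trans (_ : _ <= 2 * expR v))//; first by lra.
by rewrite ler_pM2r// expR_gt0.
Qed.

Lemma is_derive_softplus v :
  is_derive v 1 softplus (expR v / (1 + expR v)).
Proof.
have e0 : 0 < 1 + expR v by rewrite ltr_pwDl// expR_ge0.
rewrite /softplus.
have H1 : is_derive v 1 (fun v => 1 + expR v) (0 + expR v) by exact: is_deriveD.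
have H2 := @is_derive1_ln R _ e0.
have H3 := @is_derive1_comp R (@ln R) (fun v => 1 + expR v) _ _ _ H2 H1.
rewrite (_ : expR v / _ = 0 + (1 + expR v)^-1 * (0 + expR v)).
  exact: is_deriveD.
by rewrite !add0r mulrC.
Qed.

Lemma is_derive_powR_softplus p v :
  is_derive v 1 (fun v => softplus v `^ (1 - p))
   ((1 - p) * softplus v `^ (- p) * (expR v / (1 + expR v))).
Proof.
have s0 : 0 < softplus v by rewrite (lt_le_trans _ (softplus_ge1 v)).
have := is_derive1_comp (@is_derive1_powR R (1 - p) _ s0) (is_derive_softplus v).
by rewrite (_ : 1 - p - 1 = - p)//; lra.
Qed.

(** A bounded function, increasing for p > 1, whose derivative dominates a multiple of [decay p]:
    the term in [v] supplies the derivative for positive [v], the term in [- v] for negative [v]. *)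
Definition decay_primitive p v : R :=
  softplus (- v) `^ (1 - p) - softplus v `^ (1 - p).

Definition decay_derivative p v : R :=
  (p - 1) * (softplus v `^ (- p) * (expR v / (1 + expR v)) +
             softplus (- v) `^ (- p) * (expR (- v) / (1 + expR (- v)))).

Lemma is_derive_decay_primitive p v :
  is_derive v 1 (decay_primitive p) (decay_derivative p v).
Proof.
have H1 := is_derive_powR_softplus p v.
have H2 := is_derive1_comp (is_derive_powR_softplus p (- v)) (@is_deriveN _ _ _ _ _ _ _ (is_derive_id v 1)).
have H3 := is_deriveB H2 H1.
apply: (@is_derive_eq _ _ _ _ _ _ _ _ H3); rewrite /decay_derivative.
by move: (_ `^ _) (_ `^ _) (_ / _) (_ / _) => A B C D; ring.
Qed.

Lemma decay_primitive_le1 p v : 1 <= p -> `|decay_primitive p v| <= 1.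
Proof.
move=> p1; have H w : 0 <= softplus w `^ (1 - p) <= 1.
  rewrite powR_ge0/= -[leRHS](powRr0 (softplus w)) ler_powR ?softplus_ge1//; lra.
have := H v; have := H (- v); rewrite /decay_primitive; move: (_ `^ _) (_ `^ _) => A B.
clear => /andP[? ?] /andP[? ?]; rewrite ler_norml; apply/andP; split; lra.
Qed.

Lemma decayN p v : decay p (- v) = decay p v.
Proof. by rewrite /decay normrN. Qed.

Lemma decay_ge0 p v : 0 <= decay p v.
Proof. exact: powR_ge0. Qed.

(** By evenness only nonnegative arguments matter. There [softplus] is at most twice 1 + |v|, which
    costs 2 ^ (- p), the logistic factor is at least 1 / 2, and the other summand is nonnegative. *)
Lemma decay_le_derivative p v : 1 <= p ->
  (p - 1) / 2 * 2 `^ (- p) * decay p v <= decay_derivative p v.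
Proof.
move=> p1.
have q0 (w : R) : 0 <= expR w / (1 + expR w).
  by rewrite divr_ge0// ?expR_ge0// addr_ge0// expR_ge0.
have H (w : R) : 0 <= w -> 2 `^ (- p) * decay p w * 2^-1 <= softplus w `^ (- p) * (expR w / (1 + expR w)).
  move=> w0; apply: ler_pM => //; first by rewrite mulr_ge0// ?decay_ge0// powR_ge0.
    rewrite /decay -powRM//.
    rewrite !powRN lef_pV2 ?posrE ?powR_gt0 ?(lt_le_trans _ (softplus_ge1 w))//.
    rewrite ge0_ler_powR ?nnegrE ?softplus_le//; first lra.
      by rewrite (le_trans _ (softplus_ge1 w)).
  have e1 : 1 <= expR w by rewrite -expR0 ler_expR.
  rewrite ler_pdivlMr; lra.
rewrite /decay_derivative -!mulrA ler_wpM2l ?subr_ge0//.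
have [v0|/ltW v0] := leP 0 v.
  by rewrite [leLHS]mulrC (le_trans (H v v0))// lerDl mulr_ge0// powR_ge0.
have := H (- v); rewrite decayN oppr_ge0 => /(_ v0) Hv.
by rewrite [leLHS]mulrC (le_trans Hv)// lerDr mulr_ge0// powR_ge0.
Qed.

Lemma continuous_decay_derivative p : continuous (decay_derivative p).
Proof.
have cs : continuous softplus.
  by move=> x; exact: is_derive_continuous (is_derive_softplus x).
have cg : continuous (fun v : R => softplus v `^ (- p)).
  move=> x; have := is_derive_continuous (is_derive_powR_softplus (1 + p) x).
  by rewrite (_ : 1 - (1 + p) = - p); last by ring.
have ce : continuous (fun v : R => expR v / (1 + expR v)).
  move=> x; apply: cvgM; first exact: continuous_expR.
  apply: cvgV; first by rewrite gt_eqF// ltr_pwDl// expR_ge0.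
  by apply: cvgD; [exact: cvg_cst|exact: continuous_expR].
have cN : continuous (fun v : R => - v) by move=> x; apply: cvgN; exact: cvg_id.
move=> x; apply: cvgM; first exact: cvg_cst.
apply: cvgD; apply: cvgM.
- exact: cg.
- exact: ce.
- exact: (continuous_comp (cN x) (cg _)).
- exact: (continuous_comp (cN x) (ce _)).
Qed.

Lemma measurable_decay p : measurable_fun [set: R] (decay p).
Proof.
apply: (measurableT_comp (f := fun z => z `^ (- p))); first exact: measurable_powR.
by apply: measurable_funD => //; exact: normr_measurable.
Qed.

(** Up to a constant the integrand is below the modulus of the derivative of [decay_primitive p]
    composed with the polynomial. That composition is bounded by 1 and has at most two monotone
    branches, so the bound does not depend on the coefficients. *)
Lemma integral_quadratic_decay p (a b c : R) : 1 < p ->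
  (\int[mu]_y (`|2 * a * y + b| * decay p (a * y ^+ 2 + b * y + c))%:E <=
   (4 / ((p - 1) / 2 * 2 `^ (- p)))%:E)%E.
Proof.
move=> p1; set K := (X in 4 / X).
have K0 : 0 < K by rewrite /K mulr_gt0 ?powR_gt0//; lra.
pose P y := a * y ^+ 2 + b * y + c.
pose P' y := 2 * a * y + b.
have dP y : is_derive y 1 P (P' y).
  have H1 := is_deriveX 2 (is_derive_id y (1:R)).
  have H2 := is_deriveZ a H1.
  have H3 := is_deriveZ b (is_derive_id y (1:R)).
  have H4 := is_deriveD (is_deriveD H2 H3) (is_derive_cst c y 1).
  apply: (@is_derive_eq _ _ _ _ _ _ _ _ H4).
  by rewrite /P'/GRing.scale/= expr1; ring.
have cP : continuous P.
  by move=> x; exact: is_derive_continuous (dP x).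
have cP' : continuous P'.
  by move=> x; apply: cvgD; [apply: cvgM; [exact: cvg_cst|exact: cvg_id]|exact: cvg_cst].
pose f y := decay_derivative p (P y) * P' y.
have cf : continuous f.
  move=> x; apply: cvgM; last exact: cP'.
  exact: (continuous_comp (cP x) (@continuous_decay_derivative p _)).
have dF y : is_derive y 1 (decay_primitive p \o P) (f y).
  exact: is_derive1_comp (is_derive_decay_primitive p _) (dP y).
have d0 v : 0 <= decay_derivative p v.
  apply: le_trans (decay_le_derivative _ (ltW p1)); rewrite mulr_ge0 ?decay_ge0//; exact: ltW.
have I4 : (\int[mu]_y `|f y|%:E <= (4 * 1)%:E)%E.
  have FM y : `|(decay_primitive p \o P) y| <= 1 by exact/decay_primitive_le1/ltW.
  (* For nonzero [a] the sign changes at the vertex - b / (2 a) only; for a = 0 it is constant, and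
     any splitting point will do. *)
  have [a0|a0|a0] := ltgtP a 0.
  - apply: (@integral_norm_derivative_le f _ 1 (- b / (2 * a)) (-1) 1 cf dF FM); rewrite ?normrN ?normr1//.
    + move=> x; rewrite ler_ndivrMr; last lra.
      by move=> ?; rewrite mulrCA mulr_ge0// /P'; lra.
    + move=> x; rewrite ler_ndivlMr; last lra.
      by move=> ?; rewrite mul1r mulr_ge0// /P'; lra.
  - apply: (@integral_norm_derivative_le f _ 1 (- b / (2 * a)) 1 (-1) cf dF FM); rewrite ?normrN ?normr1//.
    + move=> x; rewrite ler_pdivrMr; last lra.
      by move=> ?; rewrite mul1r mulr_ge0// /P'; lra.
    + move=> x; rewrite ler_pdivlMr; last lra.
      by move=> ?; rewrite mulrCA mulr_ge0// /P'; lra.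
  - pose e : R := if 0 <= b then 1 else -1.
    have en : `|e| = 1 by rewrite /e; case: ifP => _; rewrite ?normrN normr1.
    have eb x : 0 <= e * f x.
      rewrite /f mulrCA mulr_ge0// /P' a0 mulr0 mul0r add0r /e.
      by have [?|?] := leP 0 b; lra.
    exact: (@integral_norm_derivative_le f _ 1 0 e e cf dF FM).
have mf : measurable_fun [set: R] (fun y => K^-1 * `|f y|).
  apply: measurable_funM => //; apply: measurableT_comp => //.
  exact: continuous_measurable_fun.
apply: (@le_trans _ _ (\int[mu]_y (K^-1 * `|f y|)%:E)%E).
  apply: ge0_le_integral => //.
  - by move=> y _; rewrite lee_fin mulr_ge0 ?decay_ge0.
  - apply/measurable_EFinP; apply: measurable_funM.
      apply: measurableT_comp => //; exact: (continuous_measurable_fun cP').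
    exact: (measurableT_comp (measurable_decay p) (continuous_measurable_fun cP)).
  - exact/measurable_EFinP.
  - move=> y _; rewrite lee_fin ler_pdivlMl// mulrCA /f normrM mulrC.
    rewrite ler_wpM2r// ger0_norm//; exact/decay_le_derivative/ltW.
rewrite ge0_integral_scale ?invr_ge0 ?(ltW K0)//; last first.
  by apply: measurableT_comp => //; exact: continuous_measurable_fun.
rewrite mulrC EFinM; apply: lee_wpmul2l; first by rewrite lee_fin invr_ge0 ltW.
by rewrite (le_trans I4)// mulr1.
Qed.

End DecayIntegral.

(** * Schur weights and the trilinear form *)

Section Schur.
Variable R : realType.
Local Notation RT := (measurableTypeR R).
Local Notation plane := (RT * RT)%type.
Local Notation mu := (@lebesgue_measure R).
Implicit Types (p e : R) (w z : R * R).

(** Convertible with [lebesgue2], under a name of its own that receives the sigma-finite structure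
    required by Tonelli's theorem on pairs of points. *)
Definition plane_measure : set plane -> \bar R := (mu \x mu)%E.

HB.instance Definition _ := Measure.on plane_measure.

Let plane_measure_sigma_finite : sigma_finite [set: plane] plane_measure.
Proof.
pose I n : set RT := `[- n%:R, n%:R]%classic.
have mI n : measurable (I n) by exact: measurable_itv.
exists (fun n => I n `*` I n).
  apply/seteqP; split => // -[x t] _.
  exists (Num.truncn (`|x| + `|t|)).+1 => //.
  have := truncnS_gt (`|x| + `|t|).
  set N := (Num.truncn _).+1 => hN.
  have [? ?] : `|x| <= N%:R /\ `|t| <= N%:R.
    by split; apply: le_trans (ltW hN); rewrite ?lerDl ?lerDr.
  by split; rewrite /I/= in_itv/= -ler_norml.
move=> n; split; first exact: measurableX.
have Iy : (mu (I n) < +oo)%E.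
  by rewrite /I lebesgue_measure_itv/=; case: ifP => _; rewrite -?EFinD ltry.
by rewrite /plane_measure product_measure1E// lte_mul_pinfty// ge0_fin_numE.
Qed.

HB.instance Definition _ := Measure_isSigmaFinite.Build _ _ _
  plane_measure plane_measure_sigma_finite.

Local Notation lam := plane_measure.

(** The symbol of the Airy operator; it vanishes on the characteristic curve tau = xi ^ 3. *)
Definition phase z : R := z.2 - z.1 ^+ 3.

Definition vsub w z : R * R := (w.1 - z.1, w.2 - z.2).

(** Meant to be integrated in [z] with [w] fixed. In the second factor, the argument of the first
    profile equals phase z + phase (w - z), and its coefficient is the modulus of the derivative of
    that argument in [z.1]. The second summand serves when [z.1] is low. The third is a normalised
    bump on the strip |2 z.1 - w.1| <= (1 + |w.1|) ^ e, where that derivative may vanish. *)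
Definition schur_weight p e w z : R :=
  (decay p (phase z) + decay p (phase (vsub w z))) *
  (`|3 * w.1 * (2 * z.1 - w.1)| *
     decay p (phase w + 3 * w.1 * z.1 * (w.1 - z.1)) +
   decay p z.1 +
   2 * decay e w.1 * decay p ((2 * z.1 - w.1) * decay e w.1)).

Lemma schur_weight_ge0 p e w z : 0 <= schur_weight p e w z.
Proof.
have d0 q x : 0 <= @decay R q x := decay_ge0 q x.
by rewrite mulr_ge0 ?addr_ge0 ?mulr_ge0.
Qed.

Lemma measurable_phase d (T : measurableType d) (f : T -> plane) :
  measurable_fun [set: T] f -> measurable_fun [set: T] (fun x => phase (f x)).
Proof.
move=> mf; apply: measurable_funB.
  by apply: (measurableT_comp measurable_snd mf).
apply: measurable_funX; exact: (measurableT_comp measurable_fst mf).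
Qed.

Lemma measurable_schur_weight p e d (T : measurableType d) (f g : T -> plane) :
  measurable_fun [set: T] f -> measurable_fun [set: T] g ->
  measurable_fun [set: T] (fun x => schur_weight p e (f x) (g x)).
Proof.
move=> mf mg.
have mf1 : measurable_fun [set: T] (fun x => (f x).1 : R) := measurableT_comp measurable_fst mf.
have mf2 : measurable_fun [set: T] (fun x => (f x).2 : R) := measurableT_comp measurable_snd mf.
have mg1 : measurable_fun [set: T] (fun x => (g x).1 : R) := measurableT_comp measurable_fst mg.
have mg2 : measurable_fun [set: T] (fun x => (g x).2 : R) := measurableT_comp measurable_snd mg.
have md q (h : T -> R) : measurable_fun [set: T] h -> measurable_fun [set: T] (fun x => decay q (h x)).
  by move=> mh; exact: (measurableT_comp (measurable_decay q) mh).
have mphf := measurable_phase mf.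
have mphg := measurable_phase mg.
have mfg : measurable_fun [set: T] (fun x => vsub (f x) (g x) : plane).
  by apply: measurable_fun_pair; apply: measurable_funB.
have mphfg := measurable_phase mfg.
have m3f1 : measurable_fun [set: T] (fun x => 3 * (f x).1 : R) by exact: measurable_funM.
have m2g1 : measurable_fun [set: T] (fun x => 2 * (g x).1 - (f x).1 : R).
  by apply: measurable_funB => //; exact: measurable_funM.
apply: measurable_funM; first by apply: measurable_funD; exact: md.
apply: measurable_funD; first apply: measurable_funD.
- apply: measurable_funM.
    by apply: measurableT_comp => //; exact: measurable_funM.
  apply: md; apply: measurable_funD => //.
  apply: measurable_funM; first exact: measurable_funM.
  exact: measurable_funB.
- exact: md.
- have mde : measurable_fun [set: T] (fun x => decay e (f x).1) by exact: md.
  apply: measurable_funM; first exact: measurable_funM.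
  by apply: md; exact: measurable_funM.
Qed.

(** The bound of [integral_quadratic_decay], an upper bound for the integral of [decay p] and not
    its value. *)
Definition decay_mass p : R := 4 / ((p - 1) / 2 * 2 `^ (- p)).

Lemma decay_mass_gt0 p : 1 < p -> 0 < decay_mass p.
Proof. by move=> p1; rewrite divr_gt0// mulr_gt0 ?powR_gt0//; lra. Qed.

Lemma integral_decay p (c : R) : 1 < p ->
  (\int[mu]_x (decay p (x - c))%:E <= (decay_mass p)%:E)%E.
Proof.
move=> p1; have := integral_quadratic_decay 0 1 (- c) p1.
apply: le_trans; apply: le_of_eq.
by apply: eq_integral => x _; rewrite mulr0 !mul0r !add0r normr1 !mul1r.
Qed.

(** The 6 is two translates of the profile in the second coordinate times three quadratic profiles
    in the first. The exponent [e] enters only the coefficients of one of these, hence not the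
    bound. *)
Lemma integral_schur_weight p e w : 1 < p ->
  (\int[lam]_z (schur_weight p e w z)%:E <=
   (6 * decay_mass p ^+ 2)%:E)%E.
Proof.
move=> p1; have M0 := decay_mass_gt0 p1; set M := decay_mass p in M0 *.
have msw : measurable_fun [set: plane] (fun z => (schur_weight p e w z)%:E).
  by apply/measurable_EFinP; exact: measurable_schur_weight.
rewrite [leLHS](_ : _ = \int[mu]_x \int[mu]_t (schur_weight p e w (x, t))%:E)%E; last first.
  rewrite -(@plane_tonelli _ (fun z => (schur_weight p e w z)%:E))// => z.
  by rewrite lee_fin schur_weight_ge0.
have d0 q x : 0 <= @decay R q x := decay_ge0 q x.
have md (q : R) (h : R -> R) : measurable_fun [set: R] h -> measurable_fun [set: R] (fun x => decay q (h x)).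
  by move=> mh; exact: (measurableT_comp (measurable_decay q) mh).
pose B1 (x : R) : R := `|2 * (-3 * w.1) * x + 3 * w.1 ^+ 2| * decay p (- 3 * w.1 * x ^+ 2 + 3 * w.1 ^+ 2 * x + phase w).
pose B2 (x : R) : R := `|2 * 0 * x + 1| * decay p (0 * x ^+ 2 + 1 * x + 0).
pose B3 (x : R) : R := `|2 * 0 * x + 2 * decay e w.1| * decay p (0 * x ^+ 2 + (2 * decay e w.1) * x + (- w.1 * decay e w.1)).
have [B10 B20 B30] : [/\ forall x, 0 <= B1 x, forall x, 0 <= B2 x & forall x, 0 <= B3 x].
  by split => x; rewrite mulr_ge0.
have [mB1 mB2 mB3] : [/\ measurable_fun [set: RT] B1, measurable_fun [set: RT] B2 & measurable_fun [set: RT] B3].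
  have mq (a b c : R) : measurable_fun [set: R]
      (fun x : R => `|2 * a * x + b| * decay p (a * x ^+ 2 + b * x + c)).
    apply: measurable_funM.
      by apply: measurableT_comp => //; apply: measurable_funD.
    apply: md; apply: measurable_funD => //; apply: measurable_funD.
      apply: measurable_funM => //; exact: measurable_funX.
    exact: measurable_funM.
  by split; exact: mq.
have BE x t : schur_weight p e w (x, t) =
    (B1 x + B2 x + B3 x) * (decay p (t - x ^+ 3) + decay p (t - (w.2 - (w.1 - x) ^+ 3))).
  rewrite /schur_weight [LHS]mulrC; congr (_ * _).
    congr (_ + _ + _).
    - by rewrite /B1/= -normrN; congr (`|_| * decay p _); ring.
    - by rewrite /B2/= mulr0 !mul0r !add0r normr1 !mul1r addr0.
    - rewrite /B3/= mulr0 mul0r add0r normrM !ger0_norm//.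
      by congr (_ * decay p _); ring.
  congr (_ + _); rewrite -[LHS]decayN /phase/=; congr (decay p _); ring.
have h1 (c : R) : (\int[mu]_t (decay p (t - c))%:E <= M%:E)%E by exact: integral_decay.
have mdc (c : R) : measurable_fun [set: RT] (fun t : RT => (decay p (t - c))%:E).
  by apply/measurable_EFinP; apply: md; exact: measurable_funB.
apply: (@le_trans _ _ (\int[mu]_x ((2 * M)%:E * (B1 x + B2 x + B3 x)%:E))%E).
  apply: ge0_le_integral => //.
  - by move=> x _; apply: integral_ge0 => t _; rewrite lee_fin schur_weight_ge0.
  - apply: (@measurable_fun_fubini_tonelli_F _ _ RT RT R mu
      (fun z : plane => (schur_weight p e w z)%:E) msw).
    by move=> z; rewrite lee_fin schur_weight_ge0.
  - apply: measurable_funeM; apply/measurable_EFinP.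
    by apply: measurable_funD => //; exact: measurable_funD.
  - move=> x _; under eq_integral do rewrite BE EFinM.
    have ? : (0 <= B1 x + B2 x + B3 x) by rewrite !addr_ge0.
    rewrite ge0_integralZl_EFin//; last 2 first.
    + by move=> t _; rewrite lee_fin addr_ge0.
    + under eq_fun do rewrite EFinD; exact: emeasurable_funD.
    rewrite muleC; apply: lee_wpmul2r; first by rewrite lee_fin.
    under eq_integral do rewrite EFinD.
    rewrite ge0_integralD//; last 2 first.
    + by move=> t _; rewrite lee_fin.
    + by move=> t _; rewrite lee_fin.
    by rewrite mulr_natl mulr2n EFinD; apply: leeD.
rewrite ge0_integral_scale//; last 3 first.
- by apply: measurable_funD => //; exact: measurable_funD.
- by move=> x; rewrite !addr_ge0.
- by rewrite mulr_ge0// ltW.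
rewrite (_ : 6 * M ^+ 2 = (2 * M) * (M + M + M)); last by ring.
rewrite [leRHS]EFinM; apply: lee_wpmul2l; first by rewrite lee_fin mulr_ge0// ltW.
rewrite !EFinD.
apply: ge0_integral_add3_le => //; exact: integral_quadratic_decay.
Qed.

End Schur.

(** * The trilinear form on pairs of points *)

Section Trilinear.
Variable R : realType.
Local Notation RT := (measurableTypeR R).
Local Notation plane := (RT * RT)%type.
Local Notation plane2 := (plane * plane)%type.
Local Notation lam := (@plane_measure R).
Implicit Types (p e : R) (w z : R * R) (f g H : R * R -> R).

Lemma cauchy_schwarz d (T : measurableType d) (nu : {measure set T -> \bar R})
    (f g : T -> R) :
  measurable_fun [set: T] f -> measurable_fun [set: T] g ->
  (\int[nu]_x `|f x * g x|%:E <=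
   (\int[nu]_x (f x ^+ 2)%:E) `^ (2^-1) * (\int[nu]_x (g x ^+ 2)%:E) `^ (2^-1))%E.
Proof.
move=> mf mg.
have E (h : T -> R) : ('N[nu]_2%:E[EFin \o h] = (\int[nu]_x (h x ^+ 2)%:E) `^ (2^-1))%E.
  rewrite unlock; congr (_ `^ _)%E; apply: eq_integral => x _ /=.
  by rewrite powR_mulrn// real_normK// num_real.
have := @hoelder _ _ _ nu f g 2 2 mf mg; rewrite Lnorm1 !E; apply => //.
by lra.
Qed.

Definition plane_norm f : \bar R := ((\int[lam]_z (f z ^+ 2)%:E) `^ (2^-1))%E.

Lemma measurable_vsub d (T : measurableType d) (f g : T -> plane) :
  measurable_fun [set: T] f -> measurable_fun [set: T] g ->
  measurable_fun [set: T] (fun x => vsub (f x) (g x) : plane).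
Proof.
move=> mf mg; apply: measurable_fun_pair; apply: measurable_funB.
- exact: (measurableT_comp measurable_fst mf).
- exact: (measurableT_comp measurable_fst mg).
- exact: (measurableT_comp measurable_snd mf).
- exact: (measurableT_comp measurable_snd mg).
Qed.

Lemma integral_vsubl (a : R * R) (f : plane -> \bar R) :
  measurable_fun [set: plane] f -> (forall x, (0 <= f x)%E) ->
  (\int[lam]_z f (vsub a z) = \int[lam]_z f z)%E.
Proof. by move=> mf f0; exact: (plane_integral_sub a mf f0). Qed.

Lemma integral_vsubr (a : R * R) (f : plane -> \bar R) :
  measurable_fun [set: plane] f -> (forall x, (0 <= f x)%E) ->
  (\int[lam]_z f (vsub z a) = \int[lam]_z f z)%E.
Proof. by move=> mf f0; exact: (plane_integral_shift (- a.1, - a.2) mf f0). Qed.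

Lemma measurable_comp1 (f : plane -> R) : measurable_fun [set: plane] f ->
  measurable_fun [set: plane2] (fun x => f x.1).
Proof. by move=> mf; exact: (measurableT_comp mf measurable_fst). Qed.

Lemma measurable_comp2 (f : plane -> R) : measurable_fun [set: plane] f ->
  measurable_fun [set: plane2] (fun x => f x.2).
Proof. by move=> mf; exact: (measurableT_comp mf measurable_snd). Qed.

Lemma measurable_comp12 (f : plane -> R) : measurable_fun [set: plane] f ->
  measurable_fun [set: plane2] (fun x => f (vsub x.1 x.2)).
Proof.
move=> mf; apply: (measurableT_comp mf).
by apply: measurable_vsub; [exact: measurable_fst|exact: measurable_snd].
Qed.

Lemma measurable_sqr_EFin (h : plane -> R) : measurable_fun [set: plane] h ->
  measurable_fun [set: plane] (fun a => (h a ^+ 2)%:E).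
Proof. by move=> mh; apply/measurable_EFinP; exact: measurable_funX. Qed.

Lemma plane2_tonelli (h : plane * plane -> R) :
  measurable_fun [set: plane2] h -> (forall x, 0 <= h x) ->
  (\int[lam \x lam]_x (h x)%:E = \int[lam]_a \int[lam]_b (h (a, b))%:E)%E.
Proof.
move=> mh h0; apply: (@fubini_tonelli1 _ _ plane plane R lam lam (EFin \o h)).
  exact/measurable_EFinP.
by move=> x /=; rewrite lee_fin.
Qed.

Lemma plane2_tonelli_swap (h : plane * plane -> R) :
  measurable_fun [set: plane2] h -> (forall x, 0 <= h x) ->
  (\int[lam \x lam]_x (h x)%:E = \int[lam]_b \int[lam]_a (h (a, b))%:E)%E.
Proof.
move=> mh h0; apply: (@fubini_tonelli2 _ _ plane plane R lam lam (EFin \o h)).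
  exact/measurable_EFinP.
by move=> x /=; rewrite lee_fin.
Qed.

Section Weighted.
Variables (p e : R).
Hypothesis p1 : 1 < p.
Let A : R := 6 * decay_mass p ^+ 2.
Let S := @schur_weight R p e.

Let measurable_sqrt (h : plane2 -> R) : measurable_fun [set: plane2] h ->
  measurable_fun [set: plane2] (fun x => Num.sqrt (h x)).
Proof.
move=> mh; apply: (measurableT_comp _ mh).
by apply: continuous_measurable_fun; exact: sqrt_continuous.
Qed.

Lemma integral_mul_const_le (f : plane -> R) (W : plane -> plane -> R) :
  measurable_fun [set: plane] f ->
  (forall a, measurable_fun [set: plane] (W a)) -> (forall a b, 0 <= W a b) ->
  (forall a, (\int[lam]_b (W a b)%:E <= A%:E)%E) ->
  measurable_fun [set: plane2] (fun x => W x.1 x.2) ->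
  (\int[lam]_a \int[lam]_b (f a ^+ 2 * W a b)%:E <=
   A%:E * \int[lam]_a (f a ^+ 2)%:E)%E.
Proof.
move=> mf mW W0 WA mW2.
have A0 : 0 <= A by rewrite mulr_ge0// sqr_ge0.
have mf2 := measurable_sqr_EFin mf.
rewrite -ge0_integralZl_EFin//; last by move=> a _; rewrite lee_fin sqr_ge0.
apply: ge0_le_integral => //.
- by move=> a _; apply: integral_ge0 => b _; rewrite lee_fin mulr_ge0 ?sqr_ge0.
- apply: (@measurable_fun_fubini_tonelli_F _ _ plane plane R lam
      (fun x => (f x.1 ^+ 2 * W x.1 x.2)%:E)).
    apply/measurable_EFinP; apply: measurable_funM => //.
    by apply: measurable_funX; exact: measurable_comp1.
  by move=> x; rewrite lee_fin mulr_ge0 ?sqr_ge0.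
- exact: measurable_funeM.
move=> a _; rewrite ge0_integral_scale ?sqr_ge0//.
by rewrite muleC; apply: lee_wpmul2r; [rewrite lee_fin sqr_ge0|exact: WA].
Qed.

(** In use, [G a] is either [g] itself or [g] moved by a measure preserving map depending on [a], so
    that the square integral on the product space factors exactly. *)
Lemma integral_tensor f g (G : plane -> plane -> R) :
  measurable_fun [set: plane] f -> measurable_fun [set: plane] g ->
  (forall a, measurable_fun [set: plane] (G a)) ->
  (forall a, \int[lam]_b (G a b ^+ 2)%:E = \int[lam]_b (g b ^+ 2)%:E)%E ->
  (\int[lam]_a \int[lam]_b (f a ^+ 2 * G a b ^+ 2)%:E =
   \int[lam]_a (f a ^+ 2)%:E * \int[lam]_a (g a ^+ 2)%:E)%E.
Proof.
move=> mf mg mG GE.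
have sq0 (h : plane -> R) x : (0 <= (h x ^+ 2)%:E :> \bar R)%E by rewrite lee_fin sqr_ge0.
rewrite -ge0_integralZr//; [|exact: measurable_sqr_EFin|exact: integral_ge0].
apply: eq_integral => a _.
rewrite ge0_integral_scale ?sqr_ge0 ?GE//; first exact: measurable_funX.
by move=> b; exact: sqr_ge0.
Qed.

Let measurable_vsubl g a : measurable_fun [set: plane] g ->
  measurable_fun [set: plane] (fun b => g (vsub a b)).
Proof. by move=> mg; apply: (measurableT_comp mg); exact: measurable_vsub. Qed.

Let measurable_vsubr g a : measurable_fun [set: plane] g ->
  measurable_fun [set: plane] (fun b => g (vsub b a)).
Proof. by move=> mg; apply: (measurableT_comp mg); exact: measurable_vsub. Qed.

Let integral_sqr_vsubl g a : measurable_fun [set: plane] g ->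
  (\int[lam]_b (g (vsub a b) ^+ 2)%:E = \int[lam]_b (g b ^+ 2)%:E)%E.
Proof.
move=> mg; apply: (integral_vsubl a (measurable_sqr_EFin mg)) => z.
by rewrite lee_fin sqr_ge0.
Qed.

Let integral_sqr_vsubr g a : measurable_fun [set: plane] g ->
  (\int[lam]_b (g (vsub b a) ^+ 2)%:E = \int[lam]_b (g b ^+ 2)%:E)%E.
Proof.
move=> mg; apply: (integral_vsubr a (measurable_sqr_EFin mg)) => z.
by rewrite lee_fin sqr_ge0.
Qed.

Lemma product_cauchy_schwarz (F M : plane * plane -> R) (DF DM : \bar R) :
  measurable_fun [set: plane2] F ->
  measurable_fun [set: plane2] M ->
  (forall x, 0 <= F x) -> (forall x, 0 <= M x) ->
  (\int[lam \x lam]_x (F x ^+ 2)%:E <= DF)%E ->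
  (\int[lam \x lam]_x (M x ^+ 2)%:E <= DM)%E ->
  (\int[lam \x lam]_x (F x * M x)%:E <= DF `^ (2^-1) * DM `^ (2^-1))%E.
Proof.
move=> mF mM F0 M0 hF hM.
have FM x : 0 <= F x * M x by rewrite mulr_ge0.
have := @cauchy_schwarz _ _ (lam \x lam)%E F M mF mM.
under eq_integral do rewrite ger0_norm//.
move=> /le_trans; apply.
have i0 (h : plane * plane -> R) : (0 <= \int[lam \x lam]_x (h x ^+ 2)%:E)%E.
  by apply: integral_ge0 => b _; rewrite lee_fin sqr_ge0.
have h2 : 0 <= 2^-1 :> R by [].
apply: lee_pmul; rewrite ?poweR_ge0//.
- by apply: gt0_ler_poweR => //; rewrite in_itv/= leey andbT// (le_trans (i0 _) hF).
- by apply: gt0_ler_poweR => //; rewrite in_itv/= leey andbT// (le_trans (i0 _) hM).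
Qed.

(** One square root for each of the three points that can be kept fixed: the output [w], the input
    [z] and the input [vsub w z]. *)
Definition schur_majorant w z : R :=
  Num.sqrt (S w z) + Num.sqrt (S z w) + Num.sqrt (S (vsub w z) w).

Let trilinear_split (h k l a b c : R) :
  h * ((a + b + c) * (k * l)) = h * a * (k * l) + k * b * (h * l) + l * c * (h * k).
Proof. by ring. Qed.

(** Each square root is attached to the function of the point that its weight keeps fixed.
    Cauchy-Schwarz on the product space then separates that function times the weight, controlled by
    the mass of the weight, from the product of the two other functions, whose square integral
    factors. *)
Lemma trilinear_schur H f g :
  measurable_fun [set: plane] H -> measurable_fun [set: plane] f ->
  measurable_fun [set: plane] g ->
  (forall z, 0 <= H z) -> (forall z, 0 <= f z) -> (forall z, 0 <= g z) ->
  (\int[lam]_w \int[lam]_z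
     (H w * (schur_majorant w z * (f z * g (vsub w z))))%:E <=
   (3 * Num.sqrt A)%:E * (plane_norm H * plane_norm f * plane_norm g))%E.
Proof.
move=> mH mf mg H0 f0 g0.
have S0 a b : 0 <= S a b := schur_weight_ge0 _ _ _ _.
have A0 : 0 <= A by rewrite mulr_ge0// sqr_ge0.
have m1 : measurable_fun [set: plane2] (fun x : plane * plane => x.1) by exact: measurable_fst.
have m2 : measurable_fun [set: plane2] (fun x : plane * plane => x.2) by exact: measurable_snd.
have m12 := measurable_vsub m1 m2.
have mS : [/\ measurable_fun [set: plane2] (fun x => S x.1 x.2),
    measurable_fun [set: plane2] (fun x => S x.2 x.1) &
    measurable_fun [set: plane2] (fun x => S (vsub x.1 x.2) x.1)].
  by split; exact: measurable_schur_weight.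
have msS a : measurable_fun [set: plane] (S a) by exact: measurable_schur_weight.
have [mS1 mS2 mS3] := mS.
have SA a : (\int[lam]_b (S a b)%:E <= A%:E)%E by exact: integral_schur_weight.
pose F1 x := H x.1 * Num.sqrt (S x.1 x.2).
pose M1 x := f x.2 * g (vsub x.1 x.2).
pose F2 x := f x.2 * Num.sqrt (S x.2 x.1).
pose M2 x := H x.1 * g (vsub x.1 x.2).
pose F3 x := g (vsub x.1 x.2) * Num.sqrt (S (vsub x.1 x.2) x.1).
pose M3 x := H x.1 * f x.2.
have mH1 := measurable_comp1 mH.
have mf2 := measurable_comp2 mf.
have mg12 := measurable_comp12 mg.
have mF1 : measurable_fun [set: plane2] F1 := measurable_funM mH1 (measurable_sqrt mS1).
have mF2 : measurable_fun [set: plane2] F2 := measurable_funM mf2 (measurable_sqrt mS2).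
have mF3 : measurable_fun [set: plane2] F3 := measurable_funM mg12 (measurable_sqrt mS3).
have mM1 : measurable_fun [set: plane2] M1 := measurable_funM mf2 mg12.
have mM2 : measurable_fun [set: plane2] M2 := measurable_funM mH1 mg12.
have mM3 : measurable_fun [set: plane2] M3 := measurable_funM mH1 mf2.
have F10 x : 0 <= F1 x by rewrite mulr_ge0 ?sqrtr_ge0.
have F20 x : 0 <= F2 x by rewrite mulr_ge0 ?sqrtr_ge0.
have F30 x : 0 <= F3 x by rewrite mulr_ge0 ?sqrtr_ge0.
have M10 x : 0 <= M1 x by rewrite mulr_ge0.
have M20 x : 0 <= M2 x by rewrite mulr_ge0.
have M30 x : 0 <= M3 x by rewrite mulr_ge0.
have FE x : H x.1 * (schur_majorant x.1 x.2 * (f x.2 * g (vsub x.1 x.2))) =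
    F1 x * M1 x + F2 x * M2 x + F3 x * M3 x.
  exact: trilinear_split.
have mFM1 := measurable_funM mF1 mM1.
have mFM2 := measurable_funM mF2 mM2.
have mFM3 := measurable_funM mF3 mM3.
have FM10 x : 0 <= F1 x * M1 x := mulr_ge0 (F10 x) (M10 x).
have FM20 x : 0 <= F2 x * M2 x := mulr_ge0 (F20 x) (M20 x).
have FM30 x : 0 <= F3 x * M3 x := mulr_ge0 (F30 x) (M30 x).
rewrite [leLHS](_ : _ = \int[lam \x lam]_x (F1 x * M1 x + F2 x * M2 x + F3 x * M3 x)%:E)%E; last first.
  rewrite plane2_tonelli; last 2 first.
  - exact: (measurable_funD (measurable_funD mFM1 mFM2) mFM3).
  - by move=> x; exact: (addr_ge0 (addr_ge0 (FM10 x) (FM20 x)) (FM30 x)).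
  by apply: eq_integral => w _; apply: eq_integral => z _; rewrite -(FE (w, z)).
have sq2 (h : plane -> R) : (0 <= \int[lam]_a (h a ^+ 2)%:E)%E.
  by apply: integral_ge0 => a _; rewrite lee_fin sqr_ge0.
have sqS (r q : R) : 0 <= q -> (r * Num.sqrt q) ^+ 2 = r ^+ 2 * q.
  by move=> q0; rewrite exprMn sqr_sqrtr.
have swapS (h : plane -> R) : measurable_fun [set: plane] h ->
    (\int[lam]_b \int[lam]_a (h b ^+ 2 * S b a)%:E <= A%:E * \int[lam]_a (h a ^+ 2)%:E)%E.
  by move=> mh; apply: integral_mul_const_le.
have sF1 a b : F1 (a, b) ^+ 2 = H a ^+ 2 * S a b := sqS _ _ (S0 _ _).
have sF2 a b : F2 (a, b) ^+ 2 = f b ^+ 2 * S b a := sqS _ _ (S0 _ _).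
have sF3 a b : F3 (a, b) ^+ 2 = g (vsub a b) ^+ 2 * S (vsub a b) a := sqS _ _ (S0 _ _).
have sM1 a b : M1 (a, b) ^+ 2 = f b ^+ 2 * g (vsub a b) ^+ 2 := exprMn _ _ _.
have sM2 a b : M2 (a, b) ^+ 2 = H a ^+ 2 * g (vsub a b) ^+ 2 := exprMn _ _ _.
have sM3 a b : M3 (a, b) ^+ 2 = H a ^+ 2 * f b ^+ 2 := exprMn _ _ _.
have R1 : (\int[lam \x lam]_x (F1 x * M1 x)%:E <=
    (A%:E * \int[lam]_a (H a ^+ 2)%:E) `^ 2^-1 *
    (\int[lam]_a (f a ^+ 2)%:E * \int[lam]_a (g a ^+ 2)%:E) `^ 2^-1)%E.
  apply: (product_cauchy_schwarz mF1 mM1 F10 M10).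
  - rewrite plane2_tonelli; [|exact: (measurable_funX 2 mF1)|by move=> x; exact: sqr_ge0].
    by under eq_integral do under eq_integral do rewrite sF1; exact: swapS.
  - rewrite plane2_tonelli_swap; [|exact: (measurable_funX 2 mM1)|by move=> x; exact: sqr_ge0].
    by under eq_integral do under eq_integral do rewrite sM1;
      apply: le_of_eq; apply: (@integral_tensor _ g (fun b a => g (vsub a b))) => // a;
      [exact: measurable_vsubr|exact: integral_sqr_vsubr].
have R2 : (\int[lam \x lam]_x (F2 x * M2 x)%:E <=
    (A%:E * \int[lam]_a (f a ^+ 2)%:E) `^ 2^-1 *
    (\int[lam]_a (H a ^+ 2)%:E * \int[lam]_a (g a ^+ 2)%:E) `^ 2^-1)%E.
  apply: (product_cauchy_schwarz mF2 mM2 F20 M20).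
  - rewrite plane2_tonelli_swap; [|exact: (measurable_funX 2 mF2)|by move=> x; exact: sqr_ge0].
    by under eq_integral do under eq_integral do rewrite sF2; exact: swapS.
  - rewrite plane2_tonelli; [|exact: (measurable_funX 2 mM2)|by move=> x; exact: sqr_ge0].
    by under eq_integral do under eq_integral do rewrite sM2;
      apply: le_of_eq; apply: (@integral_tensor _ g (fun a b => g (vsub a b))) => // a;
      [exact: measurable_vsubl|exact: integral_sqr_vsubl].
have R3 : (\int[lam \x lam]_x (F3 x * M3 x)%:E <=
    (A%:E * \int[lam]_a (g a ^+ 2)%:E) `^ 2^-1 *
    (\int[lam]_a (H a ^+ 2)%:E * \int[lam]_a (f a ^+ 2)%:E) `^ 2^-1)%E.
  apply: (product_cauchy_schwarz mF3 mM3 F30 M30).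
  - rewrite plane2_tonelli; [|exact: (measurable_funX 2 mF3)|by move=> x; exact: sqr_ge0].
    (* Replacing b by a - b, for fixed a, turns the point that the third weight keeps fixed into an
       independent variable. *)
    rewrite (_ : (\int[lam]_a _)%E = (\int[lam]_a \int[lam]_b (g b ^+ 2 * S b a)%:E)%E).
      have mgS := measurable_funM (measurable_funX 2 (measurable_comp2 mg)) mS2.
      have gS0 (x : plane * plane) : 0 <= g x.2 ^+ 2 * S x.2 x.1.
        by rewrite mulr_ge0 ?sqr_ge0.
      apply: le_trans (swapS _ mg); apply: le_of_eq.
      exact: (etrans (esym (plane2_tonelli mgS gS0)) (plane2_tonelli_swap mgS gS0)).
    apply: eq_integral => a _; under eq_integral do rewrite sF3.
    apply: (@integral_vsubl a (fun b => (g b ^+ 2 * S b a)%:E)).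
      apply/measurable_EFinP; apply: measurable_funM; first exact: measurable_funX.
      exact: measurable_schur_weight.
    by move=> b; rewrite lee_fin mulr_ge0 ?sqr_ge0.
  - rewrite plane2_tonelli; [|exact: (measurable_funX 2 mM3)|by move=> x; exact: sqr_ge0].
    by under eq_integral do under eq_integral do rewrite sM3; apply: le_of_eq; exact: (@integral_tensor _ f (fun=> f)).
have E h1 h2 h3 : ((A%:E * \int[lam]_a (h1 a ^+ 2)%:E) `^ 2^-1 *
    (\int[lam]_a (h2 a ^+ 2)%:E * \int[lam]_a (h3 a ^+ 2)%:E) `^ 2^-1 =
    (Num.sqrt A)%:E * (plane_norm h1 * plane_norm h2 * plane_norm h3))%E.
  rewrite !poweRM//.
  by rewrite poweR_EFin powR12_sqrt// -!muleA.
move: R1 R2 R3; rewrite !E => R1 R2 R3.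
apply: (le_trans (ge0_integral_add3_le mFM1 mFM2 mFM3 FM10 FM20 FM30 R1 R2 R3)).
rewrite (muleC (plane_norm f) (plane_norm H)).
rewrite (_ : (plane_norm g * plane_norm H * plane_norm f =
  plane_norm H * plane_norm f * plane_norm g)%E); last first.
  by rewrite -muleA muleC.
set N := (plane_norm H * _ * _)%E.
have N0 : (0 <= N)%E by rewrite /N !mule_ge0 ?poweR_ge0.
rewrite -!ge0_muleDl ?lee_fin ?sqrtr_ge0 ?addr_ge0 ?sqrtr_ge0//.
rewrite -!EFinD (_ : _ + _ + _ = 3 * Num.sqrt A)//.
by move: (Num.sqrt A) => t; ring.
Qed.

End Weighted.
End Trilinear.

(** * The pointwise kernel bound *)

Section LogEstimates.
Variable R : realFieldType.
Variables (a ia r q k : R).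

(** [ia] is the inverse of [a]. The bounds on 2 r keep leftover coefficients of the right sign. The
    condition with [ia] lets the parabolic term absorb a power |xi| ^ (8 q) when an input is low.
    The last one is the price of the strip around coinciding frequencies. *)
Definition admissible : Prop :=
  [/\ [/\ 0 < a, a <= 1, a * ia = 1 & 0 < q],
      1 + 6 * q <= 2 * r, 2 * r <= 2 - 6 * q,
      4 * q * (1 + ia) <= 1 - 2 * q &
      4 * r - 3 - 2 * a + 32 * q <= 0].

(** For q = 0 the alternatives read r <= 3 / 4 and (5 - 2 a) r <= 3, the two branches of the
    critical exponent. *)
Definition admissible_low : Prop :=
  4 * r - 3 + 12 * q <= 0 \/
  (2 - 2 * r + 12 * q) * (4 * r - 3 + 12 * q) +
  (4 * r - 2 + 12 * q - 2 * a) * (2 * r - 6 * q) <= 0.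

(* [L], [X] stand for the logarithms of [|xi|] and [1 + |xi|], [nu] for that of the
   largest frequency, [l], [M] for those of the modulations, [D] for that of the
   distance between two frequencies, and [k] for [ln 8], the constant lost in a
   comparison. The Sobolev weights contribute [G], with exponent [r >= - s]. *)
Implicit Types (L X l M G s U D Y B nu c x y : R).

(** The multipliers of the hypotheses contain the variables r and q. Once these products are
    supplied as nonnegative terms, every estimate below is linear in the resulting monomials. *)
Let slack c x y : 0 <= c -> x <= y -> 0 <= c * (y - x).
Proof. by move=> c0 xy; rewrite mulr_ge0 ?subr_ge0. Qed.

Let admissible_bounds : admissible ->
  [/\ [/\ 0 <= q, 0 <= 1 - 6 * q, 0 <= 1 - 4 * q & 0 <= 1 - 2 * q],
      0 <= r, 0 <= 1 - r, 0 <= 2 * r - (1 + 6 * q) & 0 <= 2 - 6 * q - 2 * r].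
Proof. by move=> [[_ _ _ q0] hr1 hr2 _ _]; split; [split|..]; lra. Qed.

(** Since (1 - 2 q) max + (1 + 2 q) min <= max + min, the smaller input modulation gets the
    integrable exponent, and the larger keeps 1 - 2 q for the case estimate. Passing from that
    modulation to [s1] or [s2] costs (1 + 2 q) k <= 2 k, whence 38 becomes 40. *)
Lemma log_split_output L G l l1 l2 s1 s2 B :
  admissible -> 0 <= k -> 0 <= l1 -> 0 <= l2 -> s1 <= l1 + k -> s2 <= l2 + k ->
  2 * L + 2 * r * G - (1 - 2 * q) * l - (1 - 2 * q) * Num.max l1 l2 <=
    38 * k + B ->
  2 * L + 2 * r * G - (1 - 2 * q) * l - l1 - l2 <=
    40 * k - (1 + 2 * q) * s1 + B \/
  2 * L + 2 * r * G - (1 - 2 * q) * l - l1 - l2 <=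
    40 * k - (1 + 2 * q) * s2 + B.
Proof.
move=> /admissible_bounds[[q0 q6 _ _] _ _ _ _] k0 hl1 hl2 hs1 hs2.
have p0 : 0 <= 1 + 2 * q by rewrite addr_ge0// mulr_ge0.
have k1 := mulr_ge0 q6 k0.
have [h|/ltW h] := leP l1 l2 => hB; [left|right].
  have := slack p0 hs1; have := slack q0 h; clear hl1 hl2 hs1 hs2 q0 q6 p0 h; lra.
have := slack p0 hs2; have := slack q0 h; clear hl1 hl2 hs1 hs2 q0 q6 p0 h; lra.
Qed.

(** The same exchange when an input modulation dominates. The output modulation has only the
    exponent 1 - 2 q to begin with, so raising it to 1 + 2 q leaves 1 - 4 q for the other one. *)
Lemma log_split_input L G l l1 l2 s s2 B :
  admissible -> 0 <= k -> 0 <= l -> 0 <= l2 -> s <= l + k -> s2 <= l2 + k ->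
  2 * L + 2 * r * G - l1 - (1 - 4 * q) * Num.max l l2 <= 38 * k + B ->
  2 * L + 2 * r * G - (1 - 2 * q) * l - l1 - l2 <=
    40 * k - (1 + 2 * q) * s + B \/
  2 * L + 2 * r * G - (1 - 2 * q) * l - l1 - l2 <=
    40 * k - (1 + 2 * q) * s2 + B.
Proof.
move=> /admissible_bounds[[q0 q6 _ _] _ _ _ _] k0 hl hl2 hs hs2.
have p0 : 0 <= 1 + 2 * q by rewrite addr_ge0// mulr_ge0.
have k1 := mulr_ge0 q6 k0.
have [h|/ltW h] := leP l l2 => hB; [left|right].
  have := slack p0 hs; have := slack q0 h; clear hl hl2 hs hs2 q0 q6 p0 h; lra.
have := slack p0 hs2; have := slack q0 h; clear hl hl2 hs hs2 q0 q6 p0 h; lra.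
Qed.

Lemma log_small_frequencies L G l M Y :
  admissible -> 0 <= k ->
  L <= k -> G <= 2 * k -> 0 <= l -> 0 <= M -> Y <= k ->
  2 * L + 2 * r * G - (1 - 2 * q) * l - (1 - 2 * q) * M <=
    38 * k - (1 + 2 * q) * Y.
Proof.
move=> /admissible_bounds[[q0 q6 _ q2] r0 r1 _ _] k0 hL hG hl hM hY.
have h1 := slack r0 hG.
have h2 := mulr_ge0 q2 hl; have h3 := mulr_ge0 q2 hM.
have h4 := slack q0 hY; have h5 := mulr_ge0 q6 k0; have h6 := mulr_ge0 r1 k0.
clear q0 q6 q2 r0 r1 hl hM hG; lra.
Qed.

Lemma log_low_high L X G l M U D :
  admissible -> 0 <= k ->
  L - k <= D -> G <= k -> 0 <= l -> U <= l + 2 * X + k -> U <= M + k ->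
  2 * a * X <= l + k ->
  2 * L + 2 * r * G - (1 - 2 * q) * l - (1 - 2 * q) * M <=
    38 * k + (L + D - (1 + 2 * q) * U).
Proof.
move=> adm k0 hD hG hl hU hUM hlX.
have [[q0 q6 _ q2] r0 r1 _ _] := admissible_bounds adm.
have [[a0 _ aia _] _ _ hia _] := adm.
have ia0 : 0 <= ia by rewrite ltW// -(pmulr_rgt0 _ a0) aia.
have h1 := slack r0 hG; have h2 := slack q0 hU.
have h3 : 0 <= q * (ia * (l + k) - 2 * X).
  rewrite mulr_ge0//; have := slack ia0 hlX.
  have -> : ia * (l + k - 2 * a * X) = ia * (l + k) - 2 * (a * ia) * X by ring.
  by rewrite aia mulr1.
rewrite -subr_ge0 in hia.
have h4 := mulr_ge0 hia hl; have h5 := mulr_ge0 hia k0; have h6 := mulr_ge0 r1 k0.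
have h7 := mulr_ge0 q0 k0; have h8 := mulr_ge0 q6 k0; have h9 := slack q2 hUM.
clear hia aia a0 q0 q6 q2 r0 r1 ia0 hl hU hUM hG hlX adm; lra.
Qed.

(** The resonance bound is used with multiplier 1 - 6 q, and 4 q l completes the exponent of U. What
    remains is (4 r - 3 + 12 q) nu against (2 r - 6 q) X, which is the last hypothesis. *)
Lemma log_output_separated L L1 L2 X G l M U D nu :
  admissible -> 0 <= k ->
  G <= L1 + L2 + 2 * k - X -> L <= X ->
  M <= l -> L + L1 + L2 <= l -> U <= M + k ->
  L1 <= nu -> L2 <= nu -> nu - k <= D ->
  (4 * r - 3 + 12 * q) * nu <= (2 * r - 6 * q) * X ->
  2 * L + 2 * r * G - (1 - 2 * q) * l - (1 - 2 * q) * M <=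
    38 * k + (L + D - (1 + 2 * q) * U).
Proof.
move=> /admissible_bounds[[q0 q6 _ q2] r0 r1 hr _] k0 hG hLX hM hg hU hn1 hn2 hD hst.
have q3 : 0 <= 2 * r - 1 + 6 * q by lra.
have h1 := slack r0 hG; have h2 := slack q6 hg; have h3 := slack q0 hLX.
have h4 := slack q3 hn1; have h5 := slack q3 hn2.
have h6 := mulr_ge0 r1 k0; have h7 := mulr_ge0 q0 k0; have h8 := mulr_ge0 q6 k0.
have g3 := slack q2 hU; have g4 := slack q0 hU; have g5 := slack q0 hM.
clear hr q0 q6 q2 q3 r0 r1 hG hLX hM hg hU hn1 hn2; lra.
Qed.

(** Origin of the strip exponent: when all frequencies are comparable, 2 + 2 r - 3 (1 - 6 q) powers
    of the frequency have to be covered. The Jacobian contributes one through L, and the distance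
    must supply the other 2 r - 2 + 18 q. *)
Lemma log_output_comparable_far L X G l M U D :
  admissible -> 0 <= k ->
  G <= X + 2 * k -> L <= X -> M <= l -> 3 * X - 3 * k <= l -> U <= M + k ->
  (2 * r - 2 + 18 * q) * X <= D ->
  2 * L + 2 * r * G - (1 - 2 * q) * l - (1 - 2 * q) * M <=
    38 * k + (L + D - (1 + 2 * q) * U).
Proof.
move=> /admissible_bounds[[q0 q6 _ q2] r0 r1 hr _] k0 hG hLX hM hl hU hD.
have h1 := slack r0 hG; have h2 := slack q6 hl.
have h6 := mulr_ge0 r1 k0; have h7 := mulr_ge0 q0 k0; have h8 := mulr_ge0 q6 k0.
have g3 := slack q2 hU; have g4 := slack q0 hU; have g5 := slack q0 hM.
clear hr q0 q6 q2 r0 r1 hG hM hl hU; lra.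
Qed.

(** Inside the strip the Jacobian gives nothing. The resonance 3 X in l and the parabolic bound 2 a
    X in M must also pay for the normalisation of the strip, which is possible because 4 r - 3 - 2 a
    + 32 q <= 0. *)
Lemma log_output_comparable_near L X G l M :
  admissible -> 0 <= k ->
  0 <= X -> G <= X + 2 * k -> L <= X -> 3 * X - 3 * k <= l ->
  2 * a * X - 3 * k <= M ->
  2 * L + 2 * r * G - (1 - 2 * q) * l - (1 - 2 * q) * M <=
    38 * k - (2 * r - 2 + 18 * q) * X.
Proof.
move=> adm k0 hX hG hLX hl hM.
have [[q0 q6 _ q2] r0 r1 _ _] := admissible_bounds adm.
have [[_ a1 _ _] _ _ _ hra] := adm; rewrite -subr_ge0 in a1.
have h1 := slack r0 hG; have h2 := slack q2 hl; have h3 := slack q2 hM.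
have h4 : 0 <= (0 - (4 * r - 3 - 2 * a + 32 * q)) * X by rewrite mulr_ge0 ?subr_ge0.
have h5 := mulr_ge0 q0 hX; have h6 := mulr_ge0 a1 h5.
have h7 := mulr_ge0 r1 k0; have h8 := mulr_ge0 q0 k0; have h9 := mulr_ge0 q6 k0.
clear adm hra a1 q0 q6 q2 r0 r1 hG hl hM; lra.
Qed.

(** Complement of the separated case: the output is so low that an integrable decay in its
    frequency, the term in Y, is affordable. It is paid by the parabolic term 2 a nu of the largest
    input. Eliminating X by the strict inequality turns what is left into [admissible_low]. *)
Lemma log_output_low L L1 L2 X G l l1 l2 s2 Y nu :
  admissible -> admissible_low -> 0 <= k ->
  0 <= X -> 0 <= nu -> G <= L1 + L2 + 2 * k - X -> L <= X ->
  l2 <= l -> L + L1 + L2 <= l -> 2 * a * nu - 3 * k <= l1 ->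
  s2 <= l2 + k -> Y <= X + k -> L1 <= nu -> L2 <= nu ->
  (2 * r - 6 * q) * X < (4 * r - 3 + 12 * q) * nu ->
  2 * L + 2 * r * G - (1 - 2 * q) * l - l1 - l2 <=
    40 * k - (1 + 2 * q) * s2 - (1 + 2 * q) * Y.
Proof.
move=> adm hcrit k0 hX hnu hG hLX hl2 hg hl1 hs2 hY hn1 hn2 hst.
have [[q0 q6 q4 _] r0 r1 hr _] := admissible_bounds adm.
have c0 : 0 < 2 * r - 6 * q by lra.
have T0 : (2 - 2 * r + 12 * q) * X + (4 * r - 2 + 12 * q - 2 * a) * nu <= 0.
  have hX' : 0 <= (2 * r - 6 * q) * X by rewrite mulr_ge0// ltW.
  case: hcrit => hc.
    have : 0 <= (0 - (4 * r - 3 + 12 * q)) * nu by rewrite mulr_ge0 ?subr_ge0.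
    by rewrite sub0r mulNr => ?; lra.
  rewrite -(pmulr_rle0 _ c0).
  have A0 : 0 <= 2 - 2 * r + 12 * q by lra.
  move: (2 - 2 * r + 12 * q) A0 hc => A A0.
  move: (4 * r - 2 + 12 * q - 2 * a) => B.
  move: (4 * r - 3 + 12 * q) hst => C hst.
  move: (2 * r - 6 * q) c0 hX' hst => E c0 hX' hst hc.
  have g1 := slack A0 (ltW hst).
  have g2 : 0 <= (0 - (A * C + B * E)) * nu by rewrite mulr_ge0 ?subr_ge0.
  clear -g1 g2; lra.
have q3 : 0 <= 2 * r - 1 + 4 * q by lra.
have h1 := slack r0 hG; have h2 := slack q4 hg; have h3 := slack q0 hLX.
have h4 := slack q3 hn1; have h4' := slack q3 hn2; have h5 := slack q0 hl2.
have h6 := mulr_ge0 r1 k0; have h7 := mulr_ge0 q0 k0; have h8 := mulr_ge0 q6 k0.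
have h9 := slack q0 hs2; have h10 := slack q0 hY.
have h11 := mulr_ge0 q0 hX; have h12 := mulr_ge0 q0 hnu.
clear adm hr q0 q6 q4 q3 r0 r1 hcrit c0 hst hG hl2 hg hn1 hn2; lra.
Qed.

(** With a dominant input the Jacobian carries the input frequency L1 instead of the output L. The
    leftover coefficients of X, L1 and nu then have the right sign because 1 + 6 q <= 2 r <= 2 - 6
    q. *)
Lemma log_input_separated L L1 L2 X G l1 M U D nu :
  admissible -> 0 <= k ->
  G <= L1 + L2 + 2 * k - X -> L <= X -> 0 <= X -> 0 <= L1 -> 0 <= L2 ->
  M <= l1 -> L + L1 + L2 <= l1 -> U <= M + k -> L2 <= nu -> nu - k <= D ->
  2 * L + 2 * r * G - l1 - (1 - 4 * q) * M <=
    38 * k + (L1 + D - (1 + 2 * q) * U).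
Proof.
move=> /admissible_bounds[[q0 q6 q4 _] r0 r1 hr hr'] k0 hG hLX hX hL1 hL2 hM hg hU hn hD.
have nu0 : 0 <= nu := le_trans hL2 hn.
have q3 : 0 <= 2 * r - 1 + 6 * q by lra.
have q5 : 0 <= 1 + 6 * q by lra.
have h1 := slack r0 hG; have h2 := slack q6 hg; have h3 := slack q5 hLX.
have h4 := mulr_ge0 hr hX; have h5 := mulr_ge0 hr' hL1.
have h6 := mulr_ge0 r1 k0; have h7 := mulr_ge0 q0 k0; have h8 := mulr_ge0 q6 k0.
have h9 := slack q3 hn; have h10 := mulr_ge0 hr' nu0.
have g3 := slack q4 hU; have g4 := slack q0 hU; have g5 := slack q0 hM.
clear hr hr' q0 q6 q4 q3 q5 r0 r1 hG hLX hX hL1 hL2 hM hg hU hn nu0; lra.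
Qed.

Lemma log_input_comparable_far L L1 X1 G l1 M U D :
  admissible -> 0 <= k ->
  G <= X1 + 2 * k -> L <= X1 + k -> X1 - k <= L1 -> M <= l1 ->
  3 * X1 - 3 * k <= l1 -> U <= M + k -> (2 * r - 2 + 18 * q) * X1 <= D ->
  2 * L + 2 * r * G - l1 - (1 - 4 * q) * M <=
    38 * k + (L1 + D - (1 + 2 * q) * U).
Proof.
move=> /admissible_bounds[[q0 q6 q4 _] r0 r1 _ _] k0 hG hL hL1 hM hl hU hD.
have h1 := slack r0 hG; have h2 := slack q6 hl.
have h6 := mulr_ge0 r1 k0; have h7 := mulr_ge0 q0 k0; have h8 := mulr_ge0 q6 k0.
have g3 := slack q4 hU; have g4 := slack q0 hU; have g5 := slack q0 hM.
clear q0 q6 q4 r0 r1 hG hM hl hU; lra.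
Qed.

Lemma log_input_comparable_near L X1 G l1 M :
  admissible -> 0 <= k ->
  0 <= X1 -> G <= X1 + 2 * k -> L <= X1 + k -> 3 * X1 - 3 * k <= l1 ->
  2 * a * X1 - 3 * k <= M ->
  2 * L + 2 * r * G - l1 - (1 - 4 * q) * M <=
    38 * k - (2 * r - 2 + 18 * q) * X1.
Proof.
move=> adm k0 hX hG hL hl hM.
have [[q0 q6 q4 _] r0 r1 _ _] := admissible_bounds adm.
have [[_ a1 _ _] _ _ _ hra] := adm; rewrite -subr_ge0 in a1.
have h1 := slack r0 hG; have h2 := slack q4 hM.
have h4 : 0 <= (0 - (4 * r - 3 - 2 * a + 32 * q)) * X1 by rewrite mulr_ge0 ?subr_ge0.
have h5 := mulr_ge0 q0 hX; have h6 := mulr_ge0 a1 h5.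
have h7 := mulr_ge0 r1 k0; have h8 := mulr_ge0 q0 k0; have h9 := mulr_ge0 q6 k0.
clear adm hra a1 q0 q6 q4 r0 r1 hG hM; lra.
Qed.

End LogEstimates.

(** * The Schur weight as a function of independent frequencies and phases *)

Section PointwiseKernel.
Variable R : realType.
Implicit Types (p e x u v w z : R).

Local Notation k := (ln (8 : R)).

(** The formula of [schur_weight] with the phases [va], [vb] and their combination [u] as free
    numbers, so that it serves whichever of the three points is kept fixed. *)
Definition weight_form p e w z va vb u : R :=
  (decay p va + decay p vb) *
  (`|3 * w * (2 * z - w)| * decay p u + decay p z +
   2 * decay e w * decay p ((2 * z - w) * decay e w)).

Lemma decay_expR p v : decay p v = expR (- p * ln (1 + `|v|)).
Proof.
by rewrite /decay -ln_powR lnK// posrE powR_gt0// ltr_pwDl.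
Qed.

Lemma ln8_ge0 : 0 <= k.
Proof. by rewrite ln_ge0// ler1n. Qed.

Lemma ln_le8 u v : 0 < u -> u <= 8 * v -> ln u <= ln v + k.
Proof.
move=> u0 uv; have v0 : 0 < v by rewrite -(pmulr_rgt0 _ (_ : 0 < 8 :> R))// (lt_le_trans u0).
by rewrite addrC -lnM ?posrE// ler_ln ?posrE// mulr_gt0.
Qed.

(** Keeps only the Jacobian summand, whose factor 3 is dropped. *)
Lemma weight_form_separated p e w z va vb u v E :
  v = va \/ v = vb -> w != 0 -> 2 * z - w != 0 ->
  E <= 40 * k - p * ln (1 + `|v|) +
    (ln `|w| + ln `|2 * z - w| - p * ln (1 + `|u|)) ->
  expR E <= expR (41 * k) * weight_form p e w z va vb u.
Proof.
move=> hv w0 zw0 hE.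
have d0 q x : 0 <= decay q x := decay_ge0 q x.
have h1 : expR E <= expR (41 * k) * (decay p v * (`|w| * `|2 * z - w| * decay p u)).
  rewrite -[`|w|]lnK ?posrE ?normr_gt0// -[`|2 * z - w|]lnK ?posrE ?normr_gt0//.
  rewrite !decay_expR -!expRD ler_expR (le_trans hE)//.
  have := ln8_ge0; lra.
apply: (le_trans h1); rewrite ler_pM2l ?expR_gt0//; apply: ler_pM => //.
- by rewrite !mulr_ge0.
- by case: hv => ->; rewrite ?lerDl ?lerDr.
- rewrite -addrA ler_wpDr ?addr_ge0 ?mulr_ge0// ler_wpM2r//.
  by rewrite !normrM -mulrA ler_peMl ?mulr_ge0// ger0_norm// ler1n.
Qed.

(** Keeps only the summand that decays in the frequency [z]. *)
Lemma weight_form_output p e w z va vb u v E :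
  v = va \/ v = vb ->
  E <= 40 * k - p * ln (1 + `|v|) - p * ln (1 + `|z|) ->
  expR E <= expR (41 * k) * weight_form p e w z va vb u.
Proof.
move=> hv hE.
have d0 q x : 0 <= decay q x := decay_ge0 q x.
have h1 : expR E <= expR (41 * k) * (decay p v * decay p z).
  rewrite !decay_expR -!expRD ler_expR (le_trans hE)//.
  have := ln8_ge0; lra.
apply: (le_trans h1); rewrite ler_pM2l ?expR_gt0//; apply: ler_pM => //.
- by case: hv => ->; rewrite ?lerDl ?lerDr.
- by rewrite addrAC ler_wpDl ?addr_ge0 ?mulr_ge0.
Qed.

(** Keeps only the strip summand. Inside the strip the argument of its profile is at most 1 in
    modulus, so p <= 2 bounds the profile below by 1 / 8; this loss is why the constants end at 41
    rather than 40. *)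
Lemma weight_form_near p e w z va vb u v E :
  0 <= p -> p <= 2 -> v = va \/ v = vb ->
  `|2 * z - w| <= expR (e * ln (1 + `|w|)) ->
  E <= 40 * k - p * ln (1 + `|v|) - e * ln (1 + `|w|) ->
  expR E <= expR (41 * k) * weight_form p e w z va vb u.
Proof.
move=> p0 p2 hv hzw hE.
have d0 q x : 0 <= decay q x := decay_ge0 q x.
have h1 : expR E <= expR (40 * k) * (decay p v * decay e w).
  rewrite !decay_expR -!expRD ler_expR (le_trans hE)//.
  by rewrite addrA !mulNr.
have h2 : 8^-1 <= decay p ((2 * z - w) * decay e w).
  have h3 : `|(2 * z - w) * decay e w| <= 1.
    rewrite normrM (ger0_norm (d0 _ _)) decay_expR -[leRHS]expR0.
    rewrite -(addrN (e * ln (1 + `|w|))) expRD -mulNr ler_wpM2r//.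
  rewrite decay_expR -[leLHS]lnK ?posrE// ler_expR lnV ?posrE// mulNr lerN2.
  have h4 : ln (1 + `|(2 * z - w) * decay e w|) <= ln 2.
    by rewrite ler_ln ?posrE ?ltr_pwDl//; lra.
  have h5 : ln 8 = 3 * ln 2 :> R.
    by rewrite (_ : 8 = 2 ^+ 3 :> R) ?lnXn// ?mulr_natl//; lra.
  have h6 : 0 <= ln (1 + `|(2 * z - w) * decay e w|) by rewrite ln_ge0// lerDl.
  have h7 : 0 <= (2 - p) * ln (1 + `|(2 * z - w) * decay e w|).
    by rewrite mulr_ge0 ?subr_ge0.
  move: h4 h5 h6 h7; move: (ln _) (ln _) (ln _) => A B C; lra.
apply: (le_trans h1); rewrite (_ : 41 * k = 40 * k + k); last by ring.
rewrite expRD -mulrA ler_pM2l ?expR_gt0// lnK ?posrE//.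
rewrite mulrCA; apply: ler_pM => //; first by case: hv => ->; rewrite ?lerDl ?lerDr.
rewrite -ler_pdivrMl// ler_wpDl ?addr_ge0 ?mulr_ge0//.
rewrite -mulrA mulrCA [leLHS]mulrC ler_wpM2l//.
by rewrite (le_trans h2)// ler_peMl// ler1n.
Qed.

(** [l] is the logarithm of a modulation bracket, known only through its dispersive part |v| and, up
    to the factor 8, its parabolic part (1 + |x|) ^ (2 a). *)
Definition modulation_bound (a v x l : R) : Prop :=
  [/\ 0 <= l, `|v| <= expR l & 2 * a * ln (1 + `|x|) <= l + k].

Lemma modulation_ln a v x l : modulation_bound a v x l ->
  ln (1 + `|v|) <= l + k.
Proof.
move=> [l0 hv _]; rewrite -[l in leRHS]expRK; apply: ln_le8; first by rewrite ltr_pwDl.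
have : 1 <= expR l by rewrite -expR0 ler_expR.
lra.
Qed.

Lemma modulation_lnD a b va vb xa xb la lb :
  modulation_bound a va xa la -> modulation_bound b vb xb lb ->
  ln (1 + `|va + vb|) <= Num.max la lb + k.
Proof.
move=> [la0 ha _] [lb0 hb _]; rewrite -[Num.max la lb]expRK; apply: ln_le8.
  by rewrite ltr_pwDl.
have e1 : 1 <= expR (Num.max la lb) by rewrite -expR0 ler_expR le_max la0.
have e2 : expR la <= expR (Num.max la lb) by rewrite ler_expR le_max lexx.
have e3 : expR lb <= expR (Num.max la lb) by rewrite ler_expR le_max lexx orbT.
have := ler_normD va vb.
lra.
Qed.

End PointwiseKernel.

(** * Case analysis on the dominant modulation and the positions of the frequencies *)

Section KernelCases.
Variable R : realType.
Variables (a ia r q : R).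
Hypotheses (adm : admissible a ia r q) (low : admissible_low a r q).
Implicit Types (x v l : R).

Local Notation k := (ln (8 : R)).
Local Notation p := (1 + 2 * q).
Local Notation e := (2 * r - 2 + 18 * q).
Local Notation jap x := (ln (1 + `|x|)).

(** Twice the logarithm of the quotient of weights to be bounded, with r in place of - s and 1 + |x|
    in place of the Sobolev bracket. *)
Definition log_energy x1 x2 l l1 l2 : R :=
  2 * ln `|x1 + x2| + 2 * r * (jap x1 + jap x2 - jap (x1 + x2)) -
  (1 - 2 * q) * l - l1 - l2.

(** The alternatives keep fixed the output, the first input and the second input. In the last two an
    input is read as the sum of the output and the opposite of the other input, so a difference of
    phases replaces their sum. *)
Definition kernel_dominated x1 x2 v v1 v2 l l1 l2 : Prop :=
  [\/ expR (log_energy x1 x2 l l1 l2) <= expR (41 * k) *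
        weight_form p e (x1 + x2) x1 v1 v2 (v1 + v2),
      expR (log_energy x1 x2 l l1 l2) <= expR (41 * k) *
        weight_form p e x1 (x1 + x2) v v2 (v - v2) |
      expR (log_energy x1 x2 l l1 l2) <= expR (41 * k) *
        weight_form p e x2 (x1 + x2) v v1 (v - v1)].

Lemma log_energyC x1 x2 l l1 l2 :
  log_energy x1 x2 l l1 l2 = log_energy x2 x1 l l2 l1.
Proof.
rewrite /log_energy (addrC x2 x1).
by move: (ln _) (ln _) (ln _) (ln _) => *; ring.
Qed.

Lemma jap_ge0 x1 : 0 <= jap x1.
Proof. by rewrite ln_ge0// lerDl. Qed.

Lemma jap_le8 x1 x2 : 1 + `|x1| <= 8 * (1 + `|x2|) -> jap x1 <= jap x2 + k.
Proof. by move=> h; apply: ln_le8 => //; rewrite ltr_pwDl. Qed.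

Lemma jap_abs_le8 x1 x2 : 1 + `|x1| <= 8 * `|x2| -> jap x1 <= ln `|x2| + k.
Proof. by move=> h; apply: ln_le8 => //; rewrite ltr_pwDl. Qed.

Lemma admissible_decay : 0 <= p /\ p <= 2.
Proof. by have [[_ _ _ q0] h1 h2 _ _] := adm; split; lra. Qed.

(** If the output is bounded as well, all frequencies are, and decay in [x1] costs a constant.
    Otherwise one input carries almost the whole output, the inputs are far apart, and the Jacobian
    is of the order of the square of the output. *)
Lemma kernel_low_frequency x1 x2 v1 v2 l l1 l2 :
  modulation_bound a (v1 + v2 - 3 * (x1 + x2) * x1 * x2) (x1 + x2) l ->
  modulation_bound a v1 x1 l1 -> modulation_bound a v2 x2 l2 ->
  x1 + x2 != 0 -> `|x1| <= 1 \/ `|x2| <= 1 ->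
  expR (log_energy x1 x2 l l1 l2) <= expR (41 * k) *
    weight_form p e (x1 + x2) x1 v1 v2 (v1 + v2).
Proof.
move=> m m1 m2 x0 hlow.
have [l0 hv hx] := m; have [l10 hv1 hx1] := m1; have [l20 hv2 hx2] := m2.
have k0 := ln8_ge0 R.
have s1 := modulation_ln m1; have s2 := modulation_ln m2.
have [x4|x4] := leP `|x1 + x2| 4.
  have [b1 b2] : `|x1| <= 5 /\ `|x2| <= 5.
    have h1 := ler_normB (x1 + x2) x2; have h2 := ler_normB (x1 + x2) x1.
    rewrite addrK in h1; rewrite (addrC x1) addrK (addrC x2) in h2.
    by case: hlow => ?; split; lra.
  have j1 : jap x1 <= k by rewrite ler_ln ?posrE ?ltr_pwDl//; lra.
  have j2 : jap x2 <= k by rewrite ler_ln ?posrE ?ltr_pwDl//; lra.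
  have L8 : ln `|x1 + x2| <= k by rewrite ler_ln ?posrE ?normr_gt0//; lra.
  have G2 : jap x1 + jap x2 - jap (x1 + x2) <= 2 * k.
    have := jap_ge0 (x1 + x2); move: j1 j2; move: (ln _) (ln _) (ln _) (ln _) => *; lra.
  have M0 : 0 <= Num.max l1 l2 by rewrite le_max l10.
  have := log_split_output adm k0 l10 l20 s1 s2
    (log_small_frequencies adm k0 L8 G2 l0 M0 j1).
  by case; apply: weight_form_output; [left|right].
have d4 : `|x1 + x2| <= 8 * `|x1 - x2| /\
    (1 + `|x1|) * (1 + `|x2|) <= 8 * (1 + `|x1 + x2|) /\
    `|x1| * `|x2| <= 1 + `|x1 + x2|.
  have h1 := ler_normB (x1 + x2) x2; have h2 := ler_normB (x1 + x2) x1.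
  rewrite addrK in h1; rewrite (addrC x1) addrK (addrC x2) in h2.
  have n1 := normr_ge0 x1; have n2 := normr_ge0 x2.
  have g1 : `|x1 + x2| <= `|x1 - x2| + 2 * `|x2|.
    have -> : x1 + x2 = (x1 - x2) + 2 * x2 by ring.
    by rewrite (le_trans (ler_normD _ _))// normrM ger0_norm.
  have g2 : `|x1 + x2| <= `|x1 - x2| + 2 * `|x1|.
    have -> : x1 + x2 = (- (x1 - x2)) + 2 * x1 by ring.
    by rewrite (le_trans (ler_normD _ _))// normrN normrM (@ger0_norm _ 2).
  case: hlow => hl; (split; [|split]); try lra.
  - have : (1 + `|x1|) * (1 + `|x2|) <= 2 * (1 + `|x2|) by rewrite ler_wpM2r ?addr_ge0//; lra.
    lra.
  - have : `|x1| * `|x2| <= 1 * `|x2| by rewrite ler_wpM2r.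
    lra.
  - have : (1 + `|x1|) * (1 + `|x2|) <= (1 + `|x1|) * 2 by rewrite ler_wpM2l ?addr_ge0//; lra.
    lra.
  - have : `|x1| * `|x2| <= `|x1| * 1 by rewrite ler_wpM2l.
    lra.
have {d4}[d1 [d2 d3]] := d4.
have LD : ln `|x1 + x2| - k <= ln `|x1 - x2|.
  by rewrite lerBlDr ln_le8 ?normr_gt0.
have G2 : jap x1 + jap x2 - jap (x1 + x2) <= k.
  by rewrite lerBlDl -lnM ?posrE ?ltr_pwDl// ln_le8// mulr_gt0 ?ltr_pwDl.
(* One input being at most 1, |x1 x2| <= 1 + |x1 + x2|; the resonance function is thus at most
   quadratic in the output. *)
have U1 : jap (v1 + v2) <= l + 2 * jap (x1 + x2) + k.
  rewrite mulr_natl -lnXn ?ltr_pwDl// -[l in leRHS]expRK -lnM ?posrE ?expR_gt0 ?exprn_gt0 ?ltr_pwDl//.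
  apply: ln_le8; first by rewrite ltr_pwDl.
  have e1 : 1 <= expR l by rewrite -expR0 ler_expR.
  have : `|v1 + v2| <= `|v1 + v2 - 3 * (x1 + x2) * x1 * x2| + 3 * `|x1 + x2| * (`|x1| * `|x2|).
    rewrite -[v1 + v2 in leLHS](subrK (3 * (x1 + x2) * x1 * x2)) (le_trans (ler_normD _ _))//.
    by rewrite lerD2l !normrM (@ger0_norm _ 3)// mulrA.
  move: (normr_ge0 (x1 + x2)) hv d3 x4 (normr_ge0 (v1 + v2)) e1.
  move: `|v1 + v2| `|v1 + v2 - _| (`|x1| * `|x2|) `|x1 + x2| (expR l) => A B C D E hD hB hC hD4 hA hE hAB.
  have f1 : 3 * D * C <= 3 * D * (1 + D) by rewrite ler_wpM2l// mulr_ge0.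
  have f2 : (1 + D) ^+ 2 <= E * (1 + D) ^+ 2 by rewrite ler_peMl// sqr_ge0.
  have f3 : 1 <= (1 + D) ^+ 2 by rewrite exprn_ege1// lerDl.
  have f4 : E <= E * (1 + D) ^+ 2 by rewrite ler_peMr// (le_trans _ hE).
  move: f1 f2 f3 f4; move: (E * (1 + D) ^+ 2) => F; clear -hB hAB hD; lra.
have UM := modulation_lnD m1 m2.
have hx' : 2 * a * jap (x1 + x2) <= l + k by [].
have zw : 2 * x1 - (x1 + x2) = x1 - x2 by ring.
have := log_split_output adm k0 l10 l20 s1 s2
  (log_low_high adm k0 LD G2 l0 U1 UM hx').
have d0 : x1 - x2 != 0.
  by apply/eqP => d0; move: d1; rewrite d0 normr0 mulr0; lra.
by case; rewrite -zw; apply: weight_form_separated; rewrite ?zw//; [left|right].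
Qed.

(** Frequencies closer than a quarter of the larger one have the same sign, so they are comparable
    and do not cancel in their sum. *)
Lemma norm_half_le x1 x2 : `|x1 - x2| < Num.max `|x1| `|x2| / 4 ->
  3 / 4 * Num.max `|x1| `|x2| <= `|x1| /\ 3 / 4 * Num.max `|x1| `|x2| <= `|x2| /\
  7 / 4 * Num.max `|x1| `|x2| <= `|x1 + x2|.
Proof.
have h1 : `|x1| <= `|x1 - x2| + `|x2|.
  by rewrite -{1}(subrK x2 x1) ler_normD.
have h2 : `|x2| <= `|x1 - x2| + `|x1|.
  by rewrite distrC -{1}(subrK x1 x2) ler_normD.
have h3 : 2 * `|x1| <= `|x1 + x2| + `|x1 - x2|.
  rewrite -[2](@ger0_norm R)// -normrM (_ : 2 * x1 = (x1 + x2) + (x1 - x2)) ?ler_normD//; ring.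
have h4 : 2 * `|x2| <= `|x1 + x2| + `|x1 - x2|.
  rewrite -[2](@ger0_norm R)// -normrM (_ : 2 * x2 = (x1 + x2) - (x1 - x2)) ?ler_normB//; ring.
move: h1 h2 h3 h4; move: `|x1| `|x2| `|x1 - x2| `|x1 + x2| => A B C D.
by have [?|?] := leP A B => h1 h2 h3 h4 h5; (split; [|split]); lra.
Qed.

Lemma ln_sum3 x1 x2 l : x1 + x2 != 0 -> x1 != 0 -> x2 != 0 ->
  `|x1 + x2| * `|x1| * `|x2| <= expR l ->
  ln `|x1 + x2| + ln `|x1| + ln `|x2| <= l.
Proof.
move=> x0 x10 x20 h; rewrite -!lnM ?posrE ?mulr_gt0 ?normr_gt0//.
by rewrite -[leRHS]expRK ler_ln ?posrE ?expR_gt0 ?mulr_gt0 ?normr_gt0.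
Qed.

Lemma jap_gain x1 x2 : 1 <= `|x1| -> 1 <= `|x2| ->
  jap x1 + jap x2 - jap (x1 + x2) <= ln `|x1| + ln `|x2| + 2 * k - jap (x1 + x2).
Proof.
move=> h1 h2; rewrite lerD2r.
have := @jap_abs_le8 x1 x1; have := @jap_abs_le8 x2 x2.
move: (ln _) (ln _) (ln _) (ln _) => *; lra.
Qed.

Lemma ln_abs_le_jap x1 : x1 != 0 -> ln `|x1| <= jap x1.
Proof. by move=> h; rewrite ler_ln ?posrE ?normr_gt0 ?ltr_pwDl// lerDr. Qed.

Lemma modulation_jap_le8 v x1 x2 l : modulation_bound a v x2 l ->
  1 + `|x1| <= 8 * (1 + `|x2|) -> 2 * a * jap x1 - 3 * k <= l.
Proof.
move=> [_ _ hx] /jap_le8 h; have [[a0 a1 _ _] _ _ _ _] := adm.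
have k0 := ln8_ge0 R.
have h1 : 0 <= a * (jap x2 + k - jap x1) by rewrite mulr_ge0 ?subr_ge0// ltW.
have h2 : 0 <= (1 - a) * k by rewrite mulr_ge0 ?subr_ge0.
move: hx h1 h2; move: (ln _) (ln _) (ln _) => A B C; clear; lra.
Qed.

(** Inputs further apart than a quarter of the larger one are handled by the Jacobian or, if the
    output is too low, by the weight fixed at the larger input. For closer inputs all three
    frequencies are comparable, and membership in the strip decides. *)
Lemma kernel_output_dominant x1 x2 v v1 v2 l l1 l2 :
  v = v1 + v2 - 3 * (x1 + x2) * x1 * x2 ->
  modulation_bound a v (x1 + x2) l ->
  modulation_bound a v1 x1 l1 -> modulation_bound a v2 x2 l2 ->
  x1 + x2 != 0 -> 1 <= `|x1| -> 1 <= `|x2| -> l1 <= l -> l2 <= l ->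
  `|x1 + x2| * `|x1| * `|x2| <= expR l ->
  kernel_dominated x1 x2 v v1 v2 l l1 l2.
Proof.
move=> vE m m1 m2 x0 h1 h2 l1l l2l hres.
have [l0 hv hx] := m; have [l10 hv1 hx1] := m1; have [l20 hv2 hx2] := m2.
have k0 := ln8_ge0 R.
have s1 := modulation_ln m1; have s2 := modulation_ln m2.
have x10 : x1 != 0 by rewrite -normr_gt0 (lt_le_trans _ h1).
have x20 : x2 != 0 by rewrite -normr_gt0 (lt_le_trans _ h2).
have hg := ln_sum3 x0 x10 x20 hres.
have hG := jap_gain h1 h2.
have LX := ln_abs_le_jap x0.
have Ml : Num.max l1 l2 <= l by rewrite ge_max l1l.
have UM := modulation_lnD m1 m2.
have zw : 2 * x1 - (x1 + x2) = x1 - x2 by ring.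
set N := Num.max `|x1| `|x2|.
have N1 : 1 <= N by rewrite le_max h1.
have N0 : 0 < N by rewrite (lt_le_trans _ N1).
have [hN1 hN2] : `|x1| <= N /\ `|x2| <= N by rewrite !le_max !lexx orbT.
have L1N : ln `|x1| <= ln N by rewrite ler_ln ?posrE ?normr_gt0.
have L2N : ln `|x2| <= ln N by rewrite ler_ln ?posrE ?normr_gt0.
have [far|near] := leP (N / 4) `|x1 - x2|.
  have d0 : x1 - x2 != 0 by rewrite -normr_gt0 (lt_le_trans _ far)// divr_gt0.
  have ND : ln N - k <= ln `|x1 - x2| by rewrite lerBlDr ln_le8//; lra.
  (* The threshold separating the use of the Jacobian from that of the parabolic term of the larger
     input. *)
  have [st|st] := leP ((4 * r - 3 + 12 * q) * ln N) ((2 * r - 6 * q) * jap (x1 + x2)).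
    apply: Or31; have := log_split_output adm k0 l10 l20 s1 s2
      (log_output_separated adm k0 hG LX Ml hg UM L1N L2N ND st).
    by case; rewrite -zw; apply: weight_form_separated; rewrite ?zw//; [left|right].
  have X0 := jap_ge0 (x1 + x2).
  have nu0 : 0 <= ln N by rewrite ln_ge0.
  have Yk : jap (x1 + x2) <= jap (x1 + x2) + k by rewrite lerDl.
  have a0 : 0 <= a by have [[/ltW]] := adm.
  have hjap y u y0 : modulation_bound a u y y0 -> N = `|y| -> 2 * a * ln N - 3 * k <= y0.
    move=> my Ny; apply: le_trans (modulation_jap_le8 my (_ : 1 + `|y| <= _)); last first.
      by have := normr_ge0 y; lra.
    rewrite lerD2r ler_wpM2l ?mulr_ge0// Ny.
    by apply: ln_abs_le_jap; rewrite -normr_gt0 -Ny.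
  have [h12|h12] := leP `|x2| `|x1|.
    have NE : N = `|x1| by rewrite /N; apply/max_idPl.
    apply: Or32; have := log_output_low adm low k0 X0 nu0 hG LX l2l hg (hjap _ _ _ m1 NE) s2 Yk L1N L2N st.
    by apply: weight_form_output; right.
  have NE : N = `|x2| by rewrite /N; apply/max_idPr/ltW.
  apply: Or33; rewrite log_energyC (addrC x1 x2).
  have hG' : jap x2 + jap x1 - jap (x2 + x1) <= ln `|x2| + ln `|x1| + 2 * k - jap (x2 + x1).
    by rewrite (addrC x2) (addrC (jap x2)) (addrC (ln `|x2|)).
  have hg' : ln `|x2 + x1| + ln `|x2| + ln `|x1| <= l by rewrite addrAC (addrC x2).
  rewrite (addrC x1 x2) in X0 LX Yk st.
  have := log_output_low adm low k0 X0 nu0 hG' LX l1l hg' (hjap _ _ _ m2 NE) s1 Yk L2N L1N st.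
  by apply: weight_form_output; right.
have [c1 [c2 c3]] := norm_half_le near.
rewrite -/N in c1 c2 c3.
apply: Or31.
have X0 := jap_ge0 (x1 + x2).
have hX3 : 3 * jap (x1 + x2) - 3 * k <= l.
  have t : `|x1 + x2| <= `|x1| + `|x2| := ler_normD _ _.
  have t0 : jap (x1 + x2) <= ln `|x1 + x2| + k by apply: jap_abs_le8; lra.
  have t1 : jap (x1 + x2) <= ln `|x1| + k by apply: jap_abs_le8; lra.
  have t2 : jap (x1 + x2) <= ln `|x2| + k by apply: jap_abs_le8; lra.
  by move: t0 t1 t2 hg; move: (ln _) (ln _) (ln _) (ln _) (ln _) => A B C D E; clear; lra.
have hG2 : jap x1 + jap x2 - jap (x1 + x2) <= jap (x1 + x2) + 2 * k.
  have t1 : jap x1 <= jap (x1 + x2) + k by apply: jap_le8; lra.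
  have t2 : jap x2 <= jap (x1 + x2) + k by apply: jap_le8; lra.
  by move: t1 t2; move: (ln _) (ln _) (ln _) (ln _) => A B C D ? ?; lra.
have [p0 p2] := admissible_decay.
have [hD|hD] := leP `|x1 - x2| (expR (e * jap (x1 + x2))).
  have hM : 2 * a * jap (x1 + x2) - 3 * k <= Num.max l1 l2.
    rewrite le_max (modulation_jap_le8 m1)//.
    have t : `|x1 + x2| <= `|x1| + `|x2| := ler_normD _ _; lra.
  have := log_split_output adm k0 l10 l20 s1 s2
    (log_output_comparable_near adm k0 X0 hG2 LX hX3 hM).
  by case; apply: weight_form_near; rewrite ?zw//; [left|right].
have d0 : x1 - x2 != 0 by rewrite -normr_gt0 (lt_trans _ hD)// expR_gt0.
have hD' : e * jap (x1 + x2) <= ln `|x1 - x2|.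
  by rewrite -[leLHS]expRK ler_ln ?posrE ?expR_gt0 ?normr_gt0// ltW.
have := log_split_output adm k0 l10 l20 s1 s2
  (log_output_comparable_far adm k0 hG2 LX Ml hX3 UM hD').
by case; rewrite -zw; apply: weight_form_separated; rewrite ?zw//; [left|right].
Qed.

(** Here [x1] plays the output, with [x1 + x2] and [- x2] as inputs, at distance |x1 + 2 x2|. Only
    the Sobolev factor and the exponent 1 - 2 q of [l] still distinguish the true output. *)
Lemma kernel_input_dominant x1 x2 v v1 v2 l l1 l2 :
  v = v1 + v2 - 3 * (x1 + x2) * x1 * x2 ->
  modulation_bound a v (x1 + x2) l ->
  modulation_bound a v1 x1 l1 -> modulation_bound a v2 x2 l2 ->
  x1 + x2 != 0 -> 1 <= `|x1| -> 1 <= `|x2| -> l <= l1 -> l2 <= l1 ->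
  `|x1 + x2| * `|x1| * `|x2| <= expR l1 ->
  expR (log_energy x1 x2 l l1 l2) <= expR (41 * k) *
    weight_form p e x1 (x1 + x2) v v2 (v - v2).
Proof.
move=> vE m m1 m2 x0 h1 h2 ll1 l2l hres.
have [l0 hv hx] := m; have [l10 hv1 hx1] := m1; have [l20 hv2 hx2] := m2.
have k0 := ln8_ge0 R.
have s := modulation_ln m; have s2 := modulation_ln m2.
have x10 : x1 != 0 by rewrite -normr_gt0 (lt_le_trans _ h1).
have x20 : x2 != 0 by rewrite -normr_gt0 (lt_le_trans _ h2).
have hg := ln_sum3 x0 x10 x20 hres.
have hG := jap_gain h1 h2.
have LX := ln_abs_le_jap x0.
have Ml : Num.max l l2 <= l1 by rewrite ge_max ll1.
have m2' : modulation_bound a (- v2) x2 l2 by split=> //; rewrite normrN.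
have UM := modulation_lnD m m2'.
have zw : 2 * (x1 + x2) - x1 = x1 + x2 + x2 by ring.
set N := Num.max `|x1 + x2| `|- x2|.
have N1 : 1 <= N by rewrite le_max normrN h2 orbT.
have N0 : 0 < N by rewrite (lt_le_trans _ N1).
have hN2 : `|x2| <= N by rewrite le_max normrN lexx orbT.
have hN : `|x1 + x2| <= N by rewrite le_max lexx.
have L2N : ln `|x2| <= ln N by rewrite ler_ln ?posrE ?normr_gt0.
have L10 : 0 <= ln `|x1| by rewrite ln_ge0.
have L20 : 0 <= ln `|x2| by rewrite ln_ge0.
have [far|near] := leP (N / 4) `|x1 + x2 - - x2|.
  rewrite opprK in far.
  have d0 : x1 + x2 + x2 != 0 by rewrite -normr_gt0 (lt_le_trans _ far)// divr_gt0.
  have ND : ln N - k <= ln `|x1 + x2 + x2| by rewrite lerBlDr ln_le8//; lra.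
  have := log_split_input adm k0 l0 l20 s s2
    (log_input_separated adm k0 hG LX (jap_ge0 _) L10 L20 Ml hg UM L2N ND).
  by case; rewrite -zw; apply: weight_form_separated; rewrite ?zw//; [left|right].
have [c1 [c2 c3]] := norm_half_le near.
rewrite -/N !normrN in c1 c2 c3; rewrite addrK in c3; rewrite opprK in near.
have X0 := jap_ge0 x1.
have t : `|x1| <= `|x1 + x2| + `|x2| by rewrite -{1}(addrK x2 x1) ler_normB.
have hX3 : 3 * jap x1 - 3 * k <= l1.
  have t0 : jap x1 <= ln `|x1 + x2| + k by apply: jap_abs_le8; lra.
  have t1 : jap x1 <= ln `|x1| + k by apply: jap_abs_le8; lra.
  have t2 : jap x1 <= ln `|x2| + k by apply: jap_abs_le8; lra.
  by move: t0 t1 t2 hg; move: (ln _) (ln _) (ln _) (ln _) (ln _) => A B C D E; clear; lra.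
have hG2 : jap x1 + jap x2 - jap (x1 + x2) <= jap x1 + 2 * k.
  have t2 : jap x2 <= jap (x1 + x2) + k by apply: jap_le8; lra.
  by move: t2 k0; move: (ln _) (ln _) (ln _) (ln _) => A B C D ? ?; lra.
have LX1 : ln `|x1 + x2| <= jap x1 + k.
  by apply: ln_le8; [rewrite normr_gt0|lra].
have [p0 p2] := admissible_decay.
have [hD|hD] := leP `|x1 + x2 + x2| (expR (e * jap x1)).
  have hM : 2 * a * jap x1 - 3 * k <= Num.max l l2.
    by rewrite le_max (modulation_jap_le8 m2) ?orbT//; lra.
  have := log_split_input adm k0 l0 l20 s s2
    (log_input_comparable_near adm k0 X0 hG2 LX1 hX3 hM).
  by case; apply: weight_form_near; rewrite ?zw//; [left|right].
have d0 : x1 + x2 + x2 != 0 by rewrite -normr_gt0 (lt_trans _ hD)// expR_gt0.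
have hD' : e * jap x1 <= ln `|x1 + x2 + x2|.
  by rewrite -[leLHS]expRK ler_ln ?posrE ?expR_gt0 ?normr_gt0// ltW.
have hL1 : jap x1 - k <= ln `|x1| by rewrite lerBlDr; apply: jap_abs_le8; lra.
have := log_split_input adm k0 l0 l20 s s2
  (log_input_comparable_far adm k0 hG2 LX1 hL1 Ml hX3 UM hD').
by case; rewrite -zw; apply: weight_form_separated; rewrite ?zw//; [left|right].
Qed.

Lemma kernel_cases x1 x2 v v1 v2 l l1 l2 :
  v = v1 + v2 - 3 * (x1 + x2) * x1 * x2 ->
  modulation_bound a v (x1 + x2) l ->
  modulation_bound a v1 x1 l1 -> modulation_bound a v2 x2 l2 -> x1 + x2 != 0 ->
  kernel_dominated x1 x2 v v1 v2 l l1 l2.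
Proof.
move=> vE m m1 m2 x0.
have [h1|h1] := leP `|x1| 1.
  by apply/Or31/kernel_low_frequency; rewrite -?vE//; left.
have [h2|h2] := leP `|x2| 1.
  by apply/Or31/kernel_low_frequency; rewrite -?vE//; right.
have [l0 hv _] := m; have [l10 hv1 _] := m1; have [l20 hv2 _] := m2.
(* The factor 3 of the resonance identity equals the number of modulations, so no constant is
   lost. *)
have res M : l <= M -> l1 <= M -> l2 <= M -> `|x1 + x2| * `|x1| * `|x2| <= expR M.
  rewrite -ler_expR -(ler_expR l1) -(ler_expR l2) => e0 e1 e2.
  have : 3 * (`|x1 + x2| * `|x1| * `|x2|) <= `|v1| + `|v2| + `|v|.
    rewrite -!normrM -[3](@ger0_norm R)// -normrM.
    have -> : 3 * ((x1 + x2) * x1 * x2) = v1 + v2 - v by rewrite vE; ring.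
    by rewrite (le_trans (ler_normB _ _))// lerD2r ler_normD.
  by move: hv hv1 hv2 e0 e1 e2; lra.
have vE' : v = v2 + v1 - 3 * (x2 + x1) * x2 * x1 by rewrite vE; ring.
have h1' := ltW h1; have h2' := ltW h2.
have [h12|/ltW h12] := leP l2 l1.
  have [h01|/ltW h01] := leP l l1.
    apply: Or32; apply: (kernel_input_dominant vE m m1 m2 x0 h1' h2' h01 h12).
    exact: res.
  by apply: kernel_output_dominant => //; [exact: le_trans h01|apply: res => //; exact: le_trans h01].
have [h02|/ltW h02] := leP l l2.
  apply: Or33; rewrite log_energyC (addrC x1 x2).
  rewrite (addrC x1 x2) in m x0 res.
  apply: (kernel_input_dominant vE' m m2 m1 x0 h2' h1' h02 h12).
  by rewrite mulrAC; exact: res.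
by apply: kernel_output_dominant => //; [exact: le_trans h02|apply: res => //; exact: le_trans h02].
Qed.

End KernelCases.

(** * Choice of the exponents and return to the Bourgain weights *)

Section KernelBound.
Variable R : realType.
Implicit Types (a s : R).

(** At q = 0 the required inequalities hold strictly, so a small q is left to find. Raising - s to
    at least 3 / 5 is free, since 3 / 5 lies below both 3 / 4 and 3 / (5 - 2 a) for a > 1 / 2, and
    it gives 2 r >= 6 / 5. *)
Lemma admissible_exists a s : 0 < a -> a <= 1 -> s_crit a < s -> s <= 0 ->
  exists r q : R, [/\ - s <= r, admissible a a^-1 r q & admissible_low a r q].
Proof.
move=> a0 a1 hs hs0.
pose r := Num.max (- s) (3 / 5).
have r35 : 3 / 5 <= r by rewrite le_max lexx orbT.
have rs : - s <= r by rewrite le_max lexx.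
have [r1 r2 hlow] : [/\ r < 1, 4 * r - 3 - 2 * a < 0 &
    (4 * r - 3 < 0 \/ 0 < 6 + 4 * a * r - 10 * r)].
  move: hs; rewrite /s_crit; case: ifPn => [a12|]; rewrite -?ltNge => ha.
    have h : r < 3 / 4 by rewrite gt_max; apply/andP; split; lra.
    by split; [lra|lra|left; lra].
  move=> hs; have d0 : 0 < 5 - 2 * a by lra.
  have h : r < 3 / (5 - 2 * a).
    rewrite gt_max; apply/andP; split; first by lra.
    by rewrite ltr_pdivlMr//; lra.
  rewrite ltr_pdivlMr// in h.
  (* With this product, (3 + 2 a) (5 - 2 a) >= 12 on the range 1 / 2 < a <= 1, so the critical value
     also stays below (3 + 2 a) / 4. *)
  have g1 : 0 <= (1 - a) * (a - 1 / 2) by rewrite mulr_ge0; lra.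
  have g2 : 0 <= (1 - a) * r by rewrite mulr_ge0; lra.
  have g3 : (4 * r - 3 - 2 * a) * (5 - 2 * a) < 0 by lra.
  split; [lra| |right; lra].
  by rewrite -(pmulr_llt0 _ d0).
(* 1 / 30 ensures 1 + 6 q <= 6 / 5, and a / 10 serves the condition on the inverse of a. Expanding
   [admissible_low] adds (24 r + 12 a) q + 72 q ^ 2 to its value at q = 0, which 108 q covers
   generously. *)
pose q1 := Num.min (1 / 30 : R) ((1 - r) / 3).
pose q2 := Num.min (a / 10) ((3 + 2 * a - 4 * r) / 32).
pose q3 := if 4 * r - 3 < 0 then (3 - 4 * r) / 12 else (6 + 4 * a * r - 10 * r) / 108.
pose q := Num.min (Num.min q1 q2) q3.
have q30 : 0 < q3.
  rewrite /q3; case: ifPn => h; first by lra.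
  by case: hlow => ?; [rewrite (_ : 4 * r - 3 < 0) in h|lra].
have q0 : 0 < q.
  rewrite lt_min q30 andbT !lt_min; apply/andP; split; apply/andP; split; lra.
have [c1 c2] : q <= 1 / 30 /\ q <= (1 - r) / 3 by rewrite !ge_min !lexx ?orbT.
have [c3 c4] : q <= a / 10 /\ q <= (3 + 2 * a - 4 * r) / 32 by rewrite !ge_min !lexx ?orbT.
have c5 : q <= q3 by rewrite ge_min lexx orbT.
have aia : a * a^-1 = 1 by rewrite mulfV ?gt_eqF.
exists r, q; split => //.
  split; [by split| by lra | by lra | | by lra].
  have : 0 <= a^-1 * (a / 10 - q) by rewrite mulr_ge0 ?invr_ge0 ?subr_ge0// ltW.
  have -> : a^-1 * (a / 10 - q) = (a * a^-1) / 10 - q * a^-1 by ring.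
  by rewrite aia => ?; lra.
rewrite /admissible_low; move: c5; rewrite /q3; case: ifPn => h c5; first by left; lra.
right.
have g1 : 0 <= q * (1 - r) by rewrite mulr_ge0; lra.
have g2 : 0 <= q * (1 - a) by rewrite mulr_ge0; lra.
have g3 : 0 <= q * (1 / 30 - q) by rewrite mulr_ge0; lra.
lra.
Qed.

Lemma bracket_ge1 (z : R[i]) : 1 <= bracket z.
Proof.
by rewrite /bracket -[leLHS]sqrtr1 ler_wsqrtr// lerDl sqr_ge0.
Qed.

Lemma bracket_gt0 (z : R[i]) : 0 < bracket z.
Proof. exact: lt_le_trans (bracket_ge1 z). Qed.

Lemma bracketE (x y : R) : bracket (x +i* y)%C = Num.sqrt (1 + (x ^+ 2 + y ^+ 2)).
Proof. by rewrite /bracket /= sqr_sqrtr// addr_ge0// sqr_ge0. Qed.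

Lemma bracket_ge_re (x y : R) : `|x| <= bracket (x +i* y)%C.
Proof.
rewrite bracketE -sqrtr_sqr ler_sqrt ?ltr_pwDl ?addr_ge0 ?sqr_ge0//.
by rewrite addrCA lerDl addr_ge0// sqr_ge0.
Qed.

Lemma bracket_ge_im (x y : R) : `|y| <= bracket (x +i* y)%C.
Proof.
rewrite bracketE -sqrtr_sqr ler_sqrt ?ltr_pwDl ?addr_ge0 ?sqr_ge0//.
by rewrite addrA lerDr addr_ge0// sqr_ge0.
Qed.

Lemma bracket_real_le (x : R) : bracket (x%:C)%C <= 1 + `|x|.
Proof.
rewrite bracketE expr0n/= addr0 -(@ger0_norm _ (1 + `|x|)) ?addr_ge0//.
rewrite -sqrtr_sqr ler_wsqrtr// sqrrD real_normK ?num_real//.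
by rewrite expr1n mul1r lerD2r lerDl mulrn_wge0.
Qed.

Lemma bracket_real_ge (x : R) : 1 + `|x| <= 2 * bracket (x%:C)%C.
Proof.
have := bracket_ge1 (x%:C)%C; have := bracket_ge_re x 0.
by rewrite mulr_natl mulr2n => ? ?; rewrite lerD.
Qed.

Definition modulation a (z : R * R) : R :=
  bracket ((`|z.1| `^ (2 * a)) +i* (z.2 - z.1 ^+ 3))%C.

Lemma XweightE b s a (z : R * R) :
  Xweight b s a z = expR (b * ln (modulation a z) + s * ln (bracket (z.1%:C)%C)).
Proof.
have E (x t : R) : 0 < x -> x `^ t = expR (t * ln x).
  by move=> x0; rewrite -ln_powR lnK// posrE powR_gt0.
by rewrite /Xweight /modulation expRD; congr (_ * _); exact: E (bracket_gt0 _).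
Qed.

Lemma Xweight_ge0 b s a (z : R * R) : 0 <= Xweight b s a z.
Proof. by rewrite XweightE expR_ge0. Qed.

Lemma ln_bracket_le (x : R) : ln (bracket (x%:C)%C) <= ln (1 + `|x|).
Proof.
by rewrite ler_ln ?posrE ?bracket_gt0 ?ltr_pwDl// bracket_real_le.
Qed.

Lemma ln_bracket_ge (x : R) : ln (1 + `|x|) <= ln (bracket (x%:C)%C) + ln 8.
Proof.
apply: ln_le8; first by rewrite ltr_pwDl.
have := bracket_real_ge x; have := bracket_ge1 (x%:C)%C.
by move: (bracket _) `|x| => B t; lra.
Qed.

Lemma ln_1normD (x y : R) : ln (1 + `|x + y|) <= ln (1 + `|x|) + ln (1 + `|y|).
Proof.
rewrite -lnM ?posrE ?ltr_pwDl// ler_ln ?posrE ?mulr_gt0 ?ltr_pwDl//.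
have := ler_normD x y; have : 0 <= `|x| * `|y| by rewrite mulr_ge0.
by move: `|x + y| `|x| `|y| => A B C *; lra.
Qed.

Lemma expR_half_le (E c t : R) : expR E <= expR (2 * c) * t -> 0 <= t ->
  expR (E / 2) <= expR c * Num.sqrt t.
Proof.
move=> h t0; rewrite -[leLHS]ger0_norm ?expR_ge0// -sqrtr_sqr.
rewrite -[expR c]ger0_norm ?expR_ge0// -sqrtr_sqr -sqrtrM ?sqr_ge0//.
rewrite ler_wsqrtr// -!expRM_natl.
by rewrite (_ : 2 * (E / 2) = E)// mulrCA mulfV ?mulr1.
Qed.

(** Replaces the logarithms D of the brackets by the logarithms J of 1 + |xi|, and - s by r; the
    latter only enlarges the bound because J1 + J2 - J is nonnegative. *)
Lemma kernel_exponent_le (s r q A k B B1 B2 J J1 J2 D D1 D2 : R) : 0 <= k ->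
  - s <= r -> r <= 1 -> s <= 0 ->
  J <= D + k -> D1 <= J1 -> D2 <= J2 -> J <= J1 + J2 ->
  A + ((- (1 / 2) + q) * B + s * D) -
    (1 / 2 * B1 + s * D1 + (1 / 2 * B2 + s * D2)) <=
  3 / 2 * k + (2 * A + 2 * r * (J1 + J2 - J) - (1 - 2 * q) * B - B1 - B2) / 2.
Proof.
move=> k0 rs r1 s0 h h1 h2 hJ.
have g1 : 0 <= (- s) * ((J1 + J2 - J) + k - (D1 + D2 - D)).
  by rewrite mulr_ge0 ?oppr_ge0//; lra.
have g2 : 0 <= (r + s) * (J1 + J2 - J) by rewrite mulr_ge0//; lra.
have g3 : 0 <= (1 + s) * k by rewrite mulr_ge0//; lra.
lra.
Qed.

(** As a <= 1, (1 + |xi|) ^ (2 a) is at most 4 times the larger of 1 and |xi| ^ (2 a), and the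
    bracket dominates both. *)
Lemma modulation_boundP a (z : R * R) : 0 < a -> a <= 1 ->
  modulation_bound a (phase z) z.1 (ln (modulation a z)).
Proof.
move=> a0 a1; split.
- by rewrite ln_ge0// bracket_ge1.
- by rewrite lnK ?posrE ?bracket_gt0//; exact: bracket_ge_im.
have m1 : 1 <= modulation a z := bracket_ge1 _.
have l0 : 0 <= ln (modulation a z) by rewrite ln_ge0.
have ln2 : 0 <= ln 2 :> R by rewrite ln_ge0// ler1n.
have ln83 : ln 8 = 3 * ln 2 :> R.
  by rewrite (_ : 8 = 2 ^+ 3 :> R) ?lnXn// ?mulr_natl//; lra.
have h0 : 0 <= (1 - a) * ln 2 by rewrite mulr_ge0 ?subr_ge0.
have [x1|x1] := leP `|z.1| 1.
  have : ln (1 + `|z.1|) <= ln 2 by rewrite ler_ln ?posrE ?ltr_pwDl//; lra.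
  move=> h; have : 0 <= a * (ln 2 - ln (1 + `|z.1|)) by rewrite mulr_ge0 ?subr_ge0// ltW.
  rewrite ln83; move: h0 ln2 l0; clear; move: (ln _) (ln _) (ln _) => A B C; lra.
have z0 : 0 < `|z.1| by rewrite (lt_trans _ x1).
have h1 : ln (1 + `|z.1|) <= ln 2 + ln `|z.1|.
  by rewrite -lnM ?posrE// ler_ln ?posrE ?mulr_gt0 ?ltr_pwDl//; lra.
have h2 : 2 * a * ln `|z.1| <= ln (modulation a z).
  rewrite -ln_powR ler_ln ?posrE ?powR_gt0 ?bracket_gt0//.
  by rewrite -[leLHS]ger0_norm ?powR_ge0//; exact: bracket_ge_re.
have : 0 <= a * (ln 2 + ln `|z.1| - ln (1 + `|z.1|)) by rewrite mulr_ge0 ?subr_ge0// ltW.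
rewrite ln83; move: h0 h2 ln2; clear; move: (ln _) (ln _) (ln _) (ln _) => A B C D; lra.
Qed.

(** The resonance identity read with each of the three points as output; the signs produced by
    reversing a difference disappear because [decay] is even. *)
Lemma schur_weightE p e (w z : R * R) :
  [/\ weight_form p e w.1 z.1 (phase z) (phase (vsub w z))
        (phase z + phase (vsub w z)) = schur_weight p e w z,
      weight_form p e z.1 w.1 (phase w) (phase (vsub w z))
        (phase w - phase (vsub w z)) = schur_weight p e z w &
      weight_form p e (vsub w z).1 w.1 (phase w) (phase z)
        (phase w - phase z) = schur_weight p e (vsub w z) w].
Proof.
have E1 : phase z + phase (vsub w z) = phase w + 3 * w.1 * z.1 * (w.1 - z.1).
  by rewrite /phase/=; ring.
have E2 : phase w - phase (vsub w z) = phase z + 3 * z.1 * w.1 * (z.1 - w.1).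
  by rewrite /phase/=; ring.
have E3 : phase w - phase z =
    phase (vsub w z) + 3 * (vsub w z).1 * w.1 * ((vsub w z).1 - w.1).
  by rewrite /phase/=; ring.
have N1 : phase (vsub z w) = - phase (vsub w z) by rewrite /phase/=; ring.
have N2 : phase (vsub (vsub w z) w) = - phase z by rewrite /phase/=; ring.
split; rewrite /schur_weight /weight_form ?E1 ?E2 ?E3 ?N1 ?N2 ?decayN//.
Qed.

Lemma kernel_bound a s : 0 < a -> a <= 1 -> s_crit a < s -> s <= 0 ->
  exists q p e C : R, [/\ 0 < q, q <= 1 / 2, 1 < p, 0 < C &
    forall w z : R * R, `|w.1| * Xweight (- (1 / 2) + q) s a w <=
      C * schur_majorant p e w z *
      (Xweight (1 / 2) s a z * Xweight (1 / 2) s a (vsub w z))].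
Proof.
move=> a0 a1 hs hs0; have [r [q [rs adm low]]] := admissible_exists a0 a1 hs hs0.
have [[_ _ _ q0] hr1 hr2 _ _] := adm.
have r1 : r <= 1 by lra.
(* Half of 41, because the case analysis bounds the square of the quotient, plus the 3 / 2 of
   [kernel_exponent_le]. *)
have c22 : 22 = 3 / 2 + 41 / 2 :> R by lra.
exists q, (1 + 2 * q), (2 * r - 2 + 18 * q), (expR (22 * ln 8)).
split; [by []|lra|lra|exact: expR_gt0|] => w z.
set p := 1 + 2 * q; set e := 2 * r - 2 + 18 * q.
have S0 u v : 0 <= schur_weight p e u v := schur_weight_ge0 _ _ _ _.
have maj0 : 0 <= schur_majorant p e w z by rewrite !addr_ge0 ?sqrtr_ge0.
have [w0|w0] := eqVneq w.1 0.
  rewrite w0 normr0 mul0r mulr_ge0//; last by rewrite mulr_ge0// Xweight_ge0.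
  by rewrite mulr_ge0// expR_ge0.
have wE : w.1 = z.1 + (vsub w z).1 by rewrite /=; ring.
have vE : phase w = phase z + phase (vsub w z) - 3 * (z.1 + (vsub w z).1) * z.1 * (vsub w z).1.
  by rewrite /phase/=; ring.
have m := modulation_boundP w a0 a1.
have m1 := modulation_boundP z a0 a1.
have m2 := modulation_boundP (vsub w z) a0 a1.
have m' := m; rewrite {1}wE in m'.
have w0' : z.1 + (vsub w z).1 != 0 by rewrite -wE.
have key := kernel_cases adm low vE m' m1 m2 w0'.
rewrite /kernel_dominated -wE in key; have [E1 E2 E3] := schur_weightE p e w z.
rewrite -/p -/e E1 E2 E3 in key.
set EN := log_energy _ _ _ _ _ _ _ in key.
have c41 : 41 * ln 8 = 2 * (41 / 2 * ln 8) :> R.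
  by rewrite mulrA (mulrCA 2) mulfV ?mulr1.
have {}key : expR (EN / 2) <= expR (41 / 2 * ln 8) * schur_majorant p e w z.
  rewrite c41 in key.
  case: key => /expR_half_le h; apply: (le_trans (h (S0 _ _))); rewrite ler_pM2l ?expR_gt0//.
  - by rewrite /schur_majorant -addrA lerDl addr_ge0 ?sqrtr_ge0.
  - by rewrite /schur_majorant addrAC lerDr addr_ge0 ?sqrtr_ge0.
  - by rewrite /schur_majorant lerDr addr_ge0 ?sqrtr_ge0.
rewrite !XweightE -expRD.
rewrite (_ : `|w.1| = expR (ln `|w.1|)); last by rewrite lnK// posrE normr_gt0.
rewrite -expRD -ler_pdivrMr ?expR_gt0// -expRN -expRD.
have -> : expR (22 * ln 8) * schur_majorant p e w z =
    expR (3 / 2 * ln 8) * (expR (41 / 2 * ln 8) * schur_majorant p e w z).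
  by rewrite mulrA -expRD -mulrDl c22.
apply: le_trans (_ : expR (3 / 2 * ln 8) * expR (EN / 2) <= _); last first.
  by rewrite ler_pM2l ?expR_gt0.
rewrite -expRD ler_expR /EN /log_energy -wE.
have jD := ln_1normD z.1 (vsub w z).1; rewrite -wE in jD.
exact: (kernel_exponent_le q _ _ _ _ (ln8_ge0 R) rs r1 hs0 (ln_bracket_ge w.1)
  (ln_bracket_le z.1) (ln_bracket_le (vsub w z).1) jD).
Qed.

End KernelBound.

(** * The Fourier transform of a product *)

Section ComplexIntegral.
Variable R : realType.
Implicit Types (c : R[i]).
Local Notation normc := Normc.normc.
Local Notation Re := complex.Re.
Local Notation Im := complex.Im.

Lemma normcE c : normc c = Num.sqrt (Re c ^+ 2 + Im c ^+ 2).
Proof. by case: c. Qed.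

Lemma normc_ge0 c : 0 <= normc c.
Proof. by rewrite normcE sqrtr_ge0. Qed.

Lemma Re_le_normc c : `|Re c| <= normc c.
Proof. by rewrite normcE -sqrtr_sqr ler_wsqrtr// lerDl sqr_ge0. Qed.

Lemma Im_le_normc c : `|Im c| <= normc c.
Proof. by rewrite normcE -sqrtr_sqr ler_wsqrtr// lerDr sqr_ge0. Qed.

Lemma normc_le c : normc c <= `|Re c| + `|Im c|.
Proof.
rewrite normcE -[leRHS]ger0_norm ?addr_ge0// -sqrtr_sqr ler_wsqrtr//.
rewrite sqrrD !real_normK ?num_real// lerD2r lerDl.
by rewrite mulrn_wge0// mulr_ge0.
Qed.

Lemma normc_real (x : R) : normc (x%:C)%C = `|x|.
Proof. by rewrite normcE/= expr0n/= addr0 sqrtr_sqr. Qed.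

Lemma normc_expi (x : R) : normc (expi x) = 1.
Proof. by rewrite normcE/= cos2Dsin2 sqrtr1. Qed.

Lemma expiD (x y : R) : expi (x + y) = expi x * expi y.
Proof.
by rewrite /expi cosD sinD; simpc; congr (_ +i* _)%C; rewrite addrC mulrC addrC.
Qed.

Section Measure.
Variables (d : measure_display) (T : measurableType d).
Implicit Types (f g : T -> R[i]).

Definition cmeasurable f := measurable_fun [set: T] (fun x => Re (f x)) /\
  measurable_fun [set: T] (fun x => Im (f x)).

Lemma cmeasurable_normc f : cmeasurable f ->
  measurable_fun [set: T] (fun x => normc (f x)).
Proof.
move=> [m1 m2]; under eq_fun do rewrite normcE.
have ms : measurable_fun [set: R] (@Num.sqrt R).
  by apply: continuous_measurable_fun; exact: sqrt_continuous.
by apply: (measurableT_comp ms); apply: measurable_funD; exact: measurable_funX.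
Qed.

Lemma cmeasurableM f g : cmeasurable f -> cmeasurable g ->
  cmeasurable (fun x => f x * g x).
Proof.
move=> [f1 f2] [g1 g2]; split.
  rewrite (_ : (fun x => _) = (fun x => Re (f x) * Re (g x) - Im (f x) * Im (g x))).
    by apply: measurable_funB; exact: measurable_funM.
  by apply/funext => x; case: (f x) (g x) => [a b] [a' b'].
rewrite (_ : (fun x => _) = (fun x => Re (f x) * Im (g x) + Im (f x) * Re (g x))).
  by apply: measurable_funD; exact: measurable_funM.
by apply/funext => x; case: (f x) (g x) => [a b] [a' b'].
Qed.

Lemma cmeasurableB f g : cmeasurable f -> cmeasurable g ->
  cmeasurable (fun x => f x - g x).
Proof.
move=> [f1 f2] [g1 g2]; split; under eq_fun do rewrite raddfB/=;
  exact: measurable_funB.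
Qed.

Lemma cmeasurable_cst c : cmeasurable (fun _ => c).
Proof. by split; exact: measurable_cst. Qed.

Lemma cmeasurable_real (h : T -> R) : measurable_fun [set: T] h ->
  cmeasurable (fun x => (h x)%:C)%C.
Proof. by split => //=; exact: measurable_cst. Qed.

Lemma cmeasurable_expi (h : T -> R) : measurable_fun [set: T] h ->
  cmeasurable (fun x => expi (h x)).
Proof.
split => /=; (apply: measurableT_comp => //; apply: continuous_measurable_fun).
  exact: continuous_cos.
exact: continuous_sin.
Qed.

Variable nu : {measure set T -> \bar R}.

Definition cintegral f : R[i] :=
  (Rintegral nu setT (fun x => Re (f x)) +i* Rintegral nu setT (fun x => Im (f x)))%C.

Definition cintegrable f :=
  cmeasurable f /\ (\int[nu]_x (normc (f x))%:E < +oo)%E.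

Lemma cintegrable_le f (h : T -> R) : cmeasurable f ->
  measurable_fun [set: T] h -> (forall x, normc (f x) <= h x) ->
  (\int[nu]_x (h x)%:E < +oo)%E -> cintegrable f.
Proof.
move=> mf mh fh ih; split => //; apply: le_lt_trans ih.
apply: ge0_le_integral_EFin => //; first exact: cmeasurable_normc.
by move=> x; exact: normc_ge0.
Qed.

Let integrable_le_normc f (h : T -> R) : cintegrable f ->
  measurable_fun [set: T] h -> (forall x, `|h x| <= normc (f x)) ->
  nu.-integrable setT (EFin \o h).
Proof.
move=> [mf fi] mh hf; apply/integrableP; split; first exact/measurable_EFinP.
apply: le_lt_trans fi; apply: (@ge0_le_integral_EFin _ _ _ nu (fun x => `|h x|)) => //.
- exact: measurableT_comp.
- exact: cmeasurable_normc.
Qed.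

Lemma cintegrable_Re f : cintegrable f ->
  nu.-integrable setT (EFin \o (fun x => Re (f x))).
Proof.
move=> fi; apply: (integrable_le_normc fi); first exact: fi.1.1.
by move=> x; exact: Re_le_normc.
Qed.

Lemma cintegrable_Im f : cintegrable f ->
  nu.-integrable setT (EFin \o (fun x => Im (f x))).
Proof.
move=> fi; apply: (integrable_le_normc fi); first exact: fi.1.2.
by move=> x; exact: Im_le_normc.
Qed.

Lemma eq_cintegral f g : f =1 g -> cintegral f = cintegral g.
Proof. by move=> /funext ->. Qed.

Lemma cintegralB f g : cintegrable f -> cintegrable g ->
  cintegral (fun x => f x - g x) = cintegral f - cintegral g.
Proof.
move=> fi gi; rewrite /cintegral.
under eq_Rintegral do rewrite raddfB/=.
rewrite RintegralB//; [|exact: cintegrable_Re|exact: cintegrable_Re].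
under [X in (_ +i* X)%C]eq_Rintegral do rewrite raddfB/=.
by rewrite RintegralB//; [exact: cintegrable_Im|exact: cintegrable_Im].
Qed.

Lemma cintegralZl c f : cintegrable f ->
  cintegral (fun x => c * f x) = c * cintegral f.
Proof.
move=> fi; have iR := cintegrable_Re fi; have iI := cintegrable_Im fi.
case: c => a b; rewrite /cintegral; simpc.
have Z (k : R) h : nu.-integrable setT (EFin \o h) ->
    nu.-integrable setT (EFin \o (fun x => k * h x)).
  by move=> hi; exact: (integrableZl measurableT k hi).
congr (_ +i* _)%C.
  rewrite -!RintegralZl// -RintegralB//; [|exact: Z|exact: Z].
  by apply: eq_Rintegral => x _; case: (f x) => y z; simpc.
rewrite -!RintegralZl// -RintegralD//; [|exact: Z|exact: Z].
by apply: eq_Rintegral => x _; case: (f x) => y z; simpc.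
Qed.

Lemma cintegralZr c f : cintegrable f ->
  cintegral (fun x => f x * c) = cintegral f * c.
Proof.
move=> fi; rewrite mulrC -cintegralZl//.
by apply: eq_cintegral => x; rewrite mulrC.
Qed.

Lemma cintegrableZl c f : cintegrable f -> cintegrable (fun x => c * f x).
Proof.
move=> [mf fi]; split; first exact: cmeasurableM (cmeasurable_cst c) mf.
under eq_integral do rewrite Normc.normcM.
rewrite ge0_integral_scale ?normc_ge0//; last 2 first.
- exact: cmeasurable_normc.
- by move=> x; exact: normc_ge0.
by rewrite lte_mul_pinfty ?lee_fin ?normc_ge0.
Qed.

(** The factor 2 comes from |Re| + |Im|. It is absorbed in the end by the mass of the planar Poisson
    kernel, which is at least 4. *)
Lemma normc_cintegral_le f : cintegrable f ->
  ((normc (cintegral f))%:E <= 2%:E * \int[nu]_x (normc (f x))%:E)%E.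
Proof.
move=> fi; have iR := cintegrable_Re fi; have iI := cintegrable_Im fi.
apply: (@le_trans _ _ (`|Re (cintegral f)| + `|Im (cintegral f)|)%:E).
  by rewrite lee_fin normc_le.
have h (k : T -> R) : nu.-integrable setT (EFin \o k) ->
    (forall x, `|k x| <= normc (f x)) ->
    (`|Rintegral nu setT k|%:E <= \int[nu]_x (normc (f x))%:E)%E.
  move=> ki kf; rewrite EFin_normr_Rintegral//.
  apply: le_trans (le_abse_integral _ _ _) _ => //.
    by case/integrableP : ki.
  apply: ge0_le_integral => //.
  - by apply/measurableT_comp => //; case/integrableP : ki.
  - by apply/measurable_EFinP/cmeasurable_normc; case: fi.
  - by move=> x _; rewrite lee_fin.
rewrite EFinD (_ : 2%:E = 1%:E + 1%:E)%E; last by rewrite -EFinD -natr1.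
rewrite ge0_muleDl ?lee_fin// !mul1e.
apply: leeD; apply: h => // x; [exact: Re_le_normc|exact: Im_le_normc].
Qed.

Lemma normc_cintegral_bound f (h : T -> R) (B : R) : cmeasurable f ->
  measurable_fun [set: T] h -> (forall x, normc (f x) <= h x) ->
  (\int[nu]_x (h x)%:E <= B%:E)%E -> normc (cintegral f) <= 2 * B.
Proof.
move=> mf mh fh hB; rewrite -lee_fin EFinM.
have fi : cintegrable f by apply: (cintegrable_le mf mh fh); exact: le_lt_trans hB (ltry _).
apply: (le_trans (normc_cintegral_le fi)); rewrite lee_pmul2l ?lte_fin//.
apply: le_trans hB; apply: ge0_le_integral_EFin => //; first exact: cmeasurable_normc.
by move=> x; exact: normc_ge0.
Qed.

End Measure.

Lemma cmeasurable_comp d d' (T : measurableType d) (U : measurableType d')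
    (f : U -> R[i]) (g : T -> U) :
  cmeasurable f -> measurable_fun [set: T] g -> cmeasurable (f \o g).
Proof. by move=> [f1 f2] mg; split; [exact: (measurableT_comp f1 mg)|exact: (measurableT_comp f2 mg)]. Qed.

Section Fubini.
Variables (d1 d2 : measure_display) (T1 : measurableType d1) (T2 : measurableType d2).
Variables (m1 : {sigma_finite_measure set T1 -> \bar R}).
Variables (m2 : {sigma_finite_measure set T2 -> \bar R}).

Lemma integrable_tensor (p : T1 -> R) (q : T2 -> R) :
  measurable_fun [set: T1] p -> measurable_fun [set: T2] q ->
  (forall x, 0 <= p x) -> (forall x, 0 <= q x) ->
  (\int[m1]_x (p x)%:E < +oo)%E -> (\int[m2]_x (q x)%:E < +oo)%E ->
  (m1 \x m2)%E.-integrable setT (fun z => (p z.1 * q z.2)%:E).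
Proof.
move=> mp mq p0 q0 ip iq.
have mpq : measurable_fun [set: T1 * T2] (fun z => (p z.1 * q z.2)%:E).
  apply/measurable_EFinP; apply: measurable_funM.
  - exact: (measurableT_comp mp measurable_fst).
  - exact: (measurableT_comp mq measurable_snd).
apply/integrable12ltyP => //=.
under eq_integral do under eq_integral do rewrite ger0_norm ?mulr_ge0//.
under eq_integral do rewrite ge0_integral_scale//.
rewrite ge0_integralZr//; last 3 first.
- exact/measurable_EFinP.
- by move=> x _; rewrite lee_fin.
- exact: integral_EFin_ge0.
by apply: lte_mul_pinfty; rewrite ?ge0_fin_numE//; exact: integral_EFin_ge0.
Qed.

Variables (G : T1 * T2 -> R) (p : T1 -> R) (q : T2 -> R).
Hypotheses (mG : measurable_fun [set: T1 * T2] G).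
Hypotheses (mp : measurable_fun [set: T1] p) (mq : measurable_fun [set: T2] q).
Hypotheses (ip : (\int[m1]_x (p x)%:E < +oo)%E) (iq : (\int[m2]_x (q x)%:E < +oo)%E).
Hypotheses (p0 : forall x, 0 <= p x) (q0 : forall x, 0 <= q x).
Hypothesis Gpq : forall x y, `|G (x, y)| <= p x * q y.

Let iG : (m1 \x m2)%E.-integrable setT (EFin \o G).
Proof.
apply: le_integrable (integrable_tensor mp mq p0 q0 ip iq) => //.
  exact/measurable_EFinP.
by move=> [x y] _ /=; rewrite lee_fin (le_trans (Gpq _ _))// ler_norm.
Qed.

(** Domination by a tensor product makes every section integrable, not just almost every one, so
    [fine] never meets an infinite value. *)
Let fin1 x : (\int[m2]_y (G (x, y))%:E)%E \is a fin_num.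
Proof.
apply: integrable_fin_num => //.
have iq' : m2.-integrable setT (EFin \o q).
  apply/integrableP; split; first exact/measurable_EFinP.
  by under eq_integral do rewrite /= ger0_norm//.
apply: (@le_integrable _ _ _ m2 _ measurableT _ (fun y => (p x)%:E * (q y)%:E)%E).
- by apply/measurable_EFinP; exact: measurableT_comp mG (pair1_measurable x).
- by move=> y _ /=; rewrite lee_fin (le_trans (Gpq _ _))// ler_norm.
- exact: integrableZl.
Qed.

Let fin2 y : (\int[m1]_x (G (x, y))%:E)%E \is a fin_num.
Proof.
apply: integrable_fin_num => //.
have ip' : m1.-integrable setT (EFin \o p).
  apply/integrableP; split; first exact/measurable_EFinP.
  by under eq_integral do rewrite /= ger0_norm//.
apply: (@le_integrable _ _ _ m1 _ measurableT _ (fun x => (q y)%:E * (p x)%:E)%E).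
- by apply/measurable_EFinP; exact: measurableT_comp mG (pair2_measurable y).
- by move=> x _ /=; rewrite lee_fin (le_trans (Gpq _ _))// mulrC ler_norm.
- exact: integrableZl.
Qed.

Lemma Rintegral_swap :
  Rintegral m1 setT (fun x => Rintegral m2 setT (fun y => G (x, y))) =
  Rintegral m2 setT (fun y => Rintegral m1 setT (fun x => G (x, y))).
Proof.
rewrite /Rintegral; congr fine.
under eq_integral do rewrite fineK//.
by under [RHS]eq_integral do rewrite fineK//; exact: (Fubini iG).
Qed.

Lemma Rintegral_prod :
  Rintegral (m1 \x m2)%E setT G =
  Rintegral m1 setT (fun x => Rintegral m2 setT (fun y => G (x, y))).
Proof.
rewrite /Rintegral; congr fine.
by under [RHS]eq_integral do rewrite fineK//; rewrite -integral12_prod_meas1.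
Qed.

Lemma measurable_Rintegral1 :
  measurable_fun [set: T1] (fun x => Rintegral m2 setT (fun y => G (x, y))).
Proof.
apply/measurable_EFinP; rewrite (_ : _ \o _ = fubini_F m2 (EFin \o G)).
  exact: (measurable_fubini_F iG).
by apply/funext => x; rewrite /= /Rintegral fineK.
Qed.

End Fubini.

Section ComplexFubini.
Variables (d1 d2 : measure_display) (T1 : measurableType d1) (T2 : measurableType d2).
Variables (m1 : {sigma_finite_measure set T1 -> \bar R}).
Variables (m2 : {sigma_finite_measure set T2 -> \bar R}).
Variables (G : T1 * T2 -> R[i]) (p : T1 -> R) (q : T2 -> R).
Hypotheses (mG : cmeasurable G).
Hypotheses (mp : measurable_fun [set: T1] p) (mq : measurable_fun [set: T2] q).
Hypotheses (ip : (\int[m1]_x (p x)%:E < +oo)%E) (iq : (\int[m2]_x (q x)%:E < +oo)%E).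
Hypotheses (p0 : forall x, 0 <= p x) (q0 : forall x, 0 <= q x).
Hypothesis Gpq : forall x y, normc (G (x, y)) <= p x * q y.

Let hR x y : `|Re (G (x, y))| <= p x * q y := le_trans (Re_le_normc _) (Gpq x y).
Let hI x y : `|Im (G (x, y))| <= p x * q y := le_trans (Im_le_normc _) (Gpq x y).

Lemma cintegral_swap :
  cintegral m1 (fun x => cintegral m2 (fun y => G (x, y))) =
  cintegral m2 (fun y => cintegral m1 (fun x => G (x, y))).
Proof.
rewrite /cintegral /=; congr (_ +i* _)%C.
  exact: (Rintegral_swap mG.1 mp mq ip iq p0 q0 hR).
exact: (Rintegral_swap mG.2 mp mq ip iq p0 q0 hI).
Qed.

Lemma cintegral_prod :
  cintegral (m1 \x m2)%E G = cintegral m1 (fun x => cintegral m2 (fun y => G (x, y))).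
Proof.
rewrite /cintegral /=; congr (_ +i* _)%C.
  exact: (Rintegral_prod mG.1 mp mq ip iq p0 q0 hR).
exact: (Rintegral_prod mG.2 mp mq ip iq p0 q0 hI).
Qed.

Lemma cmeasurable_cintegral1 : cmeasurable (fun x => cintegral m2 (fun y => G (x, y))).
Proof.
split.
  exact: (measurable_Rintegral1 mG.1 mp mq ip iq p0 q0 hR).
exact: (measurable_Rintegral1 mG.2 mp mq ip iq p0 q0 hI).
Qed.

End ComplexFubini.
End ComplexIntegral.

(** * The Abel weight and its transform, the Poisson kernel *)

Section Poisson.
Variable R : realType.
Local Notation RT := (measurableTypeR R).
Local Notation plane := (RT * RT)%type.
Local Notation mu := (@lebesgue_measure R).
Local Notation lam := (@plane_measure R).
Implicit Types (e x y : R).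

Definition abel e x : R := expR (- (e * `|x|)).

Definition poisson e y : R := 2 * e / (e ^+ 2 + y ^+ 2).

Lemma abel_gt0 e x : 0 < abel e x. Proof. exact: expR_gt0. Qed.

Lemma continuous_abel e : continuous (abel e).
Proof.
move=> x; apply: continuous_comp; last exact: continuous_expR.
by apply: cvgN; apply: cvgM; [exact: cvg_cst|exact: norm_continuous].
Qed.

Lemma measurable_abel e : measurable_fun [set: R] (abel e).
Proof. by apply: continuous_measurable_fun; exact: continuous_abel. Qed.

(** A primitive of exp (- e x) (1 + cos (y x)), which is the Abel weight times 1 + cos on the half
    line x >= 0. *)
Let prim e y x := expR (- (e * x)) *
  (y / (e ^+ 2 + y ^+ 2) * sin (y * x) - e / (e ^+ 2 + y ^+ 2) * cos (y * x) - e^-1).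

Let sq_gt0 e y : 0 < e -> 0 < e ^+ 2 + y ^+ 2.
Proof. by move=> e0; rewrite ltr_pwDl ?exprn_gt0// sqr_ge0. Qed.

Let prim_coef e y S C X : 0 < e ->
  X * (y / (e ^+ 2 + y ^+ 2) * (y * C) - e / (e ^+ 2 + y ^+ 2) * (y * (- S))) +
  (y / (e ^+ 2 + y ^+ 2) * S - e / (e ^+ 2 + y ^+ 2) * C - e^-1) * (- e * X) =
  X * (1 + C).
Proof.
move=> e0; have := gt_eqF (sq_gt0 y e0) => /negbT h0.
by field; rewrite h0 gt_eqF.
Qed.

Let is_derive_prim e y x : 0 < e ->
  is_derive x (1 : R) (prim e y) (expR (- (e * x)) * (1 + cos (y * x))).
Proof.
move=> e0.
have lin (k : R) : is_derive x (1 : R) (fun x => k * x) k.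
  by rewrite -[X in is_derive _ _ _ X]mulr1; exact: is_deriveZ.
have dE := is_derive1_comp (is_derive_expR _) (is_deriveN (lin e)).
have dS := is_derive1_comp (is_derive_sin _) (lin y).
have dC := is_derive1_comp (is_derive_cos _) (lin y).
have dP := is_deriveB (is_deriveB (is_deriveZ (y / (e ^+ 2 + y ^+ 2)) dS)
  (is_deriveZ (e / (e ^+ 2 + y ^+ 2)) dC)) (is_derive_cst (e^-1) x 1).
apply: (is_derive_eq (is_deriveM dE dP)).
rewrite -(@prim_coef e y (sin (y * x)) (cos (y * x)) (expR (- (e * x))) e0).
rewrite subr0 /= /GRing.scale/=.
by rewrite (mulrC _ y) (mulrC _ y) (mulrC (expR _) (- e)).
Qed.

Let prim_cvg e y : 0 < e -> prim e y x @[x --> +oo] --> (0 : R).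
Proof.
move=> e0; have d0 := sq_gt0 y e0; set D := _ + _ in d0.
set K := `|y / D| + `|e / D| + `|e^-1|.
have ex : expR (- (e * x)) @[x --> +oo] --> (0 : R).
  apply: (cvg_comp (fun x => e * x) (fun x => expR (- x)) _ (@cvgr_expR R)).
  exact: gt0_cvgMry.
have bound x : `|prim e y x| <= K * expR (- (e * x)).
  rewrite normrM (ger0_norm (expR_ge0 _)) mulrC ler_wpM2r ?expR_ge0//.
  apply: (le_trans (ler_normB _ _)); rewrite lerD2r.
  apply: (le_trans (ler_normB _ _)); rewrite !normrM.
  apply: lerD; rewrite ler_piMr// ?ler_norml ?sin_geN1 ?sin_le1 ?cos_geN1 ?cos_le1//.
apply: (@squeeze_cvgr _ _ _ _ (fun x => - (K * expR (- (e * x)))) (fun x => K * expR (- (e * x)))).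
- by near=> x; rewrite -ler_norml; exact: bound.
- by rewrite -[X in _ --> X]oppr0 -(mulr0 K); apply: cvgN; apply: cvgM => //; exact: cvg_cst.
- by rewrite -(mulr0 K); apply: cvgM => //; exact: cvg_cst.
Unshelve. all: by end_near. Qed.

Let continuous_abel_cos e y : continuous (fun x => abel e x * (1 + cos (y * x))).
Proof.
move=> x; apply: cvgM; first exact: continuous_abel.
apply: cvgD; first exact: cvg_cst.
apply: (continuous_comp (f := fun x => y * x)); last exact: continuous_cos.
by apply: cvgM; [exact: cvg_cst|exact: cvg_id].
Qed.

Let abel_cos_ge0 e y x : 0 <= abel e x * (1 + cos (y * x)).
Proof. by rewrite mulr_ge0 ?expR_ge0//; have := cos_geN1 (y * x); lra. Qed.

(** Adding 1 to the cosine makes the integrand nonnegative, as the fundamental theorem of calculus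
    on a half line demands here; evenness reduces the line to that half line. The case y = 0 then
    gives the integral of the Abel weight, to be subtracted. *)
Lemma integral_abel_cos e y : 0 < e ->
  (\int[mu]_x (abel e x * (1 + cos (y * x)))%:E = (2 / e + poisson e y)%:E)%E.
Proof.
move=> e0.
rewrite ge0_symfun_integralT//; last first.
  by move=> x /=; rewrite /abel normrN mulrN cosN.
rewrite -set_itvcy.
rewrite (_ : (\int[mu]_(x in _) _)%E = (\int[mu]_(x in `[0%R, +oo[) (expR (- (e * x)) * (1 + cos (y * x)))%:E)%E); last first.
  apply: eq_integral => x; rewrite inE/= in_itv/= andbT => x0.
  by rewrite /abel ger0_norm.
rewrite (@ge0_continuous_FTC2y _ _ (prim e y) 0 0).
- rewrite /prim mulr0 oppr0 expR0 mulr0 sin0 cos0 mulr0 mulr1 sub0r mul1r.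
  rewrite -EFinB -EFinM; congr (_%:E).
  rewrite /poisson; move: (_ ^+ 2 + _) => D.
  by ring.
- by move=> x x0; have := abel_cos_ge0 e y x; rewrite /abel ger0_norm.
- apply: continuous_subspaceT => x; apply: differentiable_continuous.
  apply/derivable1_diffP.
  have lin (k : R) : is_derive x (1 : R) (fun x => k * x) k.
    by rewrite -[X in is_derive _ _ _ X]mulr1; exact: is_deriveZ.
  have dE := is_derive1_comp (is_derive_expR _) (is_deriveN (lin e)).
  have dC := is_derive1_comp (is_derive_cos _) (lin y).
  by case: (is_deriveM dE (is_deriveD (is_derive_cst (1 : R) x 1) dC)).
- exact: prim_cvg.
- by move=> x _; case: (is_derive_prim y x e0).
- apply: cvg_at_right_filter.
  apply: differentiable_continuous; apply/derivable1_diffP.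
  by case: (is_derive_prim y 0 e0).
- move=> x _; rewrite derive1E.
  exact: (@derive_val _ _ _ _ _ _ _ (is_derive_prim y x e0)).
Qed.

Lemma integral_abel e : 0 < e -> (\int[mu]_x (abel e x)%:E = (2 / e)%:E)%E.
Proof.
move=> e0; have := integral_abel_cos 0 e0.
under eq_integral do rewrite mul0r cos0 mulrC.
rewrite ge0_integral_scale//; last 2 first.
- exact: measurable_abel.
- by move=> x; rewrite ltW// abel_gt0.
rewrite (_ : 2 / e + poisson e 0 = (1 + 1) * (2 / e)); last first.
  by rewrite /poisson expr0n/= addr0; field; rewrite gt_eqF.
move=> h; rewrite -[LHS]mul1e -(_ : (1 + 1)^-1%:E * (1 + 1)%:E = 1)%E; last first.
  by rewrite -EFinM mulVf// gt_eqF.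
by rewrite -muleA h -EFinM mulKf// gt_eqF.
Qed.

Let integrable_abel e : 0 < e -> mu.-integrable setT (EFin \o abel e).
Proof.
move=> e0; apply/integrableP; split.
  by apply/measurable_EFinP; exact: measurable_abel.
by under eq_integral do rewrite /= ger0_norm ?ltW ?abel_gt0//; rewrite integral_abel// ltry.
Qed.

Let measurable_trig (h : R -> R) y : continuous h ->
  measurable_fun [set: R] (fun x => h (x * y)).
Proof.
move=> ch; apply: continuous_measurable_fun => x.
apply: (continuous_comp (f := fun x => x * y)); last exact: ch.
by apply: cvgM; [exact: cvg_id|exact: cvg_cst].
Qed.

Let integrable_abelM e (h : R -> R) y : 0 < e -> continuous h ->
  (forall x, `|h x| <= 1) ->
  mu.-integrable setT (EFin \o (fun x => abel e x * h (x * y))).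
Proof.
move=> e0 ch h1; apply: (le_integrable measurableT _ _ (integrable_abel e0)).
  apply/measurable_EFinP; apply: measurable_funM; first exact: measurable_abel.
  exact: measurable_trig.
move=> x _; rewrite lee_fin normrM ler_piMr//; exact: h1.
Qed.

Let norm_cos_le1 x : `|cos x| <= 1. Proof. by rewrite ler_norml cos_geN1 cos_le1. Qed.
Let norm_sin_le1 x : `|sin x| <= 1. Proof. by rewrite ler_norml sin_geN1 sin_le1. Qed.

Lemma Rintegral_abel_cos e y : 0 < e ->
  Rintegral mu setT (fun x => abel e x * cos (x * y)) = poisson e y.
Proof.
move=> e0; have cc : continuous (@cos R) by exact: continuous_cos.
apply: (addrI (2 / e)); rewrite -[in LHS]/(fine (2 / e)%:E) -integral_abel//.
rewrite -/(Rintegral mu setT (abel e)) -RintegralD//; last 2 first.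
- exact: integrable_abel.
- exact: integrable_abelM.
rewrite -[RHS]/(fine _%:E) -integral_abel_cos//.
by apply: eq_Rintegral => x _; rewrite mulrDr mulr1 (mulrC x).
Qed.

(** Oddness, expressed through the weight times 1 + sin and 1 - sin: the reflection exchanges these
    functions, and both are nonnegative. *)
Lemma Rintegral_abel_sin e y : 0 < e ->
  Rintegral mu setT (fun x => abel e x * sin (x * y)) = 0.
Proof.
move=> e0; have cs : continuous (@sin R) by exact: continuous_sin.
set I := Rintegral _ _ _.
have iE := integrable_abel e0.
have iS := integrable_abelM y e0 cs norm_sin_le1.
have E1 : Rintegral mu setT (fun x => abel e x + abel e x * sin (x * y)) =
    Rintegral mu setT (abel e) + I by rewrite RintegralD.
have E2 : Rintegral mu setT (fun x => abel e x - abel e x * sin (x * y)) =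
    Rintegral mu setT (abel e) - I by rewrite RintegralB.
suff : Rintegral mu setT (abel e) + I = Rintegral mu setT (abel e) - I.
  by move/addrI/eqP; rewrite -subr_eq0 opprK -mulr2n mulrn_eq0 => /eqP.
rewrite -E1 -E2 /Rintegral; congr fine; apply/esym.
rewrite -(@integral_reflect _ (fun x => (abel e x - abel e x * sin (x * y))%:E)).
- by apply: eq_integral => x _; rewrite /abel normrN mulNr sinN mulrN opprK.
- apply/measurable_EFinP; apply: measurable_funB; first exact: measurable_abel.
  by apply: measurable_funM; [exact: measurable_abel|exact: measurable_trig].
- move=> x; rewrite lee_fin -{1}[abel e x]mulr1 -mulrBr mulr_ge0 ?subr_ge0 ?sin_le1//.
  by rewrite ltW// abel_gt0.
Qed.

Lemma cintegral_abel e y : 0 < e ->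
  cintegral mu (fun x => (abel e x)%:C%C * expi (x * y)) = (poisson e y)%:C%C.
Proof.
move=> e0; rewrite /cintegral -(Rintegral_abel_cos y e0).
congr (_ +i* _)%C; first by apply: eq_Rintegral => x _; rewrite /= mul0r subr0.
by rewrite -(Rintegral_abel_sin y e0); apply: eq_Rintegral => x _; rewrite /= mul0r addr0.
Qed.

Definition abel2 e (z : R * R) : R := abel e z.1 * abel e z.2.
Definition poisson2 e (z : R * R) : R := poisson e z.1 * poisson e z.2.

Lemma abel2_gt0 e z : 0 < abel2 e z. Proof. by rewrite mulr_gt0 ?abel_gt0. Qed.

Lemma measurable_abel2 e : measurable_fun [set: plane] (abel2 e).
Proof.
by apply: measurable_funM; apply: (measurableT_comp (measurable_abel e)).
Qed.

Let abel_fin e : 0 < e -> (\int[mu]_x (abel e x)%:E < +oo)%E.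
Proof. by move=> e0; rewrite integral_abel// ltry. Qed.

Lemma integral_abel2 e : 0 < e -> (\int[lam]_z (abel2 e z)%:E < +oo)%E.
Proof.
move=> e0; have a0 x : 0 <= abel e x by rewrite ltW ?abel_gt0.
have := @integrable_tensor _ _ _ RT RT mu mu _ _ (measurable_abel e) (measurable_abel e) a0 a0
  (abel_fin e0) (abel_fin e0).
move/integrableP => [_]; apply: le_lt_trans.
apply: le_of_eq; apply: eq_integral => z _ /=.
by rewrite ger0_norm// mulr_ge0.
Qed.

Lemma cintegral_abel2 e (y : R * R) : 0 < e ->
  cintegral lam (fun z => (abel2 e z)%:C%C * expi (z.1 * y.1 + z.2 * y.2)) =
  (poisson2 e y)%:C%C.
Proof.
move=> e0; have a0 x : 0 <= abel e x by rewrite ltW ?abel_gt0.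
have mab := measurable_abel e.
have m1 (b : R) : measurable_fun [set: R] (fun x : R => x * b).
  by apply: measurable_funM.
have cm1 b : cmeasurable (fun x : R => (abel e x)%:C%C * expi (x * b)).
  apply: cmeasurableM; first exact: cmeasurable_real.
  exact: cmeasurable_expi.
have ci b : cintegrable mu (fun x : R => (abel e x)%:C%C * expi (x * b)).
  apply: (@cintegrable_le _ _ RT mu _ (abel e) (cm1 b) mab _ (abel_fin e0)) => x.
  by rewrite Normc.normcM normc_expi mulr1 normc_real ger0_norm.
rewrite (@cintegral_prod _ _ _ RT RT mu mu _ (abel e) (abel e))//.
- have E x t : (abel2 e (x, t))%:C%C * expi (x * y.1 + t * y.2) =
      ((abel e x)%:C%C * expi (x * y.1)) * ((abel e t)%:C%C * expi (t * y.2)).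
    by rewrite expiD /abel2 rmorphM mulrACA.
  apply: (@etrans _ _ (cintegral mu (fun x =>
      ((abel e x)%:C%C * expi (x * y.1)) * (poisson e y.2)%:C%C))); last first.
    by rewrite cintegralZr// cintegral_abel// -rmorphM.
  apply: eq_cintegral.
  move=> x; rewrite -(cintegral_abel y.2 e0) -cintegralZl//.
  by apply: eq_cintegral => t; exact: E.
- apply: cmeasurableM; first by apply: cmeasurable_real; exact: measurable_abel2.
  apply: cmeasurable_expi; apply: measurable_funD; apply: measurable_funM => //.
- exact: abel_fin.
- exact: abel_fin.
- move=> x t; rewrite Normc.normcM normc_expi mulr1 normc_real ger0_norm//.
  by rewrite ltW// abel2_gt0.
Qed.

End Poisson.

(** * The Poisson kernel as an approximate identity with a rate *)

Section ApproximateIdentity.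
Variable R : realType.
Local Notation RT := (measurableTypeR R).
Local Notation plane := (RT * RT)%type.
Local Notation mu := (@lebesgue_measure R).
Local Notation lam := (@plane_measure R).
Implicit Types (e x y t : R).

Lemma decay2E t : decay 2 t = ((1 + `|t|) ^+ 2)^-1.
Proof. by rewrite /decay powRN powR_mulrn// addr_ge0. Qed.

Lemma decay32E t : decay (3 / 2) t = decay 2 t * Num.sqrt (1 + `|t|).
Proof.
have h : 0 < 1 + `|t| by rewrite ltr_pwDl.
rewrite -powR12_sqrt ?ltW// /decay -powRD; last by rewrite (gt_eqF h) implybT.
by congr (_ `^ _); field.
Qed.

Lemma poisson_ge0 e y : 0 < e -> 0 <= poisson e y.
Proof. by move=> e0; rewrite divr_ge0 ?mulr_ge0 ?addr_ge0 ?sqr_ge0// ltW. Qed.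

Lemma measurable_poisson e : 0 < e -> measurable_fun [set: R] (poisson e).
Proof.
move=> e0; apply: continuous_measurable_fun => x.
apply: cvgM; first exact: cvg_cst.
apply: cvgV; first by rewrite gt_eqF// ltr_pwDl ?exprn_gt0// sqr_ge0.
by apply: cvgD; [exact: cvg_cst|exact: exprn_continuous].
Qed.

Lemma poisson_le_decay e y : 0 < e ->
  poisson e y <= 4 * (e^-1 * decay 2 (e^-1 * y)).
Proof.
move=> e0; pose t := e^-1 * y; have yE : y = e * t by rewrite /t mulVKf ?gt_eqF.
have s0 : 0 < 1 + t ^+ 2 by rewrite ltr_pwDl// sqr_ge0.
have a0 : 0 < 1 + `|t| by rewrite ltr_pwDl.
rewrite -/t {1}yE decay2E /poisson.
have -> : 2 * e / (e ^+ 2 + (e * t) ^+ 2) = 2 * e^-1 / (1 + t ^+ 2).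
  by field; rewrite !gt_eqF// exprMn -[X in X + _]mulr1 -mulrDr mulr_gt0 ?exprn_gt0.
rewrite mulrA ler_pdivrMr// mulrAC ler_pdivlMr ?exprn_gt0//.
rewrite (_ : 4 * e^-1 * (1 + t ^+ 2) = 2 * e^-1 * (2 * (1 + t ^+ 2))); last by ring.
rewrite ler_pM2l ?mulr_gt0 ?invr_gt0//.
have := sqr_ge0 (1 - `|t|); rewrite -(real_normK (num_real t)).
by move: `|t| => x; lra.
Qed.

(** With y = e t, min 1 |y| <= sqrt |y| <= sqrt e sqrt (1 + |t|): a gain sqrt e for half a power of
    decay, and 3 / 2 is still integrable. The full moment of |y| against this kernel diverges. *)
Lemma poisson_min_le_decay e y : 0 < e ->
  poisson e y * Num.min 1 `|y| <= 4 * Num.sqrt e * (e^-1 * decay (3 / 2) (e^-1 * y)).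
Proof.
move=> e0; pose t := e^-1 * y; have yE : y = e * t by rewrite /t mulVKf ?gt_eqF.
have a0 : 0 <= 1 + `|t| by rewrite addr_ge0.
have h : Num.min 1 `|y| <= Num.sqrt e * Num.sqrt (1 + `|t|).
  rewrite -sqrtrM ?(ltW e0)//; set m := e * _.
  have m0 : 0 <= m by rewrite mulr_ge0 ?ltW.
  have ym : `|y| <= m.
    by rewrite yE normrM gtr0_norm// ler_pM2l// lerDr.
  have sm : Num.sqrt m * Num.sqrt m = m by rewrite -expr2 sqr_sqrtr.
  have mm : Num.min 1 `|y| <= Num.min 1 m by rewrite le_min ge_min lexx/= ge_min ym orbT.
  apply: (le_trans mm).
  have [m1|m1] := leP m 1.
    rewrite -{1}sm ler_piMr ?sqrtr_ge0// -[leRHS]sqrtr1 ler_wsqrtr//.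
  by rewrite -[leLHS]sqrtr1 ler_wsqrtr// ltW.
rewrite -/t decay32E.
have E1 := poisson_le_decay y e0; rewrite -/t in E1.
apply: (le_trans (ler_pM (poisson_ge0 y e0) _ E1 h)); first by rewrite le_min ler01/=.
apply: le_of_eq.
by move: (Num.sqrt _) (Num.sqrt _) (decay _ _) => A B C; ring.
Qed.

Lemma integral_scaled_decay p e : 1 < p -> 0 < e ->
  (\int[mu]_y (e^-1 * decay p (e^-1 * y))%:E <= (decay_mass p)%:E)%E.
Proof.
move=> p1 e0; apply: le_trans (integral_quadratic_decay 0 e^-1 0 p1).
apply: le_of_eq; apply: eq_integral => y _.
by rewrite mulr0 !mul0r !add0r addr0 ger0_norm// invr_ge0 ltW.
Qed.

Let integral_le_scaled_decay (f : R -> R) p e K : 1 < p -> 0 < e -> 0 <= K ->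
  measurable_fun [set: R] f -> (forall y, 0 <= f y) ->
  (forall y, f y <= K * (e^-1 * decay p (e^-1 * y))) ->
  (\int[mu]_y (f y)%:E <= (K * decay_mass p)%:E)%E.
Proof.
move=> p1 e0 K0 mf f0 fK.
have ms : measurable_fun [set: R] (fun y : R => e^-1 * decay p (e^-1 * y)).
  apply: measurable_funM => //.
  by apply: (measurableT_comp (measurable_decay p)); exact: measurable_funM.
have s0 y : 0 <= e^-1 * decay p (e^-1 * y) by rewrite mulr_ge0 ?decay_ge0// invr_ge0 ltW.
have mK := measurable_funM (measurable_cst K) ms.
apply: le_trans (@ge0_le_integral_EFin _ RT R mu _ _ mf mK f0 fK) _.
rewrite ge0_integral_scale// EFinM lee_wpmul2l ?lee_fin//.
exact: integral_scaled_decay.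
Qed.

Lemma integral_poisson_le e : 0 < e ->
  (\int[mu]_y (poisson e y)%:E <= (4 * decay_mass 2)%:E)%E.
Proof.
move=> e0; apply: (@integral_le_scaled_decay (poisson e) 2 e) => //; first lra.
- exact: measurable_poisson.
- by move=> y; exact: poisson_ge0.
- by move=> y; exact: poisson_le_decay.
Qed.

Lemma integral_poisson_min_le e : 0 < e ->
  (\int[mu]_y (poisson e y * Num.min 1 `|y|)%:E <=
   (4 * Num.sqrt e * decay_mass (3 / 2))%:E)%E.
Proof.
move=> e0; apply: (@integral_le_scaled_decay _ (3 / 2) e) => //; first lra.
- apply: measurable_funM; first exact: measurable_poisson.
  by apply: measurable_minr => //; exact: measurable_normr.
- by move=> y; rewrite mulr_ge0 ?poisson_ge0// le_min ler01/=.
- by move=> y; exact: poisson_min_le_decay.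
Qed.

(** On [- e, e] the kernel is at least 1 / e. The exact value is 2 pi, but a lower bound independent
    of e suffices. *)
Lemma integral_poisson_ge e : 0 < e -> (2%:E <= \int[mu]_y (poisson e y)%:E)%E.
Proof.
move=> e0; pose I : set RT := `[- e, e]%classic.
have mI : measurable I by exact: measurable_itv.
have muI : mu I = (2 * e)%:E.
  rewrite /I lebesgue_measure_itv/= lte_fin (_ : - e < e); last by rewrite gtrN.
  by rewrite -EFinB opprK mulr_natl.
apply: (@le_trans _ _ (\int[mu]_(y in I) (poisson e y)%:E)%E); last first.
  apply: ge0_subset_integral => //.
    by apply/measurable_EFinP; exact: measurable_poisson.
  by move=> y _; rewrite lee_fin poisson_ge0.
apply: (@le_trans _ _ (\int[mu]_(y in I) (e^-1)%:E)%E).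
  rewrite integral_cst// [X in (_ * X)%E](_ : _ = (2 * e)%:E)//.
  by rewrite -EFinM lee_fin mulrCA mulVf ?mulr1// gt_eqF.
apply: ge0_le_integral => //.
- by move=> y _; rewrite lee_fin invr_ge0 ltW.
- apply/measurable_EFinP; apply: (measurable_funS measurableT) => //.
  exact: measurable_poisson.
- move=> y; rewrite /I /= in_itv/= -ler_norml => ye.
  rewrite lee_fin /poisson ler_pdivlMr ?ltr_pwDl ?exprn_gt0// ?sqr_ge0//.
  rewrite mulrC ler_pdivrMr// -(real_normK (num_real y)).
  rewrite (_ : 2 * e * e = e ^+ 2 + e ^+ 2); last by ring.
  by rewrite lerD2l ler_sqr// ?nnegrE// ltW.
Qed.

Lemma measurable_poisson2 e : 0 < e -> measurable_fun [set: plane] (poisson2 e).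
Proof.
move=> e0; have mp := measurable_poisson e0.
by apply: measurable_funM; apply: (measurableT_comp mp).
Qed.

Lemma poisson2_ge0 e (z : R * R) : 0 < e -> 0 <= poisson2 e z.
Proof. by move=> e0; rewrite mulr_ge0 ?poisson_ge0. Qed.

Lemma plane_integral_tensor (f g : R -> R) :
  measurable_fun [set: R] f -> measurable_fun [set: R] g ->
  (forall x, 0 <= f x) -> (forall x, 0 <= g x) ->
  (\int[lam]_z (f z.1 * g z.2)%:E =
   (\int[mu]_x (f x)%:E) * \int[mu]_x (g x)%:E)%E.
Proof.
move=> mf mg f0 g0.
rewrite [LHS](@plane_tonelli R (fun z => (f z.1 * g z.2)%:E)); last 2 first.
- apply/measurable_EFinP; apply: measurable_funM.
  + exact: (measurableT_comp mf measurable_fst).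
  + exact: (measurableT_comp mg measurable_snd).
- by move=> z; rewrite lee_fin mulr_ge0.
rewrite -ge0_integralZr//; last 3 first.
- exact/measurable_EFinP.
- by move=> x _; rewrite lee_fin.
- exact: integral_EFin_ge0.
by apply: eq_integral => x _ /=; rewrite ge0_integral_scale.
Qed.

Definition poisson_mass e : R := Rintegral lam setT (poisson2 e).

Let integral_poisson_fin e : 0 < e ->
  (\int[mu]_y (poisson e y)%:E)%E \is a fin_num.
Proof.
move=> e0; rewrite ge0_fin_numE; last first.
  by apply: integral_EFin_ge0 => y; exact: poisson_ge0.
exact: le_lt_trans (integral_poisson_le e0) (ltry _).
Qed.

Lemma integral_poisson2 e : 0 < e ->
  (\int[lam]_z (poisson2 e z)%:E = (poisson_mass e)%:E)%E.
Proof.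
move=> e0; rewrite /poisson_mass /Rintegral fineK//.
rewrite plane_integral_tensor ?fin_numM ?integral_poisson_fin//.
- exact: measurable_poisson.
- exact: measurable_poisson.
- by move=> x; exact: poisson_ge0.
- by move=> x; exact: poisson_ge0.
Qed.

Lemma poisson_mass_ge e : 0 < e -> 4 <= poisson_mass e.
Proof.
move=> e0; rewrite -lee_fin -integral_poisson2// plane_integral_tensor; last 4 first.
- exact: measurable_poisson.
- exact: measurable_poisson.
- by move=> x; exact: poisson_ge0.
- by move=> x; exact: poisson_ge0.
rewrite (_ : 4%:E = 2%:E * 2%:E)%E; last by rewrite -EFinM -natrM.
by apply: lee_pmul; rewrite ?lee_fin ?integral_poisson_ge.
Qed.

(** Truncation at 1 lets one increment bound express both Lipschitz continuity and boundedness, and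
    keeps the Poisson moment finite. *)
Definition unit_dist (z : R * R) : R := Num.min 1 `|z.1| + Num.min 1 `|z.2|.

Lemma unit_dist_ge0 (z : R * R) : 0 <= unit_dist z.
Proof. by rewrite addr_ge0// le_min ler01/=. Qed.

Lemma measurable_unit_dist : measurable_fun [set: plane] unit_dist.
Proof.
have mm : measurable_fun [set: R] (fun y : R => Num.min 1 `|y|).
  by apply: measurable_minr => //; exact: measurable_normr.
by apply: measurable_funD; apply: (measurableT_comp mm).
Qed.

(** 32 is the number 2 of coordinates times a factor 4 for each of the two one-dimensional
    kernels. *)
Definition poisson_moment : R := 32 * decay_mass 2 * decay_mass (3 / 2).

Lemma integral_poisson2_unit_dist e : 0 < e ->
  (\int[lam]_z (poisson2 e z * unit_dist z)%:E <= (poisson_moment * Num.sqrt e)%:E)%E.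
Proof.
move=> e0; have mp := measurable_poisson e0.
have p0 x : 0 <= poisson e x := poisson_ge0 x e0.
pose pm (x : R) := poisson e x * Num.min 1 `|x|.
have mpm : measurable_fun [set: R] pm.
  apply: measurable_funM; first exact: measurable_poisson.
  by apply: measurable_minr => //; exact: measurable_normr.
have pm0 x : 0 <= pm x by rewrite mulr_ge0 ?poisson_ge0// le_min ler01/=.
have E z : (poisson2 e z * unit_dist z)%:E =
    ((pm z.1 * poisson e z.2)%:E + (poisson e z.1 * pm z.2)%:E)%E.
  rewrite -EFinD; congr _%:E; rewrite /poisson2 /unit_dist /pm.
  by move: (Num.min _ _) (Num.min _ _) => *; ring.
under eq_integral do rewrite E.
rewrite ge0_integralD//; last 4 first.
- by move=> z _; rewrite lee_fin mulr_ge0.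
- apply/measurable_EFinP; apply: measurable_funM; [exact: (measurableT_comp mpm measurable_fst)|exact: (measurableT_comp mp measurable_snd)].
- by move=> z _; rewrite lee_fin mulr_ge0.
- apply/measurable_EFinP; apply: measurable_funM; [exact: (measurableT_comp mp measurable_fst)|exact: (measurableT_comp mpm measurable_snd)].
rewrite !plane_integral_tensor//.
have i1 := integral_poisson_le e0; have i2 := integral_poisson_min_le e0.
have g1 := integral_EFin_ge0 mu p0; have g2 := integral_EFin_ge0 mu pm0.
apply: (le_trans (leeD (lee_pmul g2 g1 i2 i1) (lee_pmul g1 g2 i1 i2))).
rewrite -!EFinM -EFinD lee_fin; apply: le_of_eq.
by rewrite /poisson_moment; move: (Num.sqrt _) (decay_mass _) (decay_mass _) => *; ring.
Qed.

Section Convolution.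
Variables (e K : R) (u : R * R -> R[i]).
Hypothesis e0 : 0 < e.
Hypothesis mu_ : cmeasurable (u : plane -> R[i]).
Hypothesis K0 : 0 <= K.
Hypothesis uL : forall z w, Normc.normc (u z - u w) <= K * unit_dist (vsub w z).

(** Moving [u w] under the integral leaves the increments of [u] against the kernel, which the
    truncated moment controls with rate sqrt e, uniformly in [w]. *)
Lemma poisson_approximation w :
  Normc.normc (cintegral lam (fun z => u z * (poisson2 e (vsub w z))%:C%C) -
    u w * (poisson_mass e)%:C%C) <= 2 * (K * (poisson_moment * Num.sqrt e)).
Proof.
have mv : measurable_fun [set: plane] (fun z => vsub w z : plane).
  by apply: measurable_vsub.
have mP : measurable_fun [set: plane] (fun z => poisson2 e (vsub w z)).
  exact: (measurableT_comp (measurable_poisson2 e0) mv).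
have P0 z : 0 <= poisson2 e (vsub w z) := poisson2_ge0 _ e0.
have iP : (\int[lam]_z (poisson2 e (vsub w z))%:E = (poisson_mass e)%:E)%E.
  rewrite -integral_poisson2//.
  apply: (@integral_vsubl R w (fun z => (poisson2 e z)%:E)).
    by apply/measurable_EFinP; exact: measurable_poisson2.
  by move=> z; rewrite lee_fin poisson2_ge0.
have cP : cmeasurable (fun z : plane => (poisson2 e (vsub w z))%:C%C).
  exact: cmeasurable_real.
have ciP : cintegrable lam (fun z : plane => (poisson2 e (vsub w z))%:C%C).
  apply: (cintegrable_le cP mP) => [z|]; last by rewrite iP ltry.
  by rewrite normc_real ger0_norm.
have -> : (poisson_mass e)%:C%C = cintegral lam (fun z => (poisson2 e (vsub w z))%:C%C).
  rewrite /cintegral/= Rintegral_cst// mul0r; congr (_ +i* _)%C.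
  by rewrite /Rintegral iP.
have dist2 z : unit_dist z <= 2 by rewrite -natr1 lerD// ge_min lexx.
have uB z : Normc.normc (u z) <= Normc.normc (u w) + K * 2.
  rewrite -[u z](subrK (u w)) addrC; apply: (le_trans (le_normcD _ _)).
  by rewrite lerD2l (le_trans (uL _ _))// ler_wpM2l.
have muP : cmeasurable (fun z : plane => u z * (poisson2 e (vsub w z))%:C%C).
  exact: cmeasurableM.
have iuP : cintegrable lam (fun z : plane => u z * (poisson2 e (vsub w z))%:C%C).
  have mB : measurable_fun [set: plane]
      (fun z => (Normc.normc (u w) + K * 2) * poisson2 e (vsub w z)).
    exact: measurable_funM.
  apply: (cintegrable_le muP mB) => [z|].
    by rewrite Normc.normcM normc_real (ger0_norm (P0 z)) ler_wpM2r.
  have B0 : 0 <= Normc.normc (u w) + K * 2 by rewrite addr_ge0 ?normc_ge0 ?mulr_ge0.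
  by rewrite ge0_integral_scale// iP -EFinM ltry.
have iuwP : cintegrable lam (fun z : plane => u w * (poisson2 e (vsub w z))%:C%C).
  have mB : measurable_fun [set: plane]
      (fun z => Normc.normc (u w) * poisson2 e (vsub w z)).
    exact: measurable_funM.
  apply: (cintegrable_le _ mB) => [|z|].
  - by apply: cmeasurableM => //; exact: cmeasurable_cst.
  - by rewrite Normc.normcM normc_real (ger0_norm (P0 z)).
  by rewrite ge0_integral_scale ?normc_ge0// iP -EFinM ltry.
rewrite -cintegralZl// -cintegralB//.
have mB : measurable_fun [set: plane]
    (fun z => K * (poisson2 e (vsub w z) * unit_dist (vsub w z))).
  apply: measurable_funM => //; apply: measurable_funM => //.
  exact: (measurableT_comp measurable_unit_dist mv).
apply: (normc_cintegral_bound (cmeasurableB iuP.1 iuwP.1) mB).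
- move=> z; rewrite -mulrBl Normc.normcM normc_real (ger0_norm (P0 z)).
  by rewrite [leRHS]mulrCA [leLHS]mulrC; apply: (ler_wpM2l (P0 z)); exact: uL.
rewrite ge0_integral_scale//; last 2 first.
- apply: measurable_funM => //.
  exact: (measurableT_comp measurable_unit_dist mv).
- by move=> z; rewrite mulr_ge0 ?unit_dist_ge0.
rewrite EFinM lee_wpmul2l ?lee_fin//.
apply: le_trans (integral_poisson2_unit_dist e0).
apply: le_of_eq.
apply: (@integral_vsubl R w (fun z => (poisson2 e z * unit_dist z)%:E)).
  apply/measurable_EFinP; apply: measurable_funM; last exact: measurable_unit_dist.
  exact: measurable_poisson2.
by move=> z; rewrite lee_fin mulr_ge0 ?unit_dist_ge0 ?poisson2_ge0.
Qed.

End Convolution.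
End ApproximateIdentity.

(** * The transform of a product against the convolution of transforms *)

Section FourierConvolution.
Variable R : realType.
Local Notation RT := (measurableTypeR R).
Local Notation plane := (RT * RT)%type.
Local Notation lam := (@plane_measure R).
Local Notation normc := Normc.normc.
Implicit Types (e : R) (w y z zeta : R * R).

Definition dot z y : R := z.1 * y.1 + z.2 * y.2.

Lemma measurable_dot d (T : measurableType d) (f g : T -> plane) :
  measurable_fun [set: T] f -> measurable_fun [set: T] g ->
  measurable_fun [set: T] (fun x => dot (f x) (g x)).
Proof.
move=> mf mg; apply: measurable_funD; apply: measurable_funM.
- exact: (measurableT_comp measurable_fst mf).
- exact: (measurableT_comp measurable_fst mg).
- exact: (measurableT_comp measurable_snd mf).
- exact: (measurableT_comp measurable_snd mg).
Qed.

Definition character zeta z : R[i] := expi (- dot z zeta).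

Lemma normc_character zeta z : normc (character zeta z) = 1.
Proof. exact: normc_expi. Qed.

Lemma character_vsub zeta z y :
  character (vsub zeta z) y = character zeta y * expi (dot z y).
Proof. by rewrite -expiD; congr expi; rewrite /dot /=; ring. Qed.

Lemma cmeasurable_character d (T : measurableType d) (f g : T -> plane) :
  measurable_fun [set: T] f -> measurable_fun [set: T] g ->
  cmeasurable (fun x => character (f x) (g x)).
Proof.
move=> mf mg; apply: cmeasurable_expi.
exact: (measurableT_comp (@oppr_measurable R setT) (measurable_dot mg mf)).
Qed.

Lemma cmeasurable_characterM zeta (h : R * R -> R[i]) :
  cmeasurable (h : plane -> R[i]) ->
  cmeasurable ((fun z => character zeta z * h z) : plane -> R[i]).
Proof.
move=> mh; apply: cmeasurableM => //; apply: cmeasurable_character => //.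
Qed.

Lemma fourierE u zeta :
  fourier u zeta = cintegral lam (fun z => character zeta z * u z).
Proof.
rewrite /fourier -[LHS]/(cintegral lam _); apply: eq_cintegral => z.
by rewrite -expiD /character /dot opprD.
Qed.

(* Multiplication by the positive integrable weight [abel2 1] reduces the
   statement to a function dominated by an integrable tensor product. *)
Lemma cmeasurable_cintegral_bounded (G : plane * plane -> R[i]) (q : plane -> R) :
  cmeasurable G -> measurable_fun [set: plane] q -> (forall y, 0 <= q y) ->
  (\int[lam]_y (q y)%:E < +oo)%E ->
  (forall x y, normc (G (x, y)) <= q y) ->
  cmeasurable (fun x => cintegral lam (fun y => G (x, y))).
Proof.
move=> mG mq q0 iq Gq.
have ma : measurable_fun [set: plane] (abel2 (1 : R)) by exact: measurable_abel2.
have a0 (x : plane) : 0 < abel2 (1 : R) x := abel2_gt0 _ _.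
have m1 : measurable_fun [set: plane * plane] (fun x : plane * plane => x.1) by exact: measurable_fst.
have m2 (x : plane) : measurable_fun [set: plane] (fun y : plane => (x, y)).
  exact: pair1_measurable.
pose H (x : plane * plane) := (abel2 1 x.1)%:C%C * G x.
have mH : cmeasurable H.
  apply: cmeasurableM => //; apply: cmeasurable_real.
  exact: (measurableT_comp ma m1).
have Hb x y : normc (H (x, y)) <= abel2 1 x * q y.
  by rewrite Normc.normcM normc_real gtr0_norm// ler_wpM2l// ltW.
have cH := cmeasurable_cintegral1 mH ma mq (integral_abel2 ltr01) iq
  (fun x => ltW (a0 x)) q0 Hb.
rewrite (_ : (fun x => _) = (fun x => ((abel2 1 x)^-1)%:C%C *
    cintegral lam (fun y => H (x, y)))); last first.
  apply/funext => x.
  have iG : cintegrable lam (fun y => G (x, y)).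
    by apply: (cintegrable_le _ mq (Gq x) iq); exact: (cmeasurable_comp mG (m2 x)).
  rewrite (_ : cintegral lam (fun y => H (x, y)) =
      (abel2 1 x)%:C%C * cintegral lam (fun y => G (x, y))); last first.
    by rewrite -cintegralZl.
  by rewrite mulrA -rmorphM mulVf ?gt_eqF// mul1r.
apply: cmeasurableM => //; apply: cmeasurable_real.
under eq_fun do rewrite /abel2 /abel -expRD -expRN opprD !opprK !mul1r.
apply: (measurableT_comp (f := @expR R)) => //.
by apply: measurable_funD; apply: (measurableT_comp (@normr_measurable R setT)).
Qed.

Variables (u v : R * R -> R[i]) (p q : R * R -> R) (P Q K : R).
Hypotheses (um : cmeasurable (u : plane -> R[i])) (vm : cmeasurable (v : plane -> R[i])).
Hypotheses (pm : measurable_fun [set: plane] p) (qm : measurable_fun [set: plane] q).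
Hypotheses (up : forall z, normc (u z) <= p z) (vq : forall z, normc (v z) <= q z).
Hypotheses (ip : (\int[lam]_z (p z)%:E <= P%:E)%E) (iq : (\int[lam]_z (q z)%:E <= Q%:E)%E).
Hypothesis K0 : 0 <= K.
Hypothesis uL : forall z w, normc (u z - u w) <= K * unit_dist (vsub w z).

Let p0 z : 0 <= p z := le_trans (normc_ge0 _) (up z).
Let q0 z : 0 <= q z := le_trans (normc_ge0 _) (vq z).
Let ipy : (\int[lam]_z (p z)%:E < +oo)%E := le_lt_trans ip (ltry _).
Let iqy : (\int[lam]_z (q z)%:E < +oo)%E := le_lt_trans iq (ltry _).

Let fst2 : measurable_fun [set: plane * plane] (fun x : plane * plane => x.1).
Proof. exact: measurable_fst. Qed.

Let snd2 : measurable_fun [set: plane * plane] (fun x : plane * plane => x.2).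
Proof. exact: measurable_snd. Qed.

Lemma cmeasurable_fourier_of (h : R * R -> R[i]) (k : R * R -> R) :
  cmeasurable (h : plane -> R[i]) -> measurable_fun [set: plane] k ->
  (forall z, normc (h z) <= k z) -> (\int[lam]_z (k z)%:E < +oo)%E ->
  cmeasurable (fourier h : plane -> R[i]).
Proof.
move=> mh mk hk ik; rewrite (_ : fourier h =
    (fun x => cintegral lam (fun y => character x y * h y))); last first.
  by apply/funext => x; rewrite fourierE.
apply: (@cmeasurable_cintegral_bounded (fun x => character x.1 x.2 * h x.2) k) => //.
- apply: cmeasurableM; first exact: cmeasurable_character.
  exact: (cmeasurable_comp mh snd2).
- by move=> z; exact: le_trans (normc_ge0 _) (hk z).
- by move=> x y; rewrite Normc.normcM normc_character mul1r.
Qed.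

Lemma normc_fourier_le (h : R * R -> R[i]) (k : R * R -> R) (B : R) zeta :
  cmeasurable (h : plane -> R[i]) -> measurable_fun [set: plane] k ->
  (forall z, normc (h z) <= k z) -> (\int[lam]_z (k z)%:E <= B%:E)%E ->
  normc (fourier h zeta) <= 2 * B.
Proof.
move=> mh mk hk ik; rewrite fourierE.
apply: (@normc_cintegral_bound _ _ plane _ _ k) => //.
  exact: cmeasurable_characterM.
by move=> x; rewrite Normc.normcM normc_character mul1r.
Qed.

Let P0 : 0 <= 2 * P.
Proof. exact: le_trans (normc_ge0 _) (normc_fourier_le (0, 0) um pm up ip). Qed.

Let mhu : cmeasurable (fourier u : plane -> R[i]) := cmeasurable_fourier_of um pm up ipy.
Let mhv : cmeasurable (fourier v : plane -> R[i]) := cmeasurable_fourier_of vm qm vq iqy.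
Let hup z : normc (fourier u z) <= 2 * P := normc_fourier_le z um pm up ip.

Let bounded_u : exists B, forall z : R * R, normc (u z) <= B.
Proof.
exists (normc (u (0, 0)) + K * 2) => z.
have d2 (w : R * R) : unit_dist w <= 2 by rewrite -natr1 lerD// ge_min lexx.
rewrite -[u z](subrK (u (0, 0))) addrC; apply: (le_trans (le_normcD _ _)).
by rewrite lerD2l (le_trans (uL _ _))// ler_wpM2l.
Qed.

Let cintegrable_character_bounded zeta (f : R * R -> R[i]) (B : R) :
  cmeasurable (f : plane -> R[i]) -> (forall z, normc (f z) <= B) ->
  cintegrable lam (fun y => character zeta y * v y * f y).
Proof.
move=> mf fB; have B0 : 0 <= B := le_trans (normc_ge0 _) (fB (0, 0)).
have mqB : measurable_fun [set: plane] (fun z => B * q z) by exact: measurable_funM.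
apply: (cintegrable_le _ mqB).
- by apply: cmeasurableM => //; exact: cmeasurable_characterM.
- move=> z; rewrite !Normc.normcM normc_character mul1r mulrC.
  by apply: ler_pM; rewrite ?normc_ge0.
by rewrite ge0_integral_scale// lte_mul_pinfty ?lee_fin.
Qed.

Let poisson_moment_ge0 : 0 <= poisson_moment R.
Proof.
have d2 : 0 < decay_mass (2 : R) by rewrite decay_mass_gt0//; lra.
have d3 : 0 < decay_mass (3 / 2 : R) by rewrite decay_mass_gt0//; lra.
exact: (mulr_ge0 (mulr_ge0 (ler0n _ 32) (ltW d2)) (ltW d3)).
Qed.

Let Q0 : 0 <= Q.
Proof.
by rewrite -lee_fin; apply: le_trans iq; exact: integral_EFin_ge0.
Qed.

Section Regularised.
Variable e : R.
Hypothesis e0 : 0 < e.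

Let ma : measurable_fun [set: plane] (abel2 e) := measurable_abel2 e.
Let a0 z : 0 <= abel2 e z := ltW (abel2_gt0 e z).
Let ia : (\int[lam]_z (abel2 e z)%:E < +oo)%E := integral_abel2 e0.

Let cma : cmeasurable (fun z : plane => (abel2 e z)%:C%C) := cmeasurable_real ma.

(** Abel-regularised Fourier inversion, without the factor (2 pi) ^ (- 2). *)
Let inverse_transform w : R[i] :=
  cintegral lam (fun z => (abel2 e z)%:C%C * expi (dot z w) * fourier u z).

(** The Abel factor makes the double integrand absolutely integrable, so the integrals may be
    exchanged; the frequency integral is then a Poisson kernel. *)
Let inverse_transformE w : inverse_transform w =
  cintegral lam (fun x => u x * (poisson2 e (vsub w x))%:C%C).
Proof.
pose G (x : plane * plane) :=
  (abel2 e x.1)%:C%C * expi (dot x.1 w) * (character x.1 x.2 * u x.2).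
have mw : measurable_fun [set: plane] (fun z => dot z w).
  by apply: measurable_dot => //; exact: measurable_cst.
have mG : cmeasurable G.
  apply: cmeasurableM; apply: cmeasurableM.
  - exact: (cmeasurable_comp cma fst2).
  - exact: (cmeasurable_comp (cmeasurable_expi mw) fst2).
  - exact: cmeasurable_character.
  - exact: (cmeasurable_comp um snd2).
have Gb x y : normc (G (x, y)) <= abel2 e x * p y.
  rewrite !Normc.normcM normc_real normc_expi normc_character mulr1 mul1r.
  by rewrite ger0_norm// ler_wpM2l.
have cu z : cintegrable lam (fun x => character z x * u x).
  apply: (cintegrable_le _ pm) => //.
    exact: cmeasurable_characterM.
  by move=> x; rewrite Normc.normcM normc_character mul1r.
rewrite /inverse_transform.
apply: (@etrans _ _ (cintegral lam (fun z : plane => cintegral lam (fun x => G (z, x))))).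
  by apply: eq_cintegral => z; rewrite fourierE -cintegralZl.
rewrite (cintegral_swap mG ma pm ia ipy a0 p0 Gb).
apply: eq_cintegral => x; rewrite -cintegral_abel2// -cintegralZl; last first.
  apply: (cintegrable_le _ ma) => //.
    apply: cmeasurableM => //; apply: cmeasurable_expi.
    by apply: (@measurable_dot _ _ id (fun=> vsub w x)) => //; exact: measurable_cst.
  by move=> z; rewrite Normc.normcM normc_real normc_expi mulr1 ger0_norm.
apply: eq_cintegral => z; rewrite /G /=.
have E : expi (dot z w) * character z x = expi (dot z (vsub w x)).
  by rewrite -expiD; congr expi; rewrite /dot /=; ring.
rewrite -[X in _ = _ * (_ * X)]/(expi (dot z (vsub w x))) -E.
by move: (_ %:C)%C (expi _) (character _ _) (u x) => *; ring.
Qed.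

Let cmeasurable_inverse_transform : cmeasurable (inverse_transform : plane -> R[i]).
Proof.
have mq2 : measurable_fun [set: plane] (fun z => abel2 e z * (2 * P)).
  exact: measurable_funM.
pose G (x : plane * plane) :=
  (abel2 e x.2)%:C%C * expi (dot x.2 x.1) * fourier u x.2.
apply: (@cmeasurable_cintegral_bounded G (fun z => abel2 e z * (2 * P))) => //.
- apply: cmeasurableM; first apply: cmeasurableM.
  + exact: (cmeasurable_comp cma snd2).
  + by apply: cmeasurable_expi; exact: measurable_dot.
  + exact: (cmeasurable_comp mhu snd2).
- by move=> z; rewrite mulr_ge0.
- under eq_integral do rewrite mulrC.
  by rewrite ge0_integral_scale// lte_mul_pinfty ?lee_fin.
- move=> x y; rewrite !Normc.normcM normc_real normc_expi mulr1 ger0_norm//.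
  by rewrite ler_wpM2l.
Qed.

Let inverse_transform_bounded : exists B, forall w, normc (inverse_transform w) <= B.
Proof.
have maP : measurable_fun [set: plane] (fun z => (2 * P) * abel2 e z).
  exact: measurable_funM.
exists (2 * (2 * P * fine (\int[lam]_z (abel2 e z)%:E))) => w.
apply: (@normc_cintegral_bound _ _ plane _ _ (fun z => (2 * P) * abel2 e z)) => //.
- apply: cmeasurableM => //; apply: cmeasurableM => //; apply: cmeasurable_expi.
  by apply: (@measurable_dot _ _ id (fun=> w)) => //; exact: measurable_cst.
- move=> z; rewrite !Normc.normcM normc_real normc_expi mulr1 ger0_norm// mulrC.
  by rewrite ler_wpM2r.
rewrite ge0_integral_scale// [leRHS]EFinM fineK// ge0_fin_numE//.
exact: integral_EFin_ge0.
Qed.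

(** The convolution of the two transforms with an Abel factor, which converges absolutely since both
    transforms are bounded. *)
Let regularised zeta : R[i] :=
  cintegral lam (fun z => (abel2 e z)%:C%C * fourier u z * fourier v (vsub zeta z)).

Let regularisedE zeta : regularised zeta =
  cintegral lam (fun y => character zeta y * v y * inverse_transform y).
Proof.
pose G (x : plane * plane) :=
  (abel2 e x.1)%:C%C * fourier u x.1 * (character (vsub zeta x.1) x.2 * v x.2).
have mv : measurable_fun [set: plane * plane] (fun x : plane * plane => vsub zeta x.1 : plane).
  by apply: measurable_vsub => //; exact: measurable_cst.
have mG : cmeasurable G.
  apply: cmeasurableM; apply: cmeasurableM.
  - exact: (cmeasurable_comp cma fst2).
  - exact: (cmeasurable_comp mhu fst2).
  - exact: (cmeasurable_character mv snd2).
  - exact: (cmeasurable_comp vm snd2).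
have maP : measurable_fun [set: plane] (fun z => abel2 e z * (2 * P)).
  exact: measurable_funM.
have iaP : (\int[lam]_z (abel2 e z * (2 * P))%:E < +oo)%E.
  under eq_integral do rewrite mulrC.
  by rewrite ge0_integral_scale// lte_mul_pinfty ?lee_fin.
have aP0 z : 0 <= abel2 e z * (2 * P) by rewrite mulr_ge0.
have Gb x y : normc (G (x, y)) <= abel2 e x * (2 * P) * q y.
  rewrite !Normc.normcM normc_real normc_character mul1r ger0_norm//.
  exact: (ler_pM (mulr_ge0 (a0 x) (normc_ge0 _)) (normc_ge0 _)
    (ler_wpM2l (a0 x) (hup x)) (vq y)).
rewrite /regularised.
apply: (@etrans _ _ (cintegral lam (fun z : plane => cintegral lam (fun y => G (z, y))))).
  apply: eq_cintegral => z; rewrite (fourierE v) -cintegralZl//.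
  apply: (cintegrable_le _ qm) => //; first exact: cmeasurable_characterM.
  by move=> y; rewrite Normc.normcM normc_character mul1r.
rewrite (cintegral_swap mG maP qm iaP iqy aP0 q0 Gb).
apply: eq_cintegral => y; rewrite /inverse_transform -cintegralZl.
  apply: eq_cintegral => z; rewrite /G /= character_vsub.
  by move: (_ %:C)%C (expi _) (character _ _) (fourier _ _) (v y) => *; ring.
apply: (cintegrable_le _ maP) => //.
  apply: cmeasurableM => //; apply: cmeasurableM => //; apply: cmeasurable_expi.
  by apply: (@measurable_dot _ _ id (fun=> y)) => //; exact: measurable_cst.
move=> z; rewrite !Normc.normcM normc_real normc_expi mulr1 ger0_norm//.
by rewrite ler_wpM2l.
Qed.

(** The regularised convolution is at most 2 J in modulus because the Abel factor is at most 1. By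
    Fubini it is also the transform of [v] times the Poisson average of [u], hence the Poisson mass
    times the transform of the product, up to O(sqrt e). That mass is at least 4. *)
Lemma fourier_product_approx zeta (J : R) :
  (\int[lam]_z (normc (fourier u z) * normc (fourier v (vsub zeta z)))%:E <= J%:E)%E ->
  4 * normc (fourier (fun z => u z * v z) zeta) <=
    2 * J + 4 * K * poisson_moment R * Q * Num.sqrt e.
Proof.
move=> hJ.
have mv : measurable_fun [set: plane] (fun z => vsub zeta z : plane).
  by apply: measurable_vsub => //; exact: measurable_cst.
have mhv2 : cmeasurable (fun z : plane => fourier v (vsub zeta z)).
  exact: (cmeasurable_comp mhv mv).
have h1 : normc (regularised zeta) <= 2 * J.
  apply: normc_cintegral_bound hJ.
  - by apply: cmeasurableM => //; exact: cmeasurableM.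
  - by apply: measurable_funM; exact: cmeasurable_normc.
  - move=> z; rewrite !Normc.normcM normc_real ger0_norm// -mulrA ler_piMl//.
      by rewrite mulr_ge0 ?normc_ge0.
    by rewrite /abel2 mulr_ile1 ?expR_ge0// -[leRHS]expR0 ler_expR oppr_le0 mulr_ge0// ltW.
set m := poisson_mass e.
have iA : cintegrable lam (fun y => character zeta y * v y * inverse_transform y).
  have [B hB] := inverse_transform_bounded.
  exact: (cintegrable_character_bounded _ _ hB).
have iuv : cintegrable lam (fun y => character zeta y * (u y * v y)).
  have [B hB] := bounded_u.
  have := cintegrable_character_bounded zeta um hB.
  by congr cintegrable; apply/funext => y; rewrite -mulrA (mulrC (u y)).
have c0 : 0 <= 2 * (K * (poisson_moment R * Num.sqrt e)).
  exact: (mulr_ge0 (ler0n _ 2) (mulr_ge0 K0 (mulr_ge0 poisson_moment_ge0 (sqrtr_ge0 e)))).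
have h2 : normc (regularised zeta - m%:C%C * fourier (fun z => u z * v z) zeta) <=
    2 * (2 * (K * (poisson_moment R * Num.sqrt e)) * Q).
  rewrite regularisedE fourierE -cintegralZl// -cintegralB//; last first.
    exact: cintegrableZl.
  apply: (@normc_cintegral_bound _ _ plane _ _
    (fun y => 2 * (K * (poisson_moment R * Num.sqrt e)) * q y)).
  - apply: cmeasurableB; first exact: iA.1.
    exact: (cintegrableZl m%:C%C iuv).1.
  - exact: measurable_funM.
  - move=> y; rewrite (_ : _ - _ = character zeta y * v y *
      (inverse_transform y - u y * m%:C%C)); last by ring.
    rewrite !Normc.normcM normc_character mul1r mulrC.
    apply: ler_pM; rewrite ?normc_ge0//.
    by rewrite inverse_transformE; exact: poisson_approximation.
  - by rewrite ge0_integral_scale// [leRHS]EFinM lee_wpmul2l// lee_fin.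
have m4 : 4 <= m by exact: poisson_mass_ge.
have F0 := normc_ge0 (fourier (fun z => u z * v z) zeta).
set F := fourier _ zeta in h2 F0 *.
have h3 : m * normc F <= 2 * J + 2 * (2 * (K * (poisson_moment R * Num.sqrt e)) * Q).
  rewrite -(ger0_norm (_ : 0 <= m)); last by rewrite (le_trans _ m4).
  rewrite -normc_real -Normc.normcM -[_ * F](subrK (regularised zeta)) addrC.
  apply: (le_trans (le_normcD _ _)); apply: lerD => //.
  by rewrite -normcN opprB.
rewrite (le_trans (ler_wpM2r F0 m4))// (le_trans h3)// lerD2l.
apply: le_of_eq.
by move: (Num.sqrt _) (poisson_moment _) => *; ring.
Qed.

End Regularised.

Lemma normc_fourier_product_le zeta :
  ((normc (fourier (fun z => u z * v z)%R zeta))%:E <=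
   \int[lam]_z (normc (fourier u z) * normc (fourier v (vsub zeta z)))%:E)%E.
Proof.
have I0 : (0 <= \int[lam]_z (normc (fourier u z) * normc (fourier v (vsub zeta z)))%:E)%E.
  by apply: integral_EFin_ge0 => z; rewrite mulr_ge0 ?normc_ge0.
case E : (\int[lam]_z _)%E I0 => [J| |] // J0; last by rewrite leey.
rewrite lee_fin; apply/ler_addgt0Pr => /= t0' t0p; move: t0' t0p => t t0.
pose k := 4 * K * poisson_moment R * Q + 1.
have k0 : 0 < k.
  exact: (ltr_wpDl (mulr_ge0 (mulr_ge0 (mulr_ge0 (ler0n _ 4) K0) poisson_moment_ge0) Q0) ltr01).
have s0 : 0 < t / k by rewrite divr_gt0.
(* The square root of this parameter is t / k, so the error is at most t; the + 1 in [k] keeps the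
   quotient meaningful. *)
have := @fourier_product_approx ((t / k) ^+ 2) _ zeta J.
rewrite exprn_gt0// E lexx => /(_ isT isT).
rewrite sqrtr_sqr gtr0_norm// => h.
have h2 : 4 * K * poisson_moment R * Q * (t / k) <= t.
  rewrite mulrCA ger_pMr// ler_pdivrMr// mul1r /k lerDl//.
rewrite lee_fin in J0.
rewrite -[leLHS]/(normc (fourier (fun z => u z * v z) zeta)).
have {h2}h := le_trans h (lerD (lexx (2 * J)) h2).
by move: (normc _) h => F h; lra.
Qed.

End FourierConvolution.

(** * Measurability, decay and differentiation on the plane *)

Section PlaneCalculus.
Variable R : realType.
Local Notation RT := (measurableTypeR R).
Local Notation plane := (RT * RT)%type.
Local Notation mu := (@lebesgue_measure R).
Local Notation lam := (@plane_measure R).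
Local Notation normc := Normc.normc.
Implicit Types (f g : R * R -> R) (z w : R * R).

(** The measurable sets of the plane are those of the product structure, so an open set is written
    as the countable union of the rational boxes that it contains. *)
Lemma open_measurable_plane (U : set (R * R)) : open U -> measurable (U : set plane).
Proof.
move=> oU.
pose box (a b c d : rat) : set plane :=
  `](ratr a : R), (ratr b : R)[%classic `*` `](ratr c : R), (ratr d : R)[%classic.
have mbox a b c d : measurable (box a b c d).
  by apply: measurableX; exact: measurable_itv.
rewrite (_ : U = \bigcup_a \bigcup_b \bigcup_c \bigcup_d
    (if `[< box a b c d `<=` U >] then box a b c d else set0)).
  do 4! (apply: bigcupT_measurable_rat => ?).
  by case: ifP.
apply/seteqP; split => [z Uz|z [a _ [b _ [c _ [d _]]]]]; last first.
  by case: asboolP => // h; exact: h.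
have /nbhs_ballP[e /= e0 he] : nbhs z U by apply: open_nbhs_nbhs; split.
have h1 (x : R) : x - e < x by rewrite ltrBlDr ltrDl.
have h2 (x : R) : x < x + e by rewrite ltrDl.
have [a] := rat_in_itvoo (h1 z.1); rewrite in_itv/= => /andP[a1 a2].
have [b] := rat_in_itvoo (h2 z.1); rewrite in_itv/= => /andP[b1 b2].
have [c] := rat_in_itvoo (h1 z.2); rewrite in_itv/= => /andP[c1 c2].
have [d] := rat_in_itvoo (h2 z.2); rewrite in_itv/= => /andP[d1 d2].
exists a => //; exists b => //; exists c => //; exists d => //.
rewrite asboolT; first by split; rewrite /= in_itv/=; apply/andP.
move=> w [/=]; rewrite !in_itv/= => /andP[w1 w2] /andP[w3 w4]; apply: he.
split; rewrite /= -ball_normE /ball_/= ltr_distlC; apply/andP; split.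
- exact: lt_trans a1 w1.
- exact: lt_trans w2 b2.
- exact: lt_trans c1 w3.
- exact: lt_trans w4 d2.
Qed.

Lemma continuous_measurable_plane f : continuous f ->
  measurable_fun [set: plane] (f : plane -> R).
Proof.
move=> /continuousP cf; apply: (measurability _ (RGenOInfty.measurableE R)).
move=> _ [_ [x ->] <-]; rewrite setTI.
by apply: open_measurable_plane; apply: cf; exact: interval_open.
Qed.

Definition decay2 z : R := decay 2 z.1 * decay 2 z.2.

Lemma decay2_gt0 z : 0 < decay2 z.
Proof. by rewrite mulr_gt0 ?powR_gt0// ltr_pwDl. Qed.

Lemma decay2_ge0 z : 0 <= decay2 z.
Proof. exact: ltW (decay2_gt0 z). Qed.

Lemma decay2_coef_ge0 (c x : R) z : `|x| <= c * decay2 z -> 0 <= c.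
Proof. by move=> h; rewrite -(pmulr_lge0 _ (decay2_gt0 z)) (le_trans _ h). Qed.

Lemma decay_le1 (x : R) : decay 2 x <= 1.
Proof. by rewrite decay2E invf_le1 ?exprn_gt0 ?ltr_pwDl// exprn_ege1// lerDl. Qed.

Lemma decay2_le1 z : decay2 z <= 1.
Proof. by rewrite mulr_ile1 ?decay_ge0 ?decay_le1. Qed.

Lemma measurable_decay2 : measurable_fun [set: plane] decay2.
Proof.
by apply: measurable_funM; apply: (measurableT_comp (measurable_decay 2)).
Qed.

Let integral_decay0 : (\int[mu]_x (decay 2 x)%:E <= (decay_mass 2)%:E)%E.
Proof.
have := @integral_decay R 2 0; under eq_integral do rewrite subr0.
by apply; lra.
Qed.

Lemma integral_decay2 : (\int[lam]_z (decay2 z)%:E <= (decay_mass 2 ^+ 2)%:E)%E.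
Proof.
rewrite plane_integral_tensor; first last.
- by move=> x; exact: decay_ge0.
- by move=> x; exact: decay_ge0.
- exact: measurable_decay.
- exact: measurable_decay.
have i0 := integral_EFin_ge0 mu (@decay_ge0 R 2).
by rewrite expr2 EFinM; apply: lee_pmul.
Qed.

(* Differentiable with continuous [partial_x f], and integrable together with
   [partial_x f] thanks to the tensor decay. *)
Definition rapid f : Prop := [/\ forall z, differentiable f z,
  continuous (partial_x f) &
  exists M, forall z, `|f z| <= M * decay2 z /\ `|partial_x f z| <= M * decay2 z].

Lemma rapid_continuous f : rapid f -> continuous f.
Proof. by move=> [df _ _] z; exact: differentiable_continuous. Qed.

(** The reason for this class: a product of Schwartz functions is differentiated only once, so
    stability under products is proved for one derivative instead of all the iterated ones. *)
Lemma rapidM f g : rapid f -> rapid g -> rapid (fun z => f z * g z).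
Proof.
move=> rf rg; have cf := rapid_continuous rf; have cg := rapid_continuous rg.
case: rf rg => df cfx [M fM] [dg cgx [N gN]].
have E z : partial_x (fun z => f z * g z) z = f z * partial_x g z + g z * partial_x f z.
  by apply: deriveM; exact: diff_derivable.
split; first by move=> z; exact: differentiableM.
  rewrite (_ : partial_x _ = (fun z => f z * partial_x g z + g z * partial_x f z)).
    by move=> z; apply: cvgD; apply: cvgM; [exact: cf|exact: cgx|exact: cg|exact: cfx].
  by apply/funext => z; exact: E.
have M0 := decay2_coef_ge0 (fM (0, 0)).1; have N0 := decay2_coef_ge0 (gN (0, 0)).1.
have MN0 z : 0 <= M * N * decay2 z := mulr_ge0 (mulr_ge0 M0 N0) (decay2_ge0 z).
have prod (x y : R) z : `|x| <= M * decay2 z -> `|y| <= N * decay2 z ->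
    `|x * y| <= M * N * decay2 z.
  move=> hx hy; rewrite normrM (le_trans (ler_pM _ _ hx hy))//.
  rewrite mulrACA mulrA.
  by rewrite ler_piMr ?decay2_le1.
exists (M * N + M * N) => z; rewrite mulrDl E.
have [f1 f2] := fM z; have [g1 g2] := gN z; split.
  by rewrite (le_trans (prod _ _ _ f1 g1))// lerDl.
by apply: (le_trans (ler_normD _ _)); apply: lerD; [|rewrite mulrC]; exact: prod.
Qed.

Lemma rapidD f g : rapid f -> rapid g -> rapid (fun z => f z + g z).
Proof.
move=> [df cfx [M fM]] [dg cgx [N gN]].
have E z : partial_x (fun z => f z + g z) z = partial_x f z + partial_x g z.
  by apply: deriveD; exact: diff_derivable.
split; first by move=> z; exact: differentiableD.
  rewrite (_ : partial_x _ = (fun z => partial_x f z + partial_x g z)).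
    by move=> z; apply: cvgD; [exact: cfx|exact: cgx].
  by apply/funext => z; exact: E.
exists (M + N) => z; rewrite mulrDl E.
have [f1 f2] := fM z; have [g1 g2] := gN z.
by split; apply: (le_trans (ler_normD _ _)); exact: lerD.
Qed.

Lemma rapidN f : rapid f -> rapid (fun z => - f z).
Proof.
move=> [df cfx [M fM]].
have E z : partial_x (fun z => - f z) z = - partial_x f z.
  by apply: deriveN; exact: diff_derivable.
split; first by move=> z; exact: differentiableN.
  rewrite (_ : partial_x _ = (fun z => - partial_x f z)).
    by move=> z; apply: cvgN; exact: cfx.
  by apply/funext => z; exact: E.
by exists M => z; rewrite E !normrN.
Qed.

(** As (1 + |x|) ^ 2 <= 2 (1 + x ^ 2) in each variable, the product (1 + x ^ 2) (1 + t ^ 2) has to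
    be controlled; its four monomials are the four seminorms used. *)
Lemma schwartz_decay f (w : seq bool) : schwartz_real f ->
  exists M, forall z, `|iter_partial w f z| <= M * decay2 z.
Proof.
move=> [_ sf]; have [M00 h00] := sf 0%N 0%N w; have [M20 h20] := sf 2%N 0%N w.
have [M02 h02] := sf 0%N 2%N w; have [M22 h22] := sf 2%N 2%N w.
exists (4 * (M00 + M20 + M02 + M22)) => z.
move: (h00 z) (h20 z) (h02 z) (h22 z); set F := iter_partial w f z.
rewrite !expr0 !mul1r !mulr1 !normrM -!expr2 !real_normK ?num_real// => g00 g20 g02 g22.
have a1 : 0 < 1 + `|z.1| by rewrite ltr_pwDl.
have a2 : 0 < 1 + `|z.2| by rewrite ltr_pwDl.
rewrite /decay2 !decay2E -invfM ler_pdivlMr ?mulr_gt0 ?exprn_gt0//.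
have q (x : R) : (1 + `|x|) ^+ 2 <= 2 * (1 + x ^+ 2).
  have := sqr_ge0 (1 - `|x|); rewrite -(real_normK (num_real x)).
  by move: `|x| => t; lra.
apply: (@le_trans _ _ (`|F| * ((2 * (1 + z.1 ^+ 2)) * (2 * (1 + z.2 ^+ 2))))).
  by rewrite ler_wpM2l// ler_pM ?sqr_ge0.
rewrite (_ : _ * _ = 4 * (`|F| + z.1 ^+ 2 * `|F| + z.2 ^+ 2 * `|F| + z.1 ^+ 2 * z.2 ^+ 2 * `|F|)).
  by rewrite ler_pM2l// !lerD.
by move: (z.1 ^+ 2) (z.2 ^+ 2) `|F| => A B C; ring.
Qed.

Lemma schwartz_rapid f : schwartz_real f -> rapid f.
Proof.
move=> sf; have [sm _] := sf; split.
- by move=> z; exact: (sm [::] z).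
- by move=> z; apply: differentiable_continuous; exact: (sm [:: true] z).
have [M hM] := schwartz_decay [::] sf; have [N hN] := schwartz_decay [:: true] sf.
exists (Num.max M N) => z; split.
  by apply: (le_trans (hM z)); rewrite ler_wpM2r ?decay2_ge0// le_max lexx.
by apply: (le_trans (hN z)); rewrite ler_wpM2r ?decay2_ge0// le_max lexx orbT.
Qed.

Lemma is_derive_partial_x f (x t : R) : differentiable f (x, t) ->
  is_derive x (1 : R) (fun x => f (x, t)) (partial_x f (x, t)).
Proof.
move=> df; have dx := @diff_derivable _ _ _ _ _ ((1, 0) : R * R) df.
have E : (fun h : R => h^-1 *: ((f \o shift (x, t)) (h *: (1, 0)) - f (x, t))) =
    (fun h : R => h^-1 *: (((fun x => f (x, t)) \o shift x) (h *: 1) - f (x, t))).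
  apply/funext => h; congr (_ *: (f _ - _)); congr (_, _) => /=; by rewrite scaler0 add0r.
by split; [rewrite /derivable -E|rewrite /partial_x /derive -E].
Qed.

Lemma is_derive_partial_t f (x t : R) : differentiable f (x, t) ->
  is_derive t (1 : R) (fun t => f (x, t)) (partial_t f (x, t)).
Proof.
move=> df; have dt := @diff_derivable _ _ _ _ _ ((0, 1) : R * R) df.
have E : (fun h : R => h^-1 *: ((f \o shift (x, t)) (h *: (0, 1)) - f (x, t))) =
    (fun h : R => h^-1 *: (((fun t => f (x, t)) \o shift t) (h *: 1) - f (x, t))).
  apply/funext => h; congr (_ *: (f _ - _)); congr (_, _) => /=; by rewrite scaler0 add0r.
by split; [rewrite /derivable -E|rewrite /partial_t /derive -E].
Qed.

(** On [- n, n] the integral is the difference of two boundary values, of size O(1 / n) by the decay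
    of [F]; dominated convergence passes to the whole line. *)
Lemma Rintegral_derivative0 (F h : R -> R) (M : R) :
  (forall x : R, is_derive x (1 : R) F (h x)) -> continuous h ->
  mu.-integrable setT (EFin \o h) -> (forall x : R, `|F x| <= M * decay 2 x) ->
  Rintegral mu setT h = 0.
Proof.
move=> dF ch ih FM.
pose I (n : nat) : set RT := `[- n%:R, n%:R]%classic.
have mI n : measurable (I n) by exact: measurable_itv.
pose hn (n : nat) := (EFin \o h) \_ (I n).
have mh : measurable_fun [set: RT] (EFin \o h) by case/integrableP : ih.
have M0 : 0 <= M.
  have := le_trans (normr_ge0 _) (FM 0).
  by rewrite pmulr_lge0// powR_gt0// ltr_pwDl.
have mhn n : measurable_fun [set: RT] (hn n).
  apply/(measurable_restrictT _ (mI n)); exact: (measurable_funS measurableT).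
have cvgh : {ae mu, forall x, [set: RT] x -> hn ^~ x @ \oo --> (EFin \o h) x}.
  apply: aeW => x _; apply: cvg_near_cst; near=> n.
  rewrite /hn patchE ifT// inE /I /= in_itv/= -ler_norml.
  by near: n; exact: nbhs_infty_ger.
have iah : mu.-integrable setT (abse \o (EFin \o h)) by exact: integrable_abse.
have bnd : {ae mu, forall x n, [set: RT] x -> (`|hn n x| <= (abse \o (EFin \o h)) x)%E}.
  apply: aeW => x n _; rewrite /hn patchE; case: ifP => // _.
  by rewrite abse0 abse_ge0.
have [_ _ dc] := @dominated_convergence _ RT R mu setT measurableT hn (EFin \o h)
  (abse \o (EFin \o h)) mhn mh cvgh iah bnd.
have E n : (\int[mu]_x hn n x = (F n%:R - F (- n%:R))%:E)%E.
  rewrite -integral_mkcond; apply: integral_derivative => //.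
  by rewrite lerNl (le_trans _ (ler0n _ _))// oppr_le0.
have lim0 : (F n%:R - F (- n%:R)) @[n --> \oo] --> (0 : R).
  have hb n : `|F n%:R - F (- n%:R)| <= 2 * M * harmonic n.
    apply: (le_trans (ler_normB _ _)); rewrite -mulrA mulr_natl mulr2n.
    have d1 : decay 2 (n%:R : R) <= harmonic n.
      rewrite decay2E /harmonic/= ger0_norm// -nat1r lef_pV2 ?posrE ?exprn_gt0 ?ltr_pwDl//.
      by rewrite expr2 ler_peMr ?lerDl ?addr_ge0.
    apply: lerD; apply: (le_trans (FM _)); rewrite ?decayN; exact: ler_wpM2l.
  apply: norm_cvg0.
  apply: (@squeeze_cvgr _ _ _ _ (fun=> 0) (fun n => 2 * M * harmonic n)).
  - by near=> n; rewrite normr_ge0 hb.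
  - exact: cvg_cst.
  - by rewrite -(mulr0 (2 * M)); apply: cvgM; [exact: cvg_cst|exact: cvg_harmonic].
have := dc; rewrite [X in X @ \oo --> _](_ : _ = (fun n => (F n%:R - F (- n%:R))%:E)); last first.
  by apply/funext => n; exact: E.
move=> dc'; rewrite /Rintegral -(cvg_lim _ dc')//.
have -> : limn (fun n => (F n%:R - F (- n%:R))%:E) = 0%E; last by [].
by apply: cvg_lim => //; apply: cvg_EFin => //; near=> n.
Unshelve. all: by end_near. Qed.

End PlaneCalculus.

(** * The Fourier transform of a derivative *)

Section FourierDerivative.
Variable R : realType.
Local Notation RT := (measurableTypeR R).
Local Notation plane := (RT * RT)%type.
Local Notation mu := (@lebesgue_measure R).
Local Notation lam := (@plane_measure R).
Local Notation normc := Normc.normc.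
Implicit Types (f g : R * R -> R) (z w zeta : R * R).

Lemma continuous_section f (t : R) : continuous f -> continuous (fun x : R => f (x, t)).
Proof.
move=> cf x; apply: (@continuous_comp _ _ _ (fun x : R => (x, t)) f); last exact: cf.
have h1 : (id y) @[y --> x] --> x by exact: cvg_id.
have h2 : (fun=> t) y @[y --> x] --> t by exact: cvg_cst.
exact: (cvg_pair h1 h2).
Qed.

Let integral_decay_lty : (\int[mu]_x (decay 2 (x : R))%:E < +oo)%E.
Proof.
have := @integral_decay R 2 0; under eq_integral do rewrite subr0.
by move=> h; apply: le_lt_trans (ltry _); apply: h; lra.
Qed.

Lemma integral_scaled_decay2 (M : R) : 0 <= M ->
  (\int[lam]_z (M * decay2 z)%:E <= (M * decay_mass 2 ^+ 2)%:E)%E.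
Proof.
move=> M0; rewrite ge0_integral_scale//; last 2 first.
- exact: measurable_decay2.
- by move=> z; exact: decay2_ge0.
by rewrite EFinM lee_wpmul2l ?lee_fin//; exact: integral_decay2.
Qed.

Let integrable_decay2_le f (M : R) : measurable_fun [set: plane] (f : plane -> R) ->
  (forall z, `|f z| <= M * decay2 z) -> lam.-integrable setT (EFin \o f).
Proof.
move=> mf fM; apply/integrableP; split; first exact/measurable_EFinP.
have M0 : 0 <= M := decay2_coef_ge0 (fM (0, 0)).
apply: le_lt_trans (le_lt_trans (integral_scaled_decay2 M0) (ltry _)).
apply: ge0_le_integral => //.
- by apply: measurableT_comp => //; exact/measurable_EFinP.
- apply/measurable_EFinP; apply: measurable_funM => //; exact: measurable_decay2.
- by move=> z _; rewrite lee_fin.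
Qed.

Lemma Rintegral_partial_x0 (g gx : R * R -> R) (M : R) :
  measurable_fun [set: plane] (gx : plane -> R) ->
  (forall x t : R, is_derive x (1 : R) (fun x => g (x, t)) (gx (x, t))) ->
  (forall t : R, continuous (fun x : R => gx (x, t))) ->
  (forall z, `|g z| <= M * decay2 z) -> (forall z, `|gx z| <= M * decay2 z) ->
  Rintegral lam setT gx = 0.
Proof.
move=> mgx dg cgx gM gxM.
have M0 : 0 <= M := decay2_coef_ge0 (gM (0, 0)).
have mp : measurable_fun [set: R] (fun x : R => M * decay 2 x).
  by apply: measurable_funM => //; exact: measurable_decay.
have p0 (x : R) : 0 <= M * decay 2 x by rewrite mulr_ge0 ?decay_ge0.
have ip : (\int[mu]_x (M * decay 2 (x : R))%:E < +oo)%E.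
  rewrite ge0_integral_scale//; last 2 first.
  - exact: measurable_decay.
  - by move=> x; exact: decay_ge0.
  by rewrite lte_mul_pinfty ?lee_fin.
have b x t : `|gx (x, t)| <= M * decay 2 x * decay 2 t by rewrite -mulrA; exact: gxM.
have E := @Rintegral_prod R _ _ RT RT mu mu gx _ _ mgx mp (@measurable_decay R 2)
  ip integral_decay_lty p0 (fun t => decay_ge0 2 t) b.
rewrite [LHS]E (@Rintegral_swap R _ _ RT RT mu mu gx _ _ mgx mp (@measurable_decay R 2)
  ip integral_decay_lty p0 (fun t => decay_ge0 2 t) b).
rewrite (@eq_Rintegral _ _ _ _ _ (fun=> 0)); last first.
  move=> t _; apply: (@Rintegral_derivative0 R (fun x => g (x, t)) _ (M * decay 2 t)).
  - exact: cgx.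
  - apply: (@le_integrable _ RT R mu setT measurableT _ (fun x : RT => (decay 2 t * (M * decay 2 x))%:E)).
    + by apply/measurable_EFinP; exact: (measurableT_comp mgx (pair2_measurable t)).
    + by move=> x _; rewrite lee_fin (le_trans (b _ _))// mulrC ler_norm.
    + apply: (@integrableZl _ RT R mu setT measurableT (decay 2 t) (fun x : RT => (M * decay 2 x)%:E)).
      apply/integrableP; split; first exact/measurable_EFinP.
      by under eq_integral do rewrite /= ger0_norm//.
  - by move=> x; rewrite mulrAC -mulrA; exact: gM.
by rewrite Rintegral_cst// mul0r.
Qed.

Section Trig.
Variables (f : R * R -> R) (zeta : R * R).
Hypothesis rf : rapid f.

Let c z := cos (dot z zeta).
Let s z := sin (dot z zeta).

Let mdot : measurable_fun [set: plane] (fun z => dot z zeta).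
Proof. by apply: measurable_dot => //; exact: measurable_cst. Qed.

Let mc : measurable_fun [set: plane] c.
Proof. exact: (measurableT_comp (continuous_measurable_fun (@continuous_cos R)) mdot). Qed.

Let ms : measurable_fun [set: plane] s.
Proof. exact: (measurableT_comp (continuous_measurable_fun (@continuous_sin R)) mdot). Qed.

Let c1 z : `|c z| <= 1. Proof. by rewrite ler_norml cos_geN1 cos_le1. Qed.
Let s1 z : `|s z| <= 1. Proof. by rewrite ler_norml sin_geN1 sin_le1. Qed.

Let mf : measurable_fun [set: plane] (f : plane -> R).
Proof. by apply: continuous_measurable_plane; exact: rapid_continuous. Qed.

Let mfx : measurable_fun [set: plane] (partial_x f : plane -> R).
Proof. by case: rf => _ cfx _; exact: continuous_measurable_plane. Qed.

Let is_derive_dot (x t : R) : is_derive x (1 : R) (fun x => dot (x, t) zeta) zeta.1.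
Proof.
have lin : is_derive x (1 : R) (fun x => zeta.1 * x) (zeta.1 * 1) by exact: is_deriveZ.
have := is_deriveD lin (is_derive_cst (t * zeta.2) x 1).
rewrite mulr1 addr0; congr (is_derive _ _ _ _).
by apply/funext => y; rewrite /dot /= [X in _ = X + _]mulrC.
Qed.

Let bounded_mul (k : R * R -> R) (h : R * R -> R) (M : R) :
  (forall z, `|k z| <= 1) -> (forall z, `|h z| <= M * decay2 z) ->
  forall z, `|k z * h z| <= M * decay2 z.
Proof. by move=> k1 hM z; rewrite normrM (le_trans _ (hM z))// ler_piMl. Qed.

Let integrable_mul (k : R * R -> R) : measurable_fun [set: plane] (k : plane -> R) ->
  (forall z, `|k z| <= 1) ->
  lam.-integrable setT (EFin \o (fun z => k z * f z)) /\
  lam.-integrable setT (EFin \o (fun z => k z * partial_x f z)).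
Proof.
move=> mk k1; case: rf => _ _ [M fM].
split; apply: (@integrable_decay2_le _ M); try exact: measurable_funM;
  by apply: bounded_mul => // z; case: (fM z).
Qed.

Lemma integrable_cos_sin :
  [/\ lam.-integrable setT (EFin \o (fun z => c z * f z)),
      lam.-integrable setT (EFin \o (fun z => s z * f z)),
      lam.-integrable setT (EFin \o (fun z => c z * partial_x f z)) &
      lam.-integrable setT (EFin \o (fun z => s z * partial_x f z))].
Proof.
have [ic icx] := integrable_mul mc c1; have [iS isx] := integrable_mul ms s1.
by split.
Qed.

(** [k] is a cosine or a sine and [k'] its companion up to sign. The derivative in x of [k] times
    [f] has integral zero, and its two summands are the two sides. *)
Let integral_by_parts (k k' : R * R -> R) :
  measurable_fun [set: plane] (k : plane -> R) ->
  measurable_fun [set: plane] (k' : plane -> R) ->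
  (forall z, `|k z| <= 1) -> (forall z, `|k' z| <= 1) ->
  (forall x t : R, is_derive x (1 : R) (fun x => k (x, t)) (zeta.1 * k' (x, t))) ->
  (forall t, continuous (fun x : R => k (x, t))) ->
  (forall t, continuous (fun x : R => k' (x, t))) ->
  Rintegral lam setT (fun z => k z * partial_x f z) =
  - (zeta.1 * Rintegral lam setT (fun z => k' z * f z)).
Proof.
move=> mk mk' k1 k'1 dk ck ck'; case: (rf) => df cfx [M fM].
have h1 := (integrable_mul mk k1).2; have h2 := (integrable_mul mk' k'1).1.
have h2' : lam.-integrable setT (EFin \o (fun z => zeta.1 * (k' z * f z))).
  exact: (integrableZl measurableT zeta.1 h2).
have := @Rintegral_partial_x0 (fun z => k z * f z)
  (fun z => k z * partial_x f z + zeta.1 * (k' z * f z)) (M + `|zeta.1| * M).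
rewrite RintegralD// RintegralZl// => h.
apply/eqP; rewrite -subr_eq0 opprK; apply/eqP; apply: h.
- apply: measurable_funD; apply: measurable_funM => //; exact: measurable_funM.
- move=> x t; have := is_deriveM (dk x t) (is_derive_partial_x (df (x, t))).
  congr (is_derive _ _ _ _); rewrite /GRing.scale/=.
  by rewrite (mulrC (f _)) mulrA.
- move=> t x; have cf : continuous f := rapid_continuous rf.
  apply: cvgD; first apply: cvgM.
  + exact: ck.
  + exact: (continuous_section cfx).
  apply: cvgM; [exact: cvg_cst|apply: cvgM; first exact: ck'].
  exact: (continuous_section cf).
- move=> z; rewrite mulrDl.
  have b0 := bounded_mul k1 (fun z => (fM z).1) z.
  by rewrite (le_trans b0)// lerDl -mulrA mulr_ge0// (le_trans _ (fM z).1).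
- move=> z; rewrite mulrDl (le_trans (ler_normD _ _))// lerD//.
    exact: (bounded_mul k1 (fun z => (fM z).2)).
  rewrite normrM -mulrA ler_wpM2l//.
  exact: (bounded_mul k'1 (fun z => (fM z).1)).
Qed.

Let cont_dot (t : R) : continuous (fun x : R => dot (x, t) zeta).
Proof. by move=> x; exact: is_derive_continuous (is_derive_dot x t).
Qed.

Let cont_c (t : R) : continuous (fun x : R => c (x, t)).
Proof. by move=> x; exact: (@continuous_comp _ _ _ (fun x : R => dot (x, t) zeta) (@cos R) x (cont_dot (x := x)) (@continuous_cos R _)). Qed.

Let cont_s (t : R) : continuous (fun x : R => s (x, t)).
Proof. by move=> x; exact: (@continuous_comp _ _ _ (fun x : R => dot (x, t) zeta) (@sin R) x (cont_dot (x := x)) (@continuous_sin R _)). Qed.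

Lemma Rintegral_cos_partial_x :
  Rintegral lam setT (fun z => c z * partial_x f z) =
  zeta.1 * Rintegral lam setT (fun z => s z * f z).
Proof.
have mns : measurable_fun [set: plane] (fun z => - s z).
  exact: (measurableT_comp (@oppr_measurable R setT) ms).
have ns1 z : `|- s z| <= 1 by rewrite normrN.
have dc (x t : R) : is_derive x (1 : R) (fun x => c (x, t)) (zeta.1 * - s (x, t)).
  by rewrite mulrC; exact: (is_derive1_comp (is_derive_cos _) (is_derive_dot x t)).
have cns t : continuous (fun x : R => - s (x, t)) by move=> x; apply: cvgN; exact: cont_s.
rewrite (integral_by_parts mc mns c1 ns1 dc cont_c cns) -mulrN; congr (_ * _).
rewrite -[LHS]mulN1r -RintegralZl//; last first.
  rewrite (_ : _ \o _ = (fun z => (-1)%:E * (s z * f z)%:E)%E); last first.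
    by apply/funext => z; rewrite /= -EFinM mulN1r mulNr.
  by apply: (integrableZl measurableT (-1)); case: integrable_cos_sin.
by apply: eq_Rintegral => z _; rewrite mulN1r mulNr opprK.
Qed.

Lemma Rintegral_sin_partial_x :
  Rintegral lam setT (fun z => s z * partial_x f z) =
  - (zeta.1 * Rintegral lam setT (fun z => c z * f z)).
Proof.
have ds (x t : R) : is_derive x (1 : R) (fun x => s (x, t)) (zeta.1 * c (x, t)).
  by rewrite mulrC; exact: (is_derive1_comp (is_derive_sin _) (is_derive_dot x t)).
exact: (integral_by_parts ms mc s1 c1 ds cont_s cont_c).
Qed.

End Trig.

Lemma fourier_partial_x (u : R * R -> R[i]) zeta :
  rapid (fun z => complex.Re (u z)) -> rapid (fun z => complex.Im (u z)) ->
  fourier (partial_x_complex u) zeta = (0 +i* zeta.1)%C * fourier u zeta.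
Proof.
move=> ra rb; rewrite !fourierE.
set a := (fun z => complex.Re (u z)) in ra *; set b := (fun z => complex.Im (u z)) in rb *.
pose c z := cos (dot z zeta); pose s z := sin (dot z zeta).
have E (h : R * R -> R[i]) z : character zeta z * h z =
    ((c z * complex.Re (h z) + s z * complex.Im (h z)) +i*
     (c z * complex.Im (h z) - s z * complex.Re (h z)))%C.
  by rewrite /character /expi cosN sinN; case: (h z) => x y; simpc.
have RE (h : R * R -> R[i]) : cintegral lam (fun z => character zeta z * h z) =
    (Rintegral lam setT (fun z => (c z * complex.Re (h z) + s z * complex.Im (h z))) +i*
     Rintegral lam setT (fun z => (c z * complex.Im (h z) - s z * complex.Re (h z))))%C.
  by congr (_ +i* _)%C; apply: eq_Rintegral => z _; rewrite E.
rewrite !RE /partial_x_complex /=.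
have [aC aS aCx aSx] := integrable_cos_sin zeta ra.
have [bC bS bCx bSx] := integrable_cos_sin zeta rb.
rewrite (RintegralD measurableT aCx bSx) (RintegralB measurableT bCx aSx).
rewrite (RintegralD measurableT aC bS) (RintegralB measurableT bC aS).
rewrite !Rintegral_cos_partial_x// !Rintegral_sin_partial_x//.
rewrite -!/(c _) -!/(s _).
move: (Rintegral _ _ _) (Rintegral _ _ _) (Rintegral _ _ _) (Rintegral _ _ _) => A B C D.
by simpc; congr (_ +i* _)%C; ring.
Qed.

End FourierDerivative.

(** * Consequences for Schwartz functions *)

Section SchwartzFourier.
Variable R : realType.
Local Notation RT := (measurableTypeR R).
Local Notation plane := (RT * RT)%type.
Local Notation lam := (@plane_measure R).
Local Notation normc := Normc.normc.
Implicit Types (f : R * R -> R) (u v : R * R -> R[i]) (z w zeta : R * R).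

(** The bound on [g] gives 2 B, the mean value theorem gives B |x - y|, and the minimum of 1 and |x
    - y| accounts for both. *)
Let lipschitz_min (g d : R -> R) (B : R) :
  (forall x : R, is_derive x (1 : R) g (d x)) ->
  (forall x, `|g x| <= B) -> (forall x, `|d x| <= B) ->
  forall x y, `|g x - g y| <= 2 * B * Num.min 1 `|x - y|.
Proof.
move=> dg gB dB.
have B0 : 0 <= B by rewrite (le_trans _ (gB 0)).
have lip x y : x <= y -> `|g y - g x| <= B * (y - x).
  move=> xy; have cg : {within `[x, y], continuous g}.
    by apply: continuous_subspaceT => z; exact: is_derive_continuous (dg z).
  have [c _ ->] := MVT_segment xy (fun c _ => dg c) cg.
  by rewrite normrM (ger0_norm (_ : 0 <= y - x)) ?subr_ge0// ler_wpM2r ?subr_ge0.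
have lip2 x y : `|g x - g y| <= B * `|x - y|.
  have [xy|/ltW yx] := leP x y.
    by rewrite distrC (distrC x) (ger0_norm (_ : 0 <= y - x)) ?subr_ge0//; exact: lip.
  by rewrite (ger0_norm (_ : 0 <= x - y)) ?subr_ge0//; exact: lip.
move=> x y; rewrite /Num.min; case: ifP => _.
  by rewrite mulr1 mulr_natl mulr2n (le_trans (ler_normB _ _))// lerD.
by rewrite (le_trans (lip2 x y))// ler_wpM2r// ler_peMl// ler1n.
Qed.

(** The two points are joined along the axes, so one-variable estimates with the two partial
    derivatives are enough. *)
Lemma schwartz_lipschitz f : schwartz_real f ->
  exists2 K, 0 <= K & forall z w, `|f z - f w| <= K * unit_dist (vsub w z).
Proof.
move=> sf; have [sm _] := sf; have df z : differentiable f z := sm [::] z.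
have [M0 h0] := schwartz_decay [::] sf; have [M1 h1] := schwartz_decay [:: true] sf.
have [M2 h2] := schwartz_decay [:: false] sf.
have bnd (g : R * R -> R) (M : R) : (forall z, `|g z| <= M * decay2 z) -> forall z, `|g z| <= M.
  move=> gM z; have M0' : 0 <= M := decay2_coef_ge0 (gM z).
  by rewrite (le_trans (gM z))// ler_piMr// decay2_le1.
have b0 := bnd _ _ h0; have b1 := bnd _ _ h1; have b2 := bnd _ _ h2.
pose B := M0 + M1 + M2.
have p0 : 0 <= M0 := le_trans (normr_ge0 _) (b0 (0, 0)).
have p1 : 0 <= M1 := le_trans (normr_ge0 _) (b1 (0, 0)).
have p2 : 0 <= M2 := le_trans (normr_ge0 _) (b2 (0, 0)).
have B0 z : `|f z| <= B by rewrite (le_trans (b0 z))// /B -addrA lerDl addr_ge0.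
have B1 z : `|partial_x f z| <= B by rewrite (le_trans (b1 z))// /B addrAC lerDr addr_ge0.
have B2 z : `|partial_t f z| <= B by rewrite (le_trans (b2 z))// /B lerDr addr_ge0.
exists (2 * B); first by rewrite mulr_ge0// !addr_ge0.
case=> [z1 z2] [w1 w2]; rewrite /unit_dist /= mulrDr (distrC w1) (distrC w2).
rewrite (_ : f (z1, z2) - f (w1, w2) =
  (f (z1, z2) - f (w1, z2)) + (f (w1, z2) - f (w1, w2))); last by rewrite addrA subrK.
apply: (le_trans (ler_normD _ _)); apply: lerD.
  apply: (@lipschitz_min (fun x => f (x, z2)) (fun x => partial_x f (x, z2))) => // x.
  exact: is_derive_partial_x.
apply: (@lipschitz_min (fun t => f (w1, t)) (fun t => partial_t f (w1, t))) => // t.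
exact: is_derive_partial_t.
Qed.

Lemma schwartz_complex_lipschitz u : schwartz u ->
  exists2 K, 0 <= K & forall z w, normc (u z - u w) <= K * unit_dist (vsub w z).
Proof.
move=> [/schwartz_lipschitz[K1 K10 h1] /schwartz_lipschitz[K2 K20 h2]].
exists (K1 + K2); first exact: addr_ge0.
move=> z w; apply: (le_trans (normc_le _)); rewrite !raddfB/= mulrDl.
by apply: lerD; [exact: h1|exact: h2].
Qed.

Lemma schwartz_complex_decay u : schwartz u ->
  exists2 M, 0 <= M & forall z, normc (u z) <= M * decay2 z.
Proof.
move=> [/(schwartz_decay [::])[M1 h1] /(schwartz_decay [::])[M2 h2]].
exists (M1 + M2).
  exact: addr_ge0 (decay2_coef_ge0 (h1 (0, 0))) (decay2_coef_ge0 (h2 (0, 0))).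
move=> z; apply: (le_trans (normc_le _)); rewrite mulrDl.
by apply: lerD; [exact: h1|exact: h2].
Qed.

Lemma schwartz_cmeasurable u : schwartz u -> cmeasurable (u : plane -> R[i]).
Proof.
by move=> [s1 s2]; split; apply: continuous_measurable_plane;
  apply: rapid_continuous; exact: schwartz_rapid.
Qed.

Let measurable_scaled_decay2 (M : R) : measurable_fun [set: plane] (fun z => M * decay2 z).
Proof. by apply: measurable_funM => //; exact: measurable_decay2. Qed.

Lemma cmeasurable_fourier_schwartz u : schwartz u ->
  cmeasurable (fourier u : plane -> R[i]).
Proof.
move=> su; have [M M0 hM] := schwartz_complex_decay su.
apply: (cmeasurable_fourier_of (schwartz_cmeasurable su) (measurable_scaled_decay2 M) hM).
exact: le_lt_trans (integral_scaled_decay2 M0) (ltry _).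
Qed.

Lemma fourier_partial_x_product u v zeta : schwartz u -> schwartz v ->
  fourier (partial_x_complex (fun z => u z * v z)) zeta =
  (0 +i* zeta.1)%C * fourier (fun z => u z * v z) zeta.
Proof.
move=> [/schwartz_rapid ra /schwartz_rapid rb] [/schwartz_rapid rc /schwartz_rapid rd].
apply: fourier_partial_x.
- have := rapidD (rapidM ra rc) (rapidN (rapidM rb rd)); congr rapid.
  by apply/funext => z; case: (u z) (v z) => ? ? [? ?].
- have := rapidD (rapidM ra rd) (rapidM rb rc); congr rapid.
  by apply/funext => z; case: (u z) (v z) => ? ? [? ?].
Qed.

Lemma cmeasurable_fourier_partial_x_product u v : schwartz u -> schwartz v ->
  cmeasurable (fourier (partial_x_complex (fun z => u z * v z)) : plane -> R[i]).
Proof.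
move=> su sv; have [M M0 hM] := schwartz_complex_decay su.
have [N N0 hN] := schwartz_complex_decay sv.
rewrite (_ : fourier _ = (fun z : plane => (0 +i* z.1)%C * fourier (fun z => u z * v z) z)); last first.
  by apply/funext => z; exact: fourier_partial_x_product.
have mi : cmeasurable (fun z : plane => (0 +i* z.1)%C : R[i]).
  by split; [exact: (measurable_cst (0 : R))|exact: measurable_fst].
apply: (cmeasurableM mi).
have muv : cmeasurable (fun z : plane => u z * v z).
  by apply: cmeasurableM; exact: schwartz_cmeasurable.
apply: (cmeasurable_fourier_of muv (measurable_scaled_decay2 (M * N))) => [z|].
  rewrite Normc.normcM (le_trans (ler_pM _ _ (hM z) (hN z))) ?normc_ge0//.
  by rewrite mulrACA ler_wpM2l ?mulr_ge0// ler_piMr ?decay2_ge0 ?decay2_le1.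
exact: le_lt_trans (integral_scaled_decay2 (mulr_ge0 M0 N0)) (ltry _).
Qed.

Lemma normc_fourier_partial_x_product u v zeta : schwartz u -> schwartz v ->
  ((normc (fourier (partial_x_complex (fun z => (u z * v z)%R)) zeta))%:E <=
   `|zeta.1|%:E * \int[lam]_z (normc (fourier u z) * normc (fourier v (vsub zeta z)))%:E)%E.
Proof.
move=> su sv; have [K K0 hK] := schwartz_complex_lipschitz su.
have [M M0 hM] := schwartz_complex_decay su; have [N N0 hN] := schwartz_complex_decay sv.
rewrite fourier_partial_x_product//.
rewrite Normc.normcM EFinM (_ : normc (0 +i* zeta.1)%C = `|zeta.1|); last first.
  by rewrite normcE/= expr0n/= add0r sqrtr_sqr.
rewrite lee_wpmul2l ?lee_fin//.
exact: (normc_fourier_product_le (schwartz_cmeasurable su) (schwartz_cmeasurable sv)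
  (measurable_scaled_decay2 M) (measurable_scaled_decay2 N) hM hN
  (integral_scaled_decay2 M0) (integral_scaled_decay2 N0) K0 hK).
Qed.

End SchwartzFourier.

(** * Duality *)

Section Duality.
Variable R : realType.
Local Notation RT := (measurableTypeR R).
Local Notation plane := (RT * RT)%type.
Local Notation lam := (@plane_measure R).
Implicit Types (H h : R * R -> R).

Lemma sqrt_poweR_sqr (B : \bar R) : (0 <= B)%E -> ((B * B) `^ 2^-1 = B)%E.
Proof.
move=> B0; rewrite poweRM//; case: B B0 => [b| |]//.
  by rewrite lee_fin => b0; rewrite poweR_EFin powR12_sqrt// -EFinM -expr2 sqr_sqrtr.
by move=> _; rewrite poweRyr ?mulyy// invr_eq0.
Qed.

Lemma sqr_sqrt_poweR (B : \bar R) : (0 <= B)%E -> (B `^ 2^-1 * B `^ 2^-1 = B)%E.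
Proof. by move=> B0; rewrite -poweRM// sqrt_poweR_sqr. Qed.

(* [H] may have infinite norm, so it is tested against the truncations
   [min H (n * decay2)], which have finite norm and increase to [H]. *)
Lemma plane_norm_le_dual H (B : \bar R) :
  measurable_fun [set: plane] (H : plane -> R) -> (forall z, 0 <= H z) -> (0 <= B)%E ->
  (forall h, measurable_fun [set: plane] (h : plane -> R) -> (forall z, 0 <= h z) ->
    (\int[lam]_z (h z * H z)%:E <= B * plane_norm h)%E) ->
  (plane_norm H <= B)%E.
Proof.
move=> mH H0 B0 dual.
pose h (n : nat) z := Num.min (H z) (n%:R * decay2 z).
have mh n : measurable_fun [set: plane] (h n : plane -> R).
  by apply: measurable_minr => //; apply: measurable_funM => //; exact: measurable_decay2.
have h0 n z : 0 <= h n z by rewrite le_min H0 mulr_ge0 ?decay2_ge0.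
have hH n z : h n z <= H z by rewrite ge_min lexx.
have m2 n : measurable_fun [set: plane] (fun z : plane => (h n z ^+ 2)%:E).
  by apply/measurable_EFinP; exact: measurable_funX.
have i0 n : (0 <= \int[lam]_z (h n z ^+ 2)%:E)%E.
  by apply: integral_EFin_ge0 => z; exact: sqr_ge0.
have fin n : (\int[lam]_z (h n z ^+ 2)%:E < +oo)%E.
  have N0 : 0 <= (n%:R : R) ^+ 2 by rewrite sqr_ge0.
  apply: le_lt_trans (le_lt_trans (integral_scaled_decay2 N0) (ltry _)).
  apply: ge0_le_integral_EFin.
  - exact: measurable_funX.
  - by apply: measurable_funM => //; exact: measurable_decay2.
  - by move=> z; exact: sqr_ge0.
  - move=> z; apply: (@le_trans _ _ ((n%:R * decay2 z) ^+ 2)).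
      have hb : h n z <= n%:R * decay2 z by rewrite /h ge_min lexx orbT.
      by rewrite ler_sqr ?nnegrE ?(le_trans (h0 n z)).
    by rewrite exprMn ler_wpM2l// expr2 ler_piMr ?decay2_ge0 ?decay2_le1.
have hn n : (\int[lam]_z (h n z ^+ 2)%:E <= B * B)%E.
  (* The truncation is tested against itself: as it lies below [H], its squared norm is at most [B]
     times its norm, and the norm, being finite, can be cancelled. *)
  have le1 : (\int[lam]_z (h n z ^+ 2)%:E <= B * plane_norm (h n))%E.
    apply: le_trans (dual _ (mh n) (h0 n)); apply: ge0_le_integral_EFin.
    - exact: measurable_funX.
    - exact: measurable_funM.
    - by move=> z; exact: sqr_ge0.
    - by move=> z; rewrite expr2 ler_wpM2l.
  rewrite -(sqr_sqrt_poweR (i0 n)) -/(plane_norm (h n)) in le1 *.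
  have y0 : (0 <= plane_norm (h n))%E := poweR_ge0 _ _.
  have yfin : plane_norm (h n) \is a fin_num.
    by rewrite ge0_fin_numE//; exact: poweR_lty.
  suff yB : (plane_norm (h n) <= B)%E by exact: lee_pmul.
  move: y0; rewrite le_eqVlt => /predU1P[<-//|ypos].
  by rewrite muleC lee_pmul2l// in le1.
have nd (z : plane) : [set: plane] z -> {homo (fun n => (h n z ^+ 2)%:E) : n m / (n <= m)%N >-> (n <= m)%E}.
  move=> _ n m nm; rewrite lee_fin ler_sqr ?nnegrE// le_min hH/=.
  by rewrite ge_min ler_wpM2r ?decay2_ge0 ?orbT// ler_nat.
have g0 n (z : plane) : [set: plane] z -> (0 <= (h n z ^+ 2)%:E)%E.
  by move=> _; rewrite lee_fin sqr_ge0.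
have lim := @cvg_monotone_convergence _ plane R lam setT measurableT
  (fun n z => (h n z ^+ 2)%:E) m2 g0 nd.
have cvgH : (\int[lam]_z (H z ^+ 2)%:E <= B * B)%E.
  rewrite (_ : (\int[lam]_z (H z ^+ 2)%:E)%E =
      limn (fun n => \int[lam]_z (h n z ^+ 2)%:E)%E); last first.
    rewrite (cvg_lim _ lim)//; apply: eq_integral => z _; apply/esym/cvg_lim => //.
    apply: cvg_near_cst; near=> n; congr (_ ^+ 2)%:E; rewrite /h.
    apply: min_l; rewrite -ler_pdivrMr ?decay2_gt0//.
    by near: n; exact: nbhs_infty_ger.
  by apply: lime_le; [apply/cvg_ex; eexists; exact: lim|exact: nearW].
rewrite -[leRHS](sqrt_poweR_sqr B0); apply: gt0_ler_poweR => //.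
- by rewrite in_itv/= leey andbT integral_ge0// => z _; rewrite lee_fin sqr_ge0.
- by rewrite in_itv/= leey andbT mule_ge0.
Unshelve. all: by end_near. Qed.

End Duality.

(** * The bilinear estimate in the Bourgain spaces *)

Section BilinearEstimate.
Variable R : realType.
Local Notation RT := (measurableTypeR R).
Local Notation plane := (RT * RT)%type.
Local Notation lam := (@plane_measure R).
Local Notation normc := Normc.normc.
Implicit Types (u v : R * R -> R[i]) (z w : R * R) (b s a : R).

Definition weighted_fourier b s a u z : R := Xweight b s a z * normc (fourier u z).

Lemma XnormE b s a u : Xnorm b s a u = plane_norm (weighted_fourier b s a u).
Proof.
rewrite /Xnorm /L2norm unlock /plane_norm; congr (_ `^ _)%E.
apply: eq_integral => z _; rewrite poweR_EFin powR_mulrn ?normr_ge0//; congr (_ ^+ 2)%:E.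
rewrite ger0_norm ?normc_ge0// Normc.normcM normc_real.
by rewrite (ger0_norm (Xweight_ge0 _ _ _ _)).
Qed.

Let measurable_sqrt : measurable_fun [set: R] (@Num.sqrt R).
Proof. by apply: continuous_measurable_fun; exact: sqrt_continuous. Qed.

Lemma measurable_Xweight b s a : measurable_fun [set: plane] (Xweight b s a : plane -> R).
Proof.
rewrite (_ : Xweight b s a = (fun z => expR (b * ln (modulation a z) + s * ln (bracket (z.1%:C)%C)))).
  have m1 : measurable_fun [set: plane] (modulation a : plane -> R).
    rewrite (_ : modulation a = (fun z => Num.sqrt (1 + ((`|z.1| `^ (2 * a)) ^+ 2 + (z.2 - z.1 ^+ 3) ^+ 2)))).
      apply: (measurableT_comp measurable_sqrt); apply: measurable_funD => //.
      apply: measurable_funD; apply: measurable_funX.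
        apply: (measurableT_comp (measurable_powR _)).
        exact: (measurableT_comp (@normr_measurable R setT) measurable_fst).
      by apply: measurable_funB => //; exact: measurable_funX.
    by apply/funext => z; rewrite /modulation bracketE.
  have m2 : measurable_fun [set: plane] (fun z : plane => bracket (z.1%:C)%C).
    rewrite (_ : (fun z : plane => _) = (fun z : plane => Num.sqrt (1 + (z.1 ^+ 2 + 0 ^+ 2)))).
      apply: (measurableT_comp measurable_sqrt); apply: measurable_funD => //.
      by apply: measurable_funD => //; exact: measurable_funX.
    by apply/funext => z; rewrite bracketE.
  apply: (measurableT_comp (@measurable_expR R)); apply: measurable_funD; apply: measurable_funM => //.
    exact: (measurableT_comp (@measurable_ln R) m1).
  exact: (measurableT_comp (@measurable_ln R) m2).
by apply/funext => z; rewrite XweightE.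
Qed.

Lemma weighted_fourier_ge0 b s a u z : 0 <= weighted_fourier b s a u z.
Proof. by rewrite mulr_ge0 ?Xweight_ge0 ?normc_ge0. Qed.

Lemma measurable_weighted_fourier b s a u : cmeasurable (fourier u : plane -> R[i]) ->
  measurable_fun [set: plane] (weighted_fourier b s a u : plane -> R).
Proof.
move=> mu; apply: measurable_funM; first exact: measurable_Xweight.
exact: cmeasurable_normc.
Qed.

(** The modulation bracket is at least 1. This reduces every delta < q to the exponent q, with one
    constant for all of them. *)
Lemma Xweight_le b b' s a z : b <= b' -> Xweight b s a z <= Xweight b' s a z.
Proof.
move=> bb; rewrite !XweightE ler_expR lerD2r ler_wpM2r//.
by rewrite ln_ge0// bracket_ge1.
Qed.

Let measurable_schur_majorant (p e : R) d (T : measurableType d) (f g : T -> plane) :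
  measurable_fun [set: T] f -> measurable_fun [set: T] g ->
  measurable_fun [set: T] (fun x => schur_majorant p e (f x) (g x)).
Proof.
move=> mf mg; apply: measurable_funD; first apply: measurable_funD.
- exact: (measurableT_comp measurable_sqrt (measurable_schur_weight p e mf mg)).
- exact: (measurableT_comp measurable_sqrt (measurable_schur_weight p e mg mf)).
- exact: (measurableT_comp measurable_sqrt
    (measurable_schur_weight p e (measurable_vsub mf mg) mf)).
Qed.

Let mule_rotate (c k x y t : \bar R) :
  (c * (k * (x * y * t)) = c * k * y * t * x)%E.
Proof. by rewrite -!muleA; congr (_ * (_ * _))%E; rewrite muleC -muleA. Qed.

Lemma bilinear_estimate a s : 0 < a -> a <= 1 -> s_crit a < s -> s <= 0 ->
  exists q C : R, [/\ 0 < q, 0 < C & forall delta : R, delta < q ->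
    forall u v, schwartz u -> schwartz v ->
    (Xnorm (- (1 / 2) + delta) s a (partial_x_complex (fun z => (u z * v z)%R)) <=
     C%:E * Xnorm (1 / 2) s a u * Xnorm (1 / 2) s a v)%E].
Proof.
move=> a0 a1 hs hs0; have [q [p [e [C [q0 _ p1 C0 key]]]]] := kernel_bound a0 a1 hs hs0.
pose A := 3 * Num.sqrt (6 * decay_mass p ^+ 2).
have A0 : 0 < A.
  by rewrite mulr_gt0// sqrtr_gt0 mulr_gt0// exprn_gt0// decay_mass_gt0.
exists q, (C * A); split; [by []|exact: mulr_gt0|move=> delta dq u v su sv].
rewrite !XnormE; set F := weighted_fourier (1 / 2) s a u.
set G := weighted_fourier (1 / 2) s a v.
set uv := partial_x_complex _; set H := weighted_fourier _ s a uv.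
have mF : measurable_fun [set: plane] (F : plane -> R).
  by apply: measurable_weighted_fourier; exact: cmeasurable_fourier_schwartz.
have mG : measurable_fun [set: plane] (G : plane -> R).
  by apply: measurable_weighted_fourier; exact: cmeasurable_fourier_schwartz.
have F0 z : 0 <= F z := weighted_fourier_ge0 _ _ _ _ _.
have G0 z : 0 <= G z := weighted_fourier_ge0 _ _ _ _ _.
have mH : measurable_fun [set: plane] (H : plane -> R).
  apply: measurable_weighted_fourier.
  exact: cmeasurable_fourier_partial_x_product.
have B0 : (0 <= (C * A)%:E * plane_norm F * plane_norm G)%E.
  by rewrite !mule_ge0 ?poweR_ge0// lee_fin mulr_ge0 ?ltW.
apply: plane_norm_le_dual => //; first by move=> z; exact: weighted_fourier_ge0.
move=> h mh h0.
pose J w z := schur_majorant p e w z * (F z * G (vsub w z)).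
have J0 w z : 0 <= J w z.
  by rewrite mulr_ge0 ?(mulr_ge0 (F0 _) (G0 _))// !addr_ge0 ?sqrtr_ge0.
have mJ w : measurable_fun [set: plane] (J w : plane -> R).
  apply: measurable_funM.
    by apply: measurable_schur_majorant => //; exact: measurable_cst.
  apply: measurable_funM => //; apply: (measurableT_comp mG).
  by apply: measurable_vsub => //; exact: measurable_cst.
(* The kernel bound moves the output weight and the factor |xi| onto the two inputs inside the
   convolution integral, so only the majorant separates the weighted output from [F] and [G]. *)
have HJ w : ((H w)%:E <= C%:E * \int[lam]_z (J w z)%:E)%E.
  have h1 := normc_fourier_partial_x_product w su sv.
  rewrite -/uv in h1.
  pose k z := normc (fourier u z) * normc (fourier v (vsub w z)).
  have k0 z : 0 <= k z by rewrite mulr_ge0 ?normc_ge0.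
  have mk : measurable_fun [set: plane] (k : plane -> R).
    apply: measurable_funM; apply: cmeasurable_normc.
      exact: cmeasurable_fourier_schwartz.
    apply: (cmeasurable_comp (cmeasurable_fourier_schwartz sv)).
    by apply: measurable_vsub => //; exact: measurable_cst.
  have X0 := Xweight_ge0 (- (1 / 2) + delta) s a w.
  have Xq := Xweight_le s a w (_ : - (1 / 2) + delta <= - (1 / 2) + q).
  rewrite /H /weighted_fourier EFinM.
  apply: (le_trans (lee_pmul _ _ (_ : (Xweight (- (1 / 2) + delta) s a w)%:E <=
    (Xweight (- (1 / 2) + q) s a w)%:E)%E h1)).
  - by rewrite lee_fin.
  - by rewrite lee_fin normc_ge0.
  - by rewrite lee_fin Xweight_le// lerD2l ltW.
  rewrite muleA -EFinM (mulrC (Xweight _ _ _ _)) -(ge0_integral_scale _ mk k0);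
    last exact: mulr_ge0 (normr_ge0 _) (Xweight_ge0 _ _ _ _).
  rewrite -(ge0_integral_scale _ (mJ w) (J0 w)) ?(ltW C0)//.
  apply: ge0_le_integral_EFin.
  - exact: measurable_funM.
  - exact: measurable_funM.
  - by move=> z; rewrite mulr_ge0// mulr_ge0 ?Xweight_ge0.
  move=> z.
  apply: (le_trans (ler_wpM2r (k0 z) (key w z))).
  apply: le_of_eq; rewrite /J /F /G /weighted_fourier /k.
  move: (schur_majorant _ _ _ _) (Xweight _ _ _ _) (Xweight _ _ _ _) (normc _) (normc _) => *.
  by ring.
pose W w := (\int[lam]_z (h w * J w z)%:E)%E.
have mJ2 : measurable_fun [set: plane * plane] (fun x : plane * plane => h x.1 * J x.1 x.2).
  apply: measurable_funM; first exact: (measurable_comp1 mh).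
  apply: measurable_funM; last exact: (measurable_funM (measurable_comp2 mF) (measurable_comp12 mG)).
  exact: measurable_schur_majorant.
have W0 w : (0 <= W w)%E.
  by apply: integral_EFin_ge0 => z; rewrite mulr_ge0.
have mW : measurable_fun [set: plane] W.
  apply: (@measurable_fun_fubini_tonelli_F _ _ plane plane R lam
    (fun x : plane * plane => (h x.1 * J x.1 x.2)%:E)).
    exact/measurable_EFinP.
  by move=> x; rewrite lee_fin mulr_ge0.
have hHW : (\int[lam]_w (h w * H w)%:E <= C%:E * \int[lam]_w W w)%E.
  rewrite -ge0_integralZl_EFin ?(ltW C0)//.
  apply: ge0_le_integral => //.
  - by move=> w _; rewrite lee_fin mulr_ge0 ?weighted_fourier_ge0.
  - by apply/measurable_EFinP; exact: measurable_funM.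
  - by apply: emeasurable_funM.
  move=> w _; rewrite EFinM /W ge0_integral_scale//.
  by rewrite muleCA lee_wpmul2l ?lee_fin.
apply: (le_trans hHW).
have tri := trilinear_schur e p1 mh mF mG h0 F0 G0.
apply: (le_trans (lee_wpmul2l _ tri)); first by rewrite lee_fin ltW.
rewrite -/A [in leRHS]EFinM; apply: le_of_eq.
exact: mule_rotate.
Qed.

End BilinearEstimate.

Theorem proposition3p1 (R : realType) (alpha s : R)
    (halpha0 : 0 < alpha) (halpha1 : alpha <= 1)
    (hs : s_crit alpha < s) (hs0 : s <= 0) :
  exists delta0 : R, 0 < delta0 /\
  exists C : R, 0 < C /\
  forall delta : R, 0 < delta -> delta < delta0 ->
  forall u v : R * R -> R[i], schwartz u -> schwartz v ->
  (Xnorm (- (1 / 2) + delta) s alpha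
     (partial_x_complex (fun z => (u z * v z)%R)) <=
   C%:E * Xnorm (1 / 2) s alpha u * Xnorm (1 / 2) s alpha v)%E.
Proof.
have [q [C [q0 C0 H]]] := bilinear_estimate halpha0 halpha1 hs hs0.
exists q; split => //; exists C; split => // delta _ dq u v su sv.
exact: H.
Qed.
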